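(* Consider the bilevel problem in expectation form, $f(x,y)=\mathbb E_\xi[F(x,y;\xi)]$, $g(x,y)=\mathbb E_\zeta[G(x,y;\zeta)]$. Fix a number of iterations $K>1$ and assume: (i) $\nabla f$ is $L^f$-Lipschitz in $(x,y)$, and there is $C^f>0$ with $\|\nabla_2 f(x,y^*(x))\|\le C^f$ for all $x$; (ii) $\nabla g$ and $\nabla^2 g$ are $L_1^g$- and $L_2^g$-Lipschitz in $(x,y)$, respectively, and $g(x,\cdot)$ is $\mu$-strongly convex for every $x$; (iii) there are positive constants $\sigma_f,\sigma_{g,1},\sigma_{g,2}$ with $\mathbb E\|\nabla F(x,y;\xi)-\nabla f(x,y)\|^2\le\sigma_f^2$, $\mathbb E\|\nabla G(x,y;\zeta)-\nabla g(x,y)\|^2\le\sigma_{g,1}^2$, $\mathbb E\|\nabla^2G(x,y;\zeta)-\nabla^2g(x,y)\|^2\le\sigma_{g,2}^2$; (iv) $\nabla F(x,y;\xi)$, $\nabla G(x,y;\zeta)$, $\nabla^2G(x,y;\zeta)$ are $L^f$-, $L_1^g$-, $L_2^g$-Lipschitz in $(x,y)$, respectively. Choose minibatch sizes $\tau'$ and $b<\tau'$ and a probability $p\in(0,1]$. Then there exist positive constants $c$, $c_\beta$, $c_\gamma$ and $\sigma$ such that if $$\alpha_k\le\frac{c}{1+\sqrt{\frac{1-p}{pb}}},\qquad\beta_k=c_\beta\alpha_k,\qquad\gamma_k=c_\gamma\alpha_k,$$ then the iterates of SPABA (expectation version) satisfy $$\frac1K\sum_{k=0}^{K-1}\mathbb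 E\left[\|\nabla H(x_k)\|^2\right]=\mathcal O\left(\frac{1+\sqrt{\frac{1-p}{pb}}}{K}+\frac1{Kp\tau'}+\frac{\sigma}{\tau'}\right).$$
   Context: Bilevel problem: minimize $H(x)=f(x,y^*(x))$ over $x\in\mathbb{R}^{d_x}$, where $y^*(x)=\arg\min_{y\in\mathbb{R}^{d_y}}g(x,y)$ and $f,g$ are smooth real-valued functions on $\mathbb{R}^{d_x}\times\mathbb{R}^{d_y}$. $\nabla_1,\nabla_2$ are the partial gradients in $x$ and $y$; $\nabla_{12}^2$ ($d_x\times d_y$) and $\nabla_{22}^2$ ($d_y\times d_y$) are blocks of the Hessian. Let $R=C^f/\mu$ and let $\mathrm{Proj}_{\mathbb B(R)}$ be the Euclidean projection onto the ball of radius $R$ centered at $0$ in $\mathbb R^{d_y}$. SPABA (expectation version). The inputs are initial directions $(v_{-1}^x,v_{-1}^y,v_{-1}^z)$, initial points $(x_{-1},y_{-1},z_{-1})$ and $(x_0,y_0,z_0)$, the number of iterations $K$, step sizes $\alpha_k,\beta_k,\gamma_k$, minibatch sizes $b,\tau'$, the probability $p$ and the constant $R$. For a finite sample $I$ of copies of $\xi$, a finite sample $J$ of copies of $\zeta$, and $u=(x,y,z)$, let $$\widehat D_x(u;I,J)=\tfrac1{|I|}\sum_{\xi\in I}\nabla_1F(x,y;\xi)-\tfrac1{|J|}\sum_{\zeta\in J}\nabla_{12}^2G(x,y;\zeta)z,\qquad \widehat D_y(u;I,J)=\tfrac1{|J|}\sum_{\zeta\in J}\nabla_2G(x,y;\zeta),$$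 $$\widehat D_z(u;I,J)=\tfrac1{|J|}\sum_{\zeta\in J}\nabla_{22}^2G(x,y;\zeta)z-\tfrac1{|I|}\sum_{\xi\in I}\nabla_2F(x,y;\xi).$$ At iteration $k$, with $u_k=(x_k,y_k,z_k)$ and newly drawn samples, for each $\bullet\in\{x,y,z\}$, $$v_k^\bullet=\begin{cases}\widehat D_\bullet(u_k;I',J'),\ |I'|=|J'|=\tau'&\text{with probability }p,\\ v_{k-1}^\bullet+\widehat D_\bullet(u_k;I,J)-\widehat D_\bullet(u_{k-1};I,J),\ |I|=|J|=b&\text{with probability }1-p.\end{cases}$$ Updates: $x_{k+1}=x_k-\alpha_kv_k^x$, $y_{k+1}=y_k-\beta_kv_k^y$, $z_{k+1}=\mathrm{Proj}_{\mathbb B(R)}(z_k-\gamma_kv_k^z)$.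
   Formalization: H is assumed bounded below; α_k is also at least a fraction θ>0 of its upper bound; (1-p)/p times the initial error of v_{-1}, u_{-1}, z_0 is at most Λ(1+√((1-p)/(pb))+1/(pτ')); the O-constant may depend on u_0, θ and Λ. *)

(* Defs.v *)
From HB Require Import structures.
From mathcomp Require Export all_boot all_order all_algebra.
From mathcomp Require Export all_classical all_reals all_analysis.
Set Implicit Arguments.
Unset Strict Implicit.
Unset Printing Implicit Defensive.
Export Order.TTheory GRing.Theory Num.Theory.
Export numFieldNormedType.Exports.
Local Open Scope classical_set_scope.
Local Open Scope ring_scope.

(* The library norm on matrices is the maximum norm, so the Euclidean norm of
   column vectors and the operator norm it induces are defined here. The library
   norm is used only through the (equivalent) topology underlying [derive] and
   [differentiable]. *)
Definition enorm (R : realType) (n : nat) (v : 'cV[R]_n) : R :=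
  Num.sqrt (\sum_(i < n) v i 0 ^+ 2).

Definition opnorm (R : realType) (m n : nat) (A : 'M[R]_(m, n)) : R :=
  sup [set enorm (A *m v) | v in [set v : 'cV[R]_n | enorm v <= 1]].

Definition grad (R : realType) (n : nat) (h : 'cV[R]_n -> R) (w : 'cV[R]_n) :
    'cV[R]_n :=
  \col_i 'D_(delta_mx i 0) h w.

Definition hess (R : realType) (n : nat) (h : 'cV[R]_n -> R) (w : 'cV[R]_n) :
    'M[R]_n :=
  \matrix_(i, j) 'D_(delta_mx j 0) (fun u => grad h u i 0) w.

(* A point (x, y) of R^dx * R^dy is the column [col_mx x y], so that partial
   gradients and Hessian blocks are blocks of [grad] and [hess]. *)
Definition grad1 (R : realType) (dx dy : nat) (h : 'cV[R]_(dx + dy) -> R)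
    (x : 'cV[R]_dx) (y : 'cV[R]_dy) : 'cV[R]_dx :=
  usubmx (grad h (col_mx x y)).

Definition grad2 (R : realType) (dx dy : nat) (h : 'cV[R]_(dx + dy) -> R)
    (x : 'cV[R]_dx) (y : 'cV[R]_dy) : 'cV[R]_dy :=
  dsubmx (grad h (col_mx x y)).

Definition hess12 (R : realType) (dx dy : nat) (h : 'cV[R]_(dx + dy) -> R)
    (x : 'cV[R]_dx) (y : 'cV[R]_dy) : 'M[R]_(dx, dy) :=
  ursubmx (hess h (col_mx x y)).

Definition hess22 (R : realType) (dx dy : nat) (h : 'cV[R]_(dx + dy) -> R)
    (x : 'cV[R]_dx) (y : 'cV[R]_dy) : 'M[R]_dy :=
  drsubmx (hess h (col_mx x y)).

Definition everywhere_differentiable (R : realType) (n : nat)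
    (h : 'cV[R]_n -> R) : Prop :=
  forall w, differentiable h w.

Definition twice_differentiable (R : realType) (n : nat)
    (h : 'cV[R]_n -> R) : Prop :=
  everywhere_differentiable h /\
  forall i, everywhere_differentiable (fun w => grad h w i 0).

Definition lipschitz_grad (R : realType) (n : nat) (L : R)
    (h : 'cV[R]_n -> R) : Prop :=
  forall w w', enorm (grad h w - grad h w') <= L * enorm (w - w').

Definition lipschitz_hess (R : realType) (n : nat) (L : R)
    (h : 'cV[R]_n -> R) : Prop :=
  forall w w', opnorm (hess h w - hess h w') <= L * enorm (w - w').

Definition strongly_convex (R : realType) (n : nat) (mu : R)
    (h : 'cV[R]_n -> R) : Prop :=
  forall (y y' : 'cV[R]_n) (t : R), 0 <= t <= 1 ->
    h (t *: y + (1 - t) *: y') <=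
      t * h y + (1 - t) * h y' - mu / 2 * (t * (1 - t)) * enorm (y - y') ^+ 2.

(* Junk value when [h] has no minimizer on [A]; below the minimizer always
   exists and is unique. *)
Definition argmin (R : realType) (n : nat) (A : set 'cV[R]_n)
    (h : 'cV[R]_n -> R) : 'cV[R]_n :=
  get [set a | A a /\ forall b, A b -> h a <= h b].

Definition proj_ball (R : realType) (n : nat) (r : R) (v : 'cV[R]_n) :
    'cV[R]_n :=
  argmin [set w | enorm w <= r] (fun w => enorm (w - v)).

Definition lower_sol (R : realType) (dx dy : nat) (g : 'cV[R]_(dx + dy) -> R)
    (x : 'cV[R]_dx) : 'cV[R]_dy :=
  argmin setT (fun y => g (col_mx x y)).

Definition hyperobjective (R : realType) (dx dy : nat)
    (f g : 'cV[R]_(dx + dy) -> R) (x : 'cV[R]_dx) : R :=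
  f (col_mx x (lower_sol g x)).

Definition expectation_of (R : realType) (d : measure_display)
    (S : measurableType d) (Q : probability S R) (n : nat)
    (F : 'cV[R]_n -> S -> R) (f : 'cV[R]_n -> R) : Prop :=
  forall w, Q.-integrable setT (EFin \o F w) /\
    (f w)%:E = (\int[Q]_s (F w s)%:E)%E.

Definition grad_variance_le (R : realType) (d : measure_display)
    (S : measurableType d) (Q : probability S R) (n : nat)
    (F : 'cV[R]_n -> S -> R) (f : 'cV[R]_n -> R) (sigma : R) : Prop :=
  forall w, (\int[Q]_s (enorm (grad (F^~ s) w - grad f w) ^+ 2)%:E
    <= (sigma ^+ 2)%:E)%E.

Definition hess_variance_le (R : realType) (d : measure_display)
    (S : measurableType d) (Q : probability S R) (n : nat)
    (F : 'cV[R]_n -> S -> R) (f : 'cV[R]_n -> R) (sigma : R) : Prop :=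
  forall w, (\int[Q]_s (opnorm (hess (F^~ s) w - hess f w) ^+ 2)%:E
    <= (sigma ^+ 2)%:E)%E.

(* Both the points u = (x, y, z) and the directions v = (v^x, v^y, v^z). *)
Record triple (R : realType) (dx dy : nat) := Triple {
  tx : 'cV[R]_dx;
  ty : 'cV[R]_dy;
  tz : 'cV[R]_dy }.

Definition sqdist (R : realType) (dx dy : nat) (u v : triple R dx dy) : R :=
  enorm (tx u - tx v) ^+ 2 + enorm (ty u - ty v) ^+ 2 + enorm (tz u - tz v) ^+ 2.

(* The directions (D_x, D_y, D_z)(u) that the sampled ones estimate. *)
Definition exact_dir (R : realType) (dx dy : nat)
    (f g : 'cV[R]_(dx + dy) -> R) (u : triple R dx dy) : triple R dx dy :=
  let: Triple x y z := u in
  Triple (grad1 f x y - hess12 g x y *m z)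
         (grad2 g x y)
         (hess22 g x y *m z - grad2 f x y).

Definition batch_mean (R : realType) (V : lmodType R) (n : nat) (a : 'I_n -> V) :
    V :=
  n%:R^-1 *: \sum_(i < n) a i.

Definition sampled_dir (R : realType) (dx dy : nat) (Xi Zeta : Type)
    (F : 'cV[R]_(dx + dy) -> Xi -> R) (G : 'cV[R]_(dx + dy) -> Zeta -> R)
    (n : nat) (I : 'I_n -> Xi) (J : 'I_n -> Zeta) (u : triple R dx dy) :
    triple R dx dy :=
  let: Triple x y z := u in
  Triple
    (batch_mean (fun i => grad1 (F^~ (I i)) x y)
     - batch_mean (fun j => hess12 (G^~ (J j)) x y *m z))
    (batch_mean (fun j => grad2 (G^~ (J j)) x y))
    (batch_mean (fun j => hess22 (G^~ (J j)) x y *m z)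
     - batch_mean (fun i => grad2 (F^~ (I i)) x y)).

(* Everything SPABA draws, as functions on a sample space. [coin k] gives, for
   x, y and z respectively, whether the size-[tau] estimate is used at
   iteration [k]; the large batches are the I', J' and the small ones the I, J.
   [init_dir] is the input (v_{-1}^x, v_{-1}^y, v_{-1}^z). It may be random
   (for instance a minibatch estimate), and deterministic inputs are the
   constant functions. *)
Record spaba_draws (R : realType) (dx dy : nat) (Xi Zeta : Type) (b tau : nat)
    (Om : Type) := SpabaDraws {
  init_dir : Om -> triple R dx dy;
  coin : nat -> Om -> bool * bool * bool;
  large_xi : nat -> 'I_tau -> Om -> Xi;
  large_zeta : nat -> 'I_tau -> Om -> Zeta;
  small_xi : nat -> 'I_b -> Om -> Xi;
  small_zeta : nat -> 'I_b -> Om -> Zeta }.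

(* Before iteration k: u_k, u_{k-1} and v_{k-1}. *)
Record spaba_state (R : realType) (dx dy : nat) := SpabaState {
  cur_pt : triple R dx dy;
  prev_pt : triple R dx dy;
  prev_dir : triple R dx dy }.

Definition spaba_dir (R : realType) (dx dy : nat) (Xi Zeta : Type) (b tau : nat)
    (Om : Type)
    (F : 'cV[R]_(dx + dy) -> Xi -> R) (G : 'cV[R]_(dx + dy) -> Zeta -> R)
    (D : spaba_draws R dx dy Xi Zeta b tau Om) (k : nat) (om : Om)
    (s : spaba_state R dx dy) : triple R dx dy :=
  let: (cx, cy, cz) := coin D k om in
  let large := sampled_dir F G (fun i => large_xi D k i om)
                               (fun j => large_zeta D k j om) (cur_pt s) in
  let small := sampled_dir F G (fun i => small_xi D k i om)
                               (fun j => small_zeta D k j om) in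
  let new := small (cur_pt s) in
  let old := small (prev_pt s) in
  let v := prev_dir s in
  Triple (if cx then tx large else tx v + tx new - tx old)
         (if cy then ty large else ty v + ty new - ty old)
         (if cz then tz large else tz v + tz new - tz old).

Definition spaba_update (R : realType) (dx dy : nat) (r alpha beta gamma : R)
    (u v : triple R dx dy) : triple R dx dy :=
  Triple (tx u - alpha *: tx v)
         (ty u - beta *: ty v)
         (proj_ball r (tz u - gamma *: tz v)).

(* [um1] and [u0] are the initial points u_{-1} and u_0. *)
Fixpoint spaba (R : realType) (dx dy : nat) (Xi Zeta : Type) (b tau : nat)
    (Om : Type)
    (F : 'cV[R]_(dx + dy) -> Xi -> R) (G : 'cV[R]_(dx + dy) -> Zeta -> R)
    (r : R) (alpha beta gamma : nat -> R) (um1 u0 : triple R dx dy)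
    (D : spaba_draws R dx dy Xi Zeta b tau Om) (k : nat) (om : Om) :
    spaba_state R dx dy :=
  match k with
  | 0 => SpabaState u0 um1 (init_dir D om)
  | k'.+1 =>
      let s := spaba F G r alpha beta gamma um1 u0 D k' om in
      let v := spaba_dir F G D k' om s in
      SpabaState (spaba_update r (alpha k') (beta k') (gamma k') (cur_pt s) v)
                 (cur_pt s) v
  end.

Definition spaba_x (R : realType) (dx dy : nat) (Xi Zeta : Type) (b tau : nat)
    (Om : Type)
    (F : 'cV[R]_(dx + dy) -> Xi -> R) (G : 'cV[R]_(dx + dy) -> Zeta -> R)
    (r : R) (alpha beta gamma : nat -> R) (um1 u0 : triple R dx dy)
    (D : spaba_draws R dx dy Xi Zeta b tau Om) (k : nat) (om : Om) : 'cV[R]_dx :=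
  tx (cur_pt (spaba F G r alpha beta gamma um1 u0 D k om)).

Definition mutually_independent (R : realType) (d : measure_display)
    (Om : measurableType d) (P : probability Om R) (I : Type)
    (E : I -> set (set Om)) : Prop :=
  forall (n : nat) (s : 'I_n -> I) (A : 'I_n -> set Om), injective s ->
    (forall j, E (s j) (A j)) ->
    P (\bigcap_j A j) = (\prod_(j < n) P (A j))%E.

(* Index type of the mutually independent family: the draws of K iterations. *)
Inductive draw_index (K b tau : nat) :=
  | InitDir
  | Coin of 'I_K
  | LargeXi of 'I_K & 'I_tau
  | LargeZeta of 'I_K & 'I_tau
  | SmallXi of 'I_K & 'I_b
  | SmallZeta of 'I_K & 'I_b.

Definition sigma_of (d d' : measure_display) (Om : measurableType d)
    (S : measurableType d') (X : Om -> S) : set (set Om) :=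
  preimage_set_system setT X measurable.

Definition init_coords (R : realType) (dx dy : nat) (Om : Type)
    (v : Om -> triple R dx dy) (i : 'I_dx + 'I_dy + 'I_dy) (om : Om) : R :=
  match i with
  | inl (inl i) => tx (v om) i 0
  | inl (inr i) => ty (v om) i 0
  | inr i => tz (v om) i 0
  end.

Definition sigma_of_draw (R : realType) (dx dy : nat)
    (dXi dZeta d : measure_display) (Xi : measurableType dXi)
    (Zeta : measurableType dZeta) (Om : measurableType d) (K b tau : nat)
    (D : spaba_draws R dx dy Xi Zeta b tau Om) (i : draw_index K b tau) :
    set (set Om) :=
  match i with
  | InitDir => <<s \bigcup_c sigma_of (init_coords (init_dir D) c) >>
  | Coin k => sigma_of (coin D k)
  | LargeXi k i => sigma_of (large_xi D k i)
  | LargeZeta k j => sigma_of (large_zeta D k j)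
  | SmallXi k i => sigma_of (small_xi D k i)
  | SmallZeta k j => sigma_of (small_zeta D k j)
  end.

Definition copy_of (R : realType) (d d' : measure_display)
    (Om : measurableType d) (S : measurableType d') (P : probability Om R)
    (Q : probability S R) (X : Om -> S) : Prop :=
  measurable_fun setT X /\
  forall A, measurable A -> P (X @^-1` A) = Q A.

(* Each coin of an iteration is Bernoulli(p), but the joint law of its three
   coins is left free, which covers both one coin shared by x, y, z and three
   independent coins. *)
Definition spaba_sampling (R : realType) (dx dy : nat)
    (dXi dZeta d : measure_display) (Xi : measurableType dXi)
    (Zeta : measurableType dZeta) (Om : measurableType d)
    (QXi : probability Xi R) (QZeta : probability Zeta R)
    (P : probability Om R) (K b tau : nat) (p : R)
    (D : spaba_draws R dx dy Xi Zeta b tau Om) : Prop :=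
  [/\ forall c, measurable_fun setT (init_coords (init_dir D) c),
      forall k, (k < K)%N ->
        [/\ measurable_fun setT (coin D k),
            P [set om | (coin D k om).1.1] = p%:E,
            P [set om | (coin D k om).1.2] = p%:E &
            P [set om | (coin D k om).2] = p%:E],
      forall k, (k < K)%N ->
        (forall i, copy_of P QXi (large_xi D k i)) /\
        (forall j, copy_of P QZeta (large_zeta D k j)),
      forall k, (k < K)%N ->
        (forall i, copy_of P QXi (small_xi D k i)) /\
        (forall j, copy_of P QZeta (small_zeta D k j)) &
      mutually_independent P (@sigma_of_draw R dx dy dXi dZeta d Xi Zeta Om
                                K b tau D)].

Definition spaba_ratio (R : realType) (p : R) (b : nat) : R :=
  Num.sqrt ((1 - p) / (p * b%:R)).

(* Mean-square error with which the inputs initialize the recursive estimator: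
   the error of v_{-1} at u_{-1}, plus the fluctuation of size-b minibatch
   differences between u_{-1} and u_0 and over the jump of z_0 into the ball. *)
Definition init_error (R : realType) (dx dy : nat) (d : measure_display)
    (Om : measurableType d) (P : probability Om R)
    (f g : 'cV[R]_(dx + dy) -> R) (r : R) (b : nat)
    (v : Om -> triple R dx dy) (um1 u0 : triple R dx dy) : \bar R :=
  (\int[P]_om (sqdist (v om) (exact_dir f g um1))%:E
   + ((sqdist u0 um1 + enorm (tz u0 - proj_ball r (tz u0)) ^+ 2) / b%:R)%:E)%E.

(* Main.v *)
From HB Require Import structures.
Require Import Defs.
From mathcomp Require Import ring lra measurable_realfun.
Set Implicit Arguments.
Unset Strict Implicit.
Unset Printing Implicit Defensive.
Local Open Scope classical_set_scope.
Local Open Scope ring_scope.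

(** The proof follows one Lyapunov function along the iteration. For a point
    [u = (x, y, z)] put
    [potential u = H x + a |y - y* x|^2 + c |z - z* x|^2], where [y* x] minimizes
    [g (x, .)] and [z* x] solves [hess22 g * z = grad2 f] at [(x, y* x)]. By
    strong convexity both targets are Lipschitz functions of [x], [z* x] lies in
    the ball onto which [z] is projected, and
    [grad H x = grad1 f - hess12 g * z*] (implicit differentiation, carried out
    in [hyper_taylor] as a second-order remainder estimate, which gives at once
    the formula and the descent inequality for [H]).

    Along a fixed sample path, one update with direction [v] makes a descent step
    for [H] with a gradient off by the tracking errors [|y - y*|], [|z - z*|] and
    by [|v - D u|], contracts each tracking error and displaces its target by a
    multiple of [alpha |v^x|]. The ratios [c_beta] and [c_gamma] are chosen so
    large that these displacements are absorbed, and [potential_step] reads: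
    the potential decreases by [alpha / 2 |grad H|^2] plus a multiple of
    [|v^x|^2 + |y - y*|^2 + |z - z*|^2], up to [alpha * noise_gain * |v - D u|^2].

    The estimator error [E_k = E |v_(k-1) - D u_(k-1)|^2] satisfies
    [E_(k+1) <= p * VS / tau + (1 - p) (E_k + VL / b * E |u_k - u_(k-1)|^2)]
    ([estimator_step]). The coin, the large batch and the small batch of an
    iteration are independent of everything drawn earlier, so they can be
    integrated out with the past frozen ([integral_freeze]); the fresh samples are
    centred because differentiation commutes with the mean
    ([grad_has_mean], [hess_has_mean]), and each of them adds its own second
    moment only.

    Finally [E (potential u_k) + w E_(k+1)] is summed, with the weight
    [w = (M + 1) ab / p], where [M] is [noise_gain] and
    [ab = c / (1 + sqrt((1 - p) / (p b)))]. The contraction by [1 - p] of the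
    estimator pays for the noise in the potential, and the drift [|u_k - u_(k-1)|^2]
    comes back with the factor [w (1 - p) VL / b], proportional to
    [ab * (1 - p) / (p b)]. Since [|u_k - u_(k-1)|^2] is of order [alpha^2] times
    what the potential loses, this is absorbed when
    [alpha * sqrt((1 - p) / (p b))] is small: this is the step-size condition. What
    remains is the initial potential and the initial estimator error, which give
    the two terms of order [1 / K], and the variance [VS / tau] of the large
    batches at every step. Among the iterates only [z_0] may lie outside the ball, and the jump of
    the first projection is charged to the initial error. *)

(** * Euclidean geometry of column vectors *)

Section Euclid.
Context {R : realType}.
Implicit Types (m n : nat).

Definition dot n (u v : 'cV[R]_n) : R := \sum_(i < n) u i 0 * v i 0.

Lemma dotC n (u v : 'cV[R]_n) : dot u v = dot v u.
Proof. by apply: eq_bigr => i _; rewrite mulrC. Qed.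

Lemma dotDr n (u v w : 'cV[R]_n) : dot u (v + w) = dot u v + dot u w.
Proof. by rewrite /dot -big_split; apply: eq_bigr => i _; rewrite mxE mulrDr. Qed.

Lemma dotZr n a (u v : 'cV[R]_n) : dot u (a *: v) = a * dot u v.
Proof. by rewrite /dot mulr_sumr; apply: eq_bigr => i _; rewrite mxE mulrCA. Qed.

Lemma dotNr n (u v : 'cV[R]_n) : dot u (- v) = - dot u v.
Proof. by rewrite -scaleN1r dotZr mulN1r. Qed.

Lemma dotBr n (u v w : 'cV[R]_n) : dot u (v - w) = dot u v - dot u w.
Proof. by rewrite dotDr dotNr. Qed.

Lemma dotDl n (u v w : 'cV[R]_n) : dot (u + v) w = dot u w + dot v w.
Proof. by rewrite dotC dotDr !(dotC w). Qed.

Lemma dotZl n a (u v : 'cV[R]_n) : dot (a *: u) v = a * dot u v.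
Proof. by rewrite dotC dotZr (dotC v). Qed.

Lemma dotNl n (u v : 'cV[R]_n) : dot (- u) v = - dot u v.
Proof. by rewrite dotC dotNr (dotC v). Qed.

Lemma dotBl n (u v w : 'cV[R]_n) : dot (u - v) w = dot u w - dot v w.
Proof. by rewrite dotDl dotNl. Qed.

Lemma dot0r n (u : 'cV[R]_n) : dot u 0 = 0.
Proof. by rewrite -(scale0r 0) dotZr mul0r. Qed.

Lemma dot0l n (u : 'cV[R]_n) : dot 0 u = 0.
Proof. by rewrite dotC dot0r. Qed.

Lemma dot_delta n (u : 'cV[R]_n) i : dot u (delta_mx i 0) = u i 0.
Proof.
rewrite /dot (bigD1 i)//= big1 ?addr0 => [|j ji]; rewrite mxE ?eqxx ?mulr1//=.
by rewrite (negbTE ji) mulr0.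
Qed.

Lemma dot_col_mx m n (a c : 'cV[R]_m) (b d : 'cV[R]_n) :
  dot (col_mx a b) (col_mx c d) = dot a c + dot b d.
Proof.
rewrite /dot big_split_ord/=; congr (_ + _); apply: eq_bigr => i _.
  by rewrite !col_mxEu.
by rewrite !col_mxEd.
Qed.

Lemma enorm_ge0 n (v : 'cV[R]_n) : 0 <= enorm v.
Proof. exact: sqrtr_ge0. Qed.
Hint Resolve enorm_ge0 : core.

Lemma enorm_sq n (v : 'cV[R]_n) : enorm v ^+ 2 = dot v v.
Proof.
rewrite /enorm sqr_sqrtr; last by apply: sumr_ge0 => i _; exact: sqr_ge0.
by apply: eq_bigr => i _; rewrite expr2.
Qed.

Lemma enorm0 n : enorm (0 : 'cV[R]_n) = 0.
Proof. by apply/eqP; rewrite -sqrf_eq0 enorm_sq dot0r. Qed.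

Lemma enormZ n a (v : 'cV[R]_n) : enorm (a *: v) = `|a| * enorm v.
Proof.
apply/eqP; rewrite -(@eqrXn2 _ 2) ?mulr_ge0//.
by rewrite exprMn !enorm_sq dotZl dotZr mulrA real_normK ?num_real// expr2.
Qed.

Lemma enormN n (v : 'cV[R]_n) : enorm (- v) = enorm v.
Proof. by rewrite -scaleN1r enormZ normrN1 mul1r. Qed.

Lemma enormB n (u v : 'cV[R]_n) : enorm (u - v) = enorm (v - u).
Proof. by rewrite -enormN opprB. Qed.

Lemma enorm_sqD n (u v : 'cV[R]_n) :
  enorm (u + v) ^+ 2 = enorm u ^+ 2 + 2 * dot u v + enorm v ^+ 2.
Proof. by rewrite !enorm_sq dotDr !dotDl (dotC v); ring. Qed.

Lemma enorm_sqB n (u v : 'cV[R]_n) :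
  enorm (u - v) ^+ 2 = enorm u ^+ 2 - 2 * dot u v + enorm v ^+ 2.
Proof. by rewrite enorm_sqD enormN dotNr mulrN. Qed.

Lemma ler_of_sqr (a b : R) : 0 <= b -> a ^+ 2 <= b ^+ 2 -> a <= b.
Proof.
move=> b0 ab; rewrite (le_trans (ler_norm a))// -(@ler_pXn2r _ 2) ?nnegrE//.
by rewrite real_normK ?num_real.
Qed.

Lemma ler_sqr_mono (a b : R) : 0 <= a -> a <= b -> a ^+ 2 <= b ^+ 2.
Proof. by move=> a0 ab; rewrite lerXn2r ?nnegrE// (le_trans a0). Qed.

Lemma enorm_eq0 n (v : 'cV[R]_n) : enorm v = 0 -> v = 0.
Proof.
move=> v0; have : dot v v = 0 by rewrite -enorm_sq v0 expr0n.
move/eqP; rewrite psumr_eq0 => [/allP v_eq0|i _]; last by rewrite -expr2 sqr_ge0.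
apply/colP => i; have /= := v_eq0 i (mem_index_enum i).
by rewrite -expr2 sqrf_eq0 mxE => /eqP.
Qed.

(** Expanding the square of [|v|^2 u - <u, v> v] gives
    [|v|^2 (|u|^2 |v|^2 - <u, v>^2)]. *)
Lemma cauchy_schwarz n (u v : 'cV[R]_n) : `|dot u v| <= enorm u * enorm v.
Proof.
apply: ler_of_sqr; first by rewrite mulr_ge0.
rewrite real_normK ?num_real// exprMn !enorm_sq.
have [/enorm_eq0->|v0] := eqVneq (enorm v) 0.
  by rewrite !dot0r mulr0 expr0n.
have vv : 0 < dot v v by rewrite -enorm_sq exprn_even_gt0.
rewrite -subr_ge0 -(pmulr_rge0 _ vv).
have := sqr_ge0 (enorm (dot v v *: u - dot u v *: v)).
by rewrite enorm_sq !(dotBl, dotBr, dotZl, dotZr) (dotC v u) => h; nra.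
Qed.

Lemma dot_le n (u v : 'cV[R]_n) : dot u v <= enorm u * enorm v.
Proof. exact: le_trans (ler_norm _) (cauchy_schwarz u v). Qed.

Lemma ler_enormD n (u v : 'cV[R]_n) : enorm (u + v) <= enorm u + enorm v.
Proof.
apply: ler_of_sqr; first by rewrite addr_ge0.
by rewrite enorm_sqD; have := dot_le u v; nra.
Qed.

Lemma ler_enormB n (u v : 'cV[R]_n) : enorm (u - v) <= enorm u + enorm v.
Proof. by rewrite -(enormN v) ler_enormD. Qed.

Lemma ler_enorm_sqD n (u v : 'cV[R]_n) :
  enorm (u + v) ^+ 2 <= 2 * enorm u ^+ 2 + 2 * enorm v ^+ 2.
Proof.
by have := sqr_ge0 (enorm (u - v)); rewrite enorm_sqD enorm_sqB; lra.
Qed.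

Lemma ler_enorm_sum n (I : finType) (v : I -> 'cV[R]_n) :
  enorm (\sum_i v i) <= \sum_i enorm (v i).
Proof.
elim/big_ind2 : _ => [|x a y b xa yb|//]; first by rewrite enorm0.
exact: le_trans (ler_enormD _ _) (lerD xa yb).
Qed.

Lemma enorm_delta n i : enorm (delta_mx i 0 : 'cV[R]_n) = 1.
Proof.
by apply/eqP; rewrite -(@eqrXn2 _ 2)// enorm_sq dot_delta mxE !eqxx/= expr1n.
Qed.

Lemma ler_enorm_coord n (v : 'cV[R]_n) i : `|v i 0| <= enorm v.
Proof.
rewrite -(dot_delta v i); apply: (le_trans (cauchy_schwarz _ _)).
by rewrite enorm_delta mulr1.
Qed.

(** Duality: the norm is the supremum of pairings, which reduces
    vector-valued estimates to scalar ones. *)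
Lemma enorm_le_dot n (v : 'cV[R]_n) (a : R) : 0 <= a ->
  (forall w : 'cV[R]_n, dot w v <= a * enorm w) -> enorm v <= a.
Proof.
move=> a0 /(_ v); rewrite -enorm_sq expr2.
have [-> //|v0] := eqVneq (enorm v) 0.
by rewrite ler_pM2r// lt0r v0 enorm_ge0.
Qed.

Lemma enorm_col_mx_sq m n (a : 'cV[R]_m) (b : 'cV[R]_n) :
  enorm (col_mx a b) ^+ 2 = enorm a ^+ 2 + enorm b ^+ 2.
Proof. by rewrite !enorm_sq dot_col_mx. Qed.

Lemma enorm_col_mx0 m n (a : 'cV[R]_m) : enorm (col_mx a (0 : 'cV[R]_n)) = enorm a.
Proof.
by apply/eqP; rewrite -(@eqrXn2 _ 2)// enorm_col_mx_sq enorm0 expr0n addr0.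
Qed.

Lemma enorm_col_0mx m n (b : 'cV[R]_n) : enorm (col_mx (0 : 'cV[R]_m) b) = enorm b.
Proof.
by apply/eqP; rewrite -(@eqrXn2 _ 2)// enorm_col_mx_sq enorm0 expr0n add0r.
Qed.

Lemma ler_enorm_col_mx m n (a : 'cV[R]_m) (b : 'cV[R]_n) :
  enorm (col_mx a b) <= enorm a + enorm b.
Proof.
apply: ler_of_sqr; first by rewrite addr_ge0.
by rewrite enorm_col_mx_sq; have := mulr_ge0 (enorm_ge0 a) (enorm_ge0 b); nra.
Qed.

Lemma ler_enorm_usubmx m n (v : 'cV[R]_(m + n)) : enorm (usubmx v) <= enorm v.
Proof.
apply: ler_of_sqr => //; rewrite -{2}(vsubmxK v) enorm_col_mx_sq.
by rewrite lerDl sqr_ge0.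
Qed.

Lemma ler_enorm_dsubmx m n (v : 'cV[R]_(m + n)) : enorm (dsubmx v) <= enorm v.
Proof.
apply: ler_of_sqr => //; rewrite -{2}(vsubmxK v) enorm_col_mx_sq.
by rewrite lerDr sqr_ge0.
Qed.

Lemma mulmx_coord_dot m n (A : 'M[R]_(m, n)) (v : 'cV[R]_n) i :
  (A *m v) i 0 = dot (row i A)^T v.
Proof. by rewrite mxE; apply: eq_bigr => j _; rewrite !mxE. Qed.

(** The supremum defining the operator norm is over a bounded set, so that it
    is a genuine least upper bound: each row contributes at most its own norm. *)
Lemma opnorm_has_sup m n (A : 'M[R]_(m, n)) :
  has_sup [set enorm (A *m v) | v in [set v : 'cV[R]_n | enorm v <= 1]].
Proof.
split; first by exists (enorm (A *m 0)), 0 => //=; rewrite enorm0.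
exists (\sum_i enorm (row i A)^T) => _ [v /= v1 <-].
have -> : A *m v = \sum_i (dot (row i A)^T v) *: delta_mx i 0.
  by rewrite [LHS]matrix_sum_delta; apply: eq_bigr => i _;
     rewrite big_ord1 mulmx_coord_dot.
apply: (le_trans (ler_enorm_sum _)); apply: ler_sum => i _.
rewrite enormZ enorm_delta mulr1 (le_trans (cauchy_schwarz _ _))//.
by rewrite ler_piMr.
Qed.

Lemma ler_opnorm m n (A : 'M[R]_(m, n)) v : enorm (A *m v) <= opnorm A * enorm v.
Proof.
have [/enorm_eq0->|v0] := eqVneq (enorm v) 0.
  by rewrite mulmx0 !enorm0 mulr0.
have vgt0 : 0 < enorm v by rewrite lt0r v0 enorm_ge0.
rewrite -ler_pdivrMr// mulrC -[X in X * _]ger0_norm ?invr_ge0// -enormZ.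
rewrite scalemxAr; apply: ub_le_sup; first by case: (opnorm_has_sup A).
by exists ((enorm v)^-1 *: v) => //=; rewrite enormZ ger0_norm ?invr_ge0// mulVf.
Qed.

Lemma opnorm_ge0 m n (A : 'M[R]_(m, n)) : 0 <= opnorm A.
Proof.
apply: (@le_trans _ _ (enorm (A *m 0))) => //.
apply: ub_le_sup; first by case: (opnorm_has_sup A).
by exists 0 => //=; rewrite enorm0.
Qed.

Lemma coordB n (u v : 'cV[R]_n) i : (u - v) i 0 = u i 0 - v i 0.
Proof. by rewrite !mxE. Qed.

Lemma mulmx_delta m n (A : 'M[R]_(m, n)) i j :
  (A *m (delta_mx j 0 : 'cV[R]_n)) i 0 = A i j.
Proof.
rewrite mxE (bigD1 j)//= big1 ?addr0; first by rewrite mxE !eqxx mulr1.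
by move=> k kj; rewrite mxE (negbTE kj) mulr0.
Qed.

End Euclid.
#[export] Hint Extern 0 (is_true (0 <= enorm _)) => exact: enorm_ge0 : core.

(** * Taylor estimates *)

Section Calculus.
Context {R : realType}.
Implicit Types (n : nat).

Lemma derive_dot_grad n (h : 'cV[R]_n -> R) w v :
  differentiable h w -> 'D_v h w = dot (grad h w) v.
Proof.
move=> dh; rewrite deriveE// {1}[v]matrix_sum_delta linear_sum.
apply: eq_bigr => i _; rewrite big_ord1 linearZ mxE mulrC deriveE//.
Qed.

Lemma is_derive_line n (h : 'cV[R]_n -> R) (w v : 'cV[R]_n) (t : R) :
  differentiable h (w + t *: v) ->
  is_derive t 1 (fun s => h (w + s *: v)) (dot (grad h (w + t *: v)) v).
Proof.
move=> dh.
have E : (fun s : R => s^-1 *: ((fun s => h (w + s *: v)) (s *: (1 : R) + t)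
            - h (w + t *: v)))
       = (fun s : R => s^-1 *: (h (s *: v + (w + t *: v)) - h (w + t *: v))).
  apply/funext => s; congr (_ *: (h _ - _)).
  by rewrite [s *: 1]mulr1 scalerDl addrCA.
have dhv := @diff_derivable _ _ _ h _ v dh.
split; first by rewrite /derivable /= E.
by rewrite -derive_dot_grad// /derive /= E.
Qed.

Lemma MVT_line n (h : 'cV[R]_n -> R) (w v : 'cV[R]_n) :
  everywhere_differentiable h ->
  exists2 t : R, 0 <= t <= 1 & h (w + v) - h w = dot (grad h (w + t *: v)) v.
Proof.
move=> dh.
have dline (t : R) := @is_derive_line n h w v t (dh _).
have [] := @MVT_segment R (fun s => h (w + s *: v))
  (fun t => dot (grad h (w + t *: v)) v) 0 1 ler01.
- apply: continuous_subspaceT => t; apply: differentiable_continuous.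
  by apply/derivable1_diffP; apply: (@ex_derive _ _ _ _ _ _ _ (dline t)).
- move=> t; rewrite in_itv/= scale1r scale0r addr0 subr0 mulr1 => t01 ->.
  by exists t.
Qed.

(** Letting [t] tend to [0], in the form in which first-order conditions are
    extracted below from second-order expansions. *)
Lemma le_of_forall_small (a b c : R) :
  (forall t, 0 < t <= 1 -> a <= b + t * c) -> a <= b.
Proof.
move=> H; rewrite leNgt; apply/negP => ba.
have [c0|c0] := leP c 0.
  by have := H 1; rewrite ltr01 lexx => /(_ isT); lra.
pose t := Num.min 1 ((a - b) / (2 * c)).
have t0 : 0 < t by rewrite lt_min ltr01 divr_gt0//; lra.
have t1 : t <= 1 by rewrite ge_min lexx.
have tc : t * c <= (a - b) / 2.
  have : t <= (a - b) / (2 * c) by rewrite ge_min lexx orbT.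
  move=> /(ler_wpM2r (ltW c0)) /le_trans; apply.
  by rewrite le_eqVlt; apply/orP; left; apply/eqP; field; lra.
by have := H t; rewrite t0 t1 => /(_ isT); lra.
Qed.

Lemma taylor1 n (L : R) (h : 'cV[R]_n -> R) (w v : 'cV[R]_n) : 0 <= L ->
  everywhere_differentiable h -> lipschitz_grad L h ->
  `|h (w + v) - h w - dot (grad h w) v| <= L * enorm v ^+ 2.
Proof.
move=> L0 dh Lh; have [t /andP[t0 t1] ->] := MVT_line w v dh.
rewrite -dotBl (le_trans (cauchy_schwarz _ _))// expr2 mulrA ler_wpM2r//.
rewrite (le_trans (Lh _ _))// addrC addKr enormZ ger0_norm// ler_wpM2l//.
by rewrite ler_piMl.
Qed.

Lemma grad_dot_hess n (h : 'cV[R]_n -> R) (w v : 'cV[R]_n) i :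
  dot (grad (fun u => grad h u i 0) w) v = (hess h w *m v) i 0.
Proof. by rewrite mxE; apply: eq_bigr => j _; rewrite !mxE. Qed.

Lemma grad_dot_grad n (h : 'cV[R]_n -> R) (w a : 'cV[R]_n) :
  twice_differentiable h ->
  differentiable (fun u => dot a (grad h u)) w /\
  forall v, dot (grad (fun u => dot a (grad h u)) w) v = dot a (hess h w *m v).
Proof.
move=> [_ dh].
have -> : (fun u => dot a (grad h u)) =
          \sum_i (a i 0 *: (fun u => grad h u i 0)).
  by apply/funext => u; rewrite /dot fct_sumE.
have da i : differentiable (a i 0 *: (fun u => grad h u i 0)) w.
  exact/differentiableZ/dh.
have d : differentiable (\sum_i (a i 0 *: (fun u => grad h u i 0))) w.
  exact: differentiable_sum.
split=> // v; rewrite -derive_dot_grad// derive_sum => [|i]; last first.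
  exact: diff_derivable.
apply: eq_bigr => i _; rewrite deriveZ; last exact/diff_derivable/dh.
by rewrite derive_dot_grad ?grad_dot_hess//; exact: dh.
Qed.

(** Testing against a fixed direction [a] reduces the vector-valued estimate
    to the mean value theorem for the scalar [<a, grad h>]. *)
Lemma taylor2 n (L : R) (h : 'cV[R]_n -> R) (w v : 'cV[R]_n) : 0 <= L ->
  twice_differentiable h -> lipschitz_hess L h ->
  enorm (grad h (w + v) - grad h w - hess h w *m v) <= L * enorm v ^+ 2.
Proof.
move=> L0 dh Lh; apply: enorm_le_dot => [|a].
  by rewrite mulr_ge0// exprn_ge0.
have da : everywhere_differentiable (fun u => dot a (grad h u)).
  by move=> u; case: (grad_dot_grad u a dh).
have [t /andP[t0 t1] E] := MVT_line w v da.
rewrite !dotBr {}E; have [_ ->] := grad_dot_grad (w + t *: v) a dh.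
rewrite -dotBr -mulmxBl (le_trans (dot_le _ _))// mulrC ler_wpM2r//.
rewrite (le_trans (ler_opnorm _ _))// expr2 mulrA ler_wpM2r//.
rewrite (le_trans (Lh _ _))// addrC addKr enormZ ger0_norm// ler_wpM2l//.
by rewrite ler_piMl.
Qed.

(** The Hessian is the limit of difference quotients of the gradient, so it
    inherits the Lipschitz constant of the gradient as a bound on its norm. *)
Lemma hess_bound n (L1 L2 : R) (h : 'cV[R]_n -> R) (w v : 'cV[R]_n) : 0 <= L2 ->
  twice_differentiable h -> lipschitz_grad L1 h -> lipschitz_hess L2 h ->
  enorm (hess h w *m v) <= L1 * enorm v.
Proof.
move=> L20 dh Lh1 Lh2.
apply: (@le_of_forall_small _ _ (L2 * enorm v ^+ 2)) => t /andP[t0 t1].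
rewrite -(ler_pM2l t0) -{1}(gtr0_norm t0) -enormZ scalemxAr.
have T := taylor2 w (t *: v) L20 dh Lh2.
have := Lh1 (w + t *: v) w; rewrite [w + _ - w]addrC addKr enormZ gtr0_norm// => B.
set H := hess h w *m _ in T *.
have -> : H = (grad h (w + t *: v) - grad h w) -
              (grad h (w + t *: v) - grad h w - H) by rewrite opprB addrC subrK.
rewrite (le_trans (ler_enormB _ _))// (le_trans (lerD B T))//.
by rewrite enormZ gtr0_norm// le_eqVlt; apply/orP; left; apply/eqP; ring.
Qed.

(** Up to [O(t^3)], the second difference of [h] in the directions [t a] and
    [t b] is both [t^2 <a, Hess h b>] and [t^2 <b, Hess h a>]. *)
Lemma hess_sym n (L : R) (h : 'cV[R]_n -> R) (w a b : 'cV[R]_n) : 0 <= L ->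
  twice_differentiable h -> lipschitz_hess L h ->
  dot a (hess h w *m b) = dot b (hess h w *m a).
Proof.
move=> L0 dh Lh.
pose D (t : R) (a b : 'cV[R]_n) : R := h (w + t *: a + t *: b) - h (w + t *: a) - h (w + t *: b) + h w.
pose c (a b : 'cV[R]_n) := enorm a * (L * (enorm a + enorm b) ^+ 2 + L * enorm a ^+ 2).
have DE (a' b' : 'cV[R]_n) (t : R) : 0 < t ->
    `|D t a' b' - t ^+ 2 * dot a' (hess h w *m b')| <= t ^+ 3 * c a' b'.
  move=> t0.
  pose phi (u : 'cV[R]_n) : R := h (u + t *: b') - h u.
  have dphi (u : 'cV[R]_n) : differentiable phi u /\
      grad phi u = grad h (u + t *: b') - grad h u.
    have d1 : differentiable (fun u => h (u + t *: b')) u.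
      apply: (@differentiable_comp _ _ _ _ (fun u => u + t *: b') h); last exact: dh.1.
      apply: differentiableD; last exact: differentiable_cst.
      exact: ex_diff.
    split; first by apply: differentiableB => //; exact: dh.1.
    have shiftD e : 'D_e (fun u => h (u + t *: b')) u = 'D_e h (u + t *: b').
      rewrite /derive; suff -> : (fun s : R => s^-1 *:
          (((fun u => h (u + t *: b')) \o shift u) (s *: e) - h (u + t *: b')))
        = (fun s : R => s^-1 *:
          ((h \o shift (u + t *: b')) (s *: e) - h (u + t *: b'))) by [].
      by apply/funext => s /=; rewrite addrA.
    apply/colP => i; rewrite !mxE deriveB ?shiftD//; first exact: diff_derivable.
    exact/diff_derivable/dh.1.
  have [s /andP[s0 s1]] := MVT_line w (t *: a') (fun u => (dphi u).1).
  rewrite (dphi _).2 => E.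
  have -> : D t a' b' = t * dot (grad h (w + s *: (t *: a') + t *: b')
                               - grad h (w + s *: (t *: a'))) a'.
    rewrite -dotZr -E /D /phi; ring.
  have T1 := taylor2 w (s *: (t *: a') + t *: b') L0 dh Lh.
  have T2 := taylor2 w (s *: (t *: a')) L0 dh Lh.
  rewrite expr2 -mulrA -mulrBr normrM gtr0_norm// exprS -mulrA ler_wpM2l ?(ltW t0)//.
  rewrite -dotZr scalemxAr (dotC _ a') -dotBr.
  rewrite (le_trans (cauchy_schwarz _ _))// /c [leRHS]mulrCA ler_wpM2l//.
  rewrite addrA in T1.
  set g1 := grad h (_ + _ + _) in T1 *; set g2 := grad h (_ + s *: _) in T2 *.
  have -> : g1 - g2 - hess h w *m (t *: b') =
     (g1 - grad h w - hess h w *m (s *: (t *: a') + t *: b')) -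
     (g2 - grad h w - hess h w *m (s *: (t *: a'))).
    rewrite mulmxDr; move: (hess h w *m _) (hess h w *m _) (grad h w) => p q r.
    by apply/colP => i; rewrite !mxE; ring.
  rewrite (le_trans (ler_enormB _ _))// (le_trans (lerD T1 T2))// mulrDr lerD//.
    rewrite [leRHS]mulrCA ler_wpM2l// -exprMn; apply: ler_sqr_mono => //.
    rewrite (le_trans (ler_enormD _ _))// !enormZ (gtr0_norm t0) (ger0_norm s0) mulrDr lerD2r.
    by rewrite ler_piMl// mulr_ge0// (ltW t0).
  rewrite [leRHS]mulrCA ler_wpM2l// -exprMn; apply: ler_sqr_mono => //.
  by rewrite !enormZ (gtr0_norm t0) (ger0_norm s0) ler_piMl// mulr_ge0// (ltW t0).
(* The second difference is symmetric in the two directions. *)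
have sym a' b' : dot a' (hess h w *m b') <= dot b' (hess h w *m a').
  apply: (@le_of_forall_small _ _ (c a' b' + c b' a')) => t /andP[t0 _].
  have := DE a' b' _ t0; have := DE b' a' _ t0.
  have -> : D t b' a' = D t a' b' by rewrite /D (addrAC w); ring.
  move=> /ler_normlP[_ H1] /ler_normlP[H2 _].
  by rewrite -(ler_pM2l (exprn_gt0 2 t0)); lra.
by apply/eqP; rewrite eq_le !sym.
Qed.

End Calculus.

(** * Minimizers of strongly convex functions and projections onto balls *)

Section Argmin.
Context {R : realType}.
Implicit Types (n : nat).

Lemma argminP n (A : set 'cV[R]_n) (h : 'cV[R]_n -> R) a :
  A a -> (forall b, A b -> h a <= h b) ->
  A (argmin A h) /\ forall b, A b -> h (argmin A h) <= h b.
Proof.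
move=> Aa ha.
exact: (@getPex _ [set a | A a /\ forall b, A b -> h a <= h b] (ex_intro _ a (conj Aa ha))).
Qed.

(** Continuity in an epsilon-delta form on coordinates. It follows both from
    the library topology of column vectors and from Euclidean Lipschitz bounds. *)
Definition econtinuous n (h : 'cV[R]_n -> R) := forall (w : 'cV[R]_n) (e : R), 0 < e ->
  exists2 d : R, 0 < d & forall v : 'cV[R]_n, (forall i, `|v i 0| < d) -> `|h (w + v) - h w| < e.

Lemma ler_enorm_sum_coord n (v : 'cV[R]_n) : enorm v <= \sum_i `|v i 0|.
Proof.
rewrite {1}[v]matrix_sum_delta; apply: (le_trans (ler_enorm_sum _)).
by apply: ler_sum => i _; rewrite big_ord1 enormZ enorm_delta mulr1.
Qed.

Lemma enorm_small n (v : 'cV[R]_n) (d : R) :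
  0 < d -> (forall i, `|v i 0| < d / n.+1%:R) -> enorm v < d.
Proof.
move=> d0 H; apply: (le_lt_trans (ler_enorm_sum_coord v)).
apply: (@le_lt_trans _ _ (\sum_(i < n) d / n.+1%:R)).
  by apply: ler_sum => i _; exact/ltW/H.
rewrite sumr_const card_ord -[_ *+ _]mulr_natr -mulrA gtr_pMr//.
by rewrite mulrC ltr_pdivrMr ?ltr0n// mul1r ltr_nat.
Qed.

Lemma econtinuous_enorm n (h : 'cV[R]_n -> R) :
  (forall (w : 'cV[R]_n) (e : R), 0 < e -> exists2 d : R, 0 < d &
     forall v : 'cV[R]_n, enorm v < d -> `|h (w + v) - h w| < e) -> econtinuous h.
Proof.
move=> H w e e0; have [d d0 Hd] := H w e e0.
exists (d / n.+1%:R) => [|v Hv]; first by rewrite divr_gt0.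
exact/Hd/enorm_small.
Qed.

Lemma lipschitz_econtinuous n (h : 'cV[R]_n -> R) (L : R) :
  (forall w w', `|h w - h w'| <= L * enorm (w - w')) -> econtinuous h.
Proof.
move=> Lh; apply: econtinuous_enorm => w e e0.
exists (e / (`|L| + 1)) => [|v]; first by rewrite divr_gt0// ltr_wpDl.
rewrite ltr_pdivlMr; last by rewrite ltr_wpDl.
move=> vd; apply: (le_lt_trans (Lh _ _)); rewrite [w + v]addrC addrK.
apply: le_lt_trans vd; rewrite mulrC ler_wpM2l//.
by rewrite (le_trans (ler_norm L))// lerDl.
Qed.

Lemma continuous_econtinuous n (h : 'cV[R]_n -> R) : continuous h -> econtinuous h.
Proof.
move=> ch w e e0; have /cvgrPdist_lt/(_ _ e0) := ch w.
rewrite near_simpl => /nbhs_ballP[d /= d0 Hd]; exists d => // v vd.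
rewrite distrC; apply: Hd; split=> // i j; rewrite (ord1 j).
by rewrite /ball/= mxE opprD addNKr normrN.
Qed.

Lemma econtinuous_trmx n (h : 'cV[R]_n -> R) : econtinuous h ->
  continuous (fun v : 'rV[R]_n => h v^T).
Proof.
move=> ch v; apply: (iffRL (@cvgrPdist_lt _ _ _ (nbhs v) (nbhs_filter v) _ _)) => e e0; rewrite nearE.
have [d d0 Hd] := ch v^T e e0.
apply/nbhs_ballP; exists d => //= u [_ uv].
have -> : u^T = v^T + (u - v)^T by rewrite linearB/= addrC subrK.
rewrite distrC; apply: Hd => i; rewrite !mxE distrC; exact: uv.
Qed.

Variables (n : nat) (h : 'cV[R]_n -> R) (G : 'cV[R]_n -> 'cV[R]_n) (L mu : R).
Hypothesis (L0 : 0 <= L) (mu_gt0 : 0 < mu).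
Hypothesis taylor : forall y v,
  `|h (y + v) - h y - dot (G y) v| <= L * enorm v ^+ 2.

Lemma taylor_econtinuous : econtinuous h.
Proof.
have l0 := L0; apply: econtinuous_enorm => w e e0.
pose B : R := enorm (G w) + L + 1.
have B0 : 0 < B by rewrite /B; have := enorm_ge0 (G w); lra.
exists (Num.min 1 (e / B)) => [|v]; first by rewrite lt_min ltr01 divr_gt0.
rewrite lt_min => /andP[v1]; rewrite ltr_pdivlMr// => ve.
apply: le_lt_trans ve; have T := taylor w v.
have -> : h (w + v) - h w = h (w + v) - h w - dot (G w) v + dot (G w) v.
  by rewrite subrK.
rewrite (le_trans (ler_normD _ _))// (le_trans (lerD T (cauchy_schwarz _ _)))//.
have v0 := enorm_ge0 v; have Gw0 := enorm_ge0 (G w).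
have v2 : L * enorm v ^+ 2 <= L * enorm v by rewrite ler_wpM2l// expr2 ler_piMl// ltW.
by rewrite /B; nra.
Qed.

(** A step of length [t] against the gradient changes [h] by
    [- t |G a|^2 + O(t^2)], which must be non-negative for all small [t]. *)
Lemma min_grad0 a : (forall b, h a <= h b) -> G a = 0.
Proof.
have l0 := L0.
move=> ha; apply: enorm_eq0; apply/eqP; rewrite -sqrf_eq0 eq_le sqr_ge0 andbT.
apply: (@le_of_forall_small _ _ _ (L * enorm (G a) ^+ 2)) => t /andP[t0 t1].
have := taylor a (- t *: G a); rewrite dotZr enormZ normrN (gtr0_norm t0) exprMn -enorm_sq.
move=> /ler_normlP[_]; have := ha (a + - t *: G a) => H1 H2.
by rewrite -(ler_pM2l t0); nra.
Qed.

Hypothesis sc : strongly_convex mu h.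

(** Strong convexity along the segment, compared with the Taylor expansion at
    its endpoint and divided by the length, as the length tends to [0]. *)
Lemma strongly_convex_first_order y v :
  h y + dot (G y) v + mu / 2 * enorm v ^+ 2 <= h (y + v).
Proof.
have l0 := L0.
apply: (@le_of_forall_small _ _ _ ((L + mu / 2) * enorm v ^+ 2)) => t /andP[t0 t1].
have := @sc (y + v) y t; rewrite (ltW t0) t1 => /(_ isT).
have -> : t *: (y + v) + (1 - t) *: y = y + t *: v.
  by apply/colP => i; rewrite !mxE; ring.
rewrite [y + v - y]addrC addKr => S; have /ler_normlP[T _] := taylor y (t *: v).
rewrite dotZr enormZ (gtr0_norm t0) exprMn in T.
by rewrite -(ler_pM2l t0); nra.
Qed.

Lemma strongly_convex_monotone y y' :
  mu * enorm (y - y') ^+ 2 <= dot (G y - G y') (y - y').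
Proof.
have l0 := L0.
have := strongly_convex_first_order y (y' - y).
have := strongly_convex_first_order y' (y - y').
rewrite ![_ + (_ - _)]addrC !subrK (enormB y' y) dotBl -(opprB y y') dotNr; lra.
Qed.

(** Outside the cube of half-side [2 |G 0| / mu] the quadratic lower bound at
    the origin exceeds [h 0]; inside, compactness gives a minimizer. *)
Lemma strongly_convex_has_min : exists a, forall b, h a <= h b.
Proof.
have l0 := L0; have m0 := mu_gt0.
(* Beyond this radius the term [mu / 2 * |v|^2] dominates [|G 0| |v|]. *)
pose M : R := 2 * enorm (G 0) / mu.
have M0 : 0 <= M by rewrite /M divr_ge0// ?mulr_ge0// ltW.
pose A := [set v : 'rV[R]_n | forall i, v ord0 i \in `[(- M), M]].
have cA : compact A.
  apply: (@rV_compact _ _ (fun=> `[(- M), M]%classic)) => _.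
  exact: segment_compact.
have A0 : A 0 by move=> i; rewrite mxE in_itv/= M0 lerNl oppr0 M0.
have [a _ ha] := @EVT_min_rV R n (fun v => h v^T) A (ex_intro _ 0 A0) cA
  (continuous_subspaceT (econtinuous_trmx taylor_econtinuous)).
exists a^T => b.
have [bA|bA] := pselect (A b^T).
  by have := ha b^T; rewrite trmxK; apply; rewrite inE.
apply: (@le_trans _ _ (h 0)).
  by have := ha 0; rewrite trmx0; apply; rewrite inE.
have {}bA : M < enorm b.
  move: bA => /existsNP[i]; rewrite mxE in_itv/= -ler_norml => /negP.
  by rewrite -ltNge => /lt_le_trans; apply; exact: ler_enorm_coord.
have := strongly_convex_first_order 0 b; rewrite add0r.
have /ler_normlP[Gb _] := cauchy_schwarz (G 0) b.
have := bA; rewrite /M ltr_pdivrMr// => MB.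
have : 2 * enorm (G 0) * enorm b <= enorm b * mu * enorm b.
  by rewrite ler_wpM2r// ltW.
by rewrite expr2; lra.
Qed.

End Argmin.

Section Projection.
Context {R : realType} (n : nat) (r : R).
Hypothesis r_gt0 : 0 < r.
Implicit Types v w : 'cV[R]_n.

Lemma proj_ballP v : enorm (proj_ball r v) <= r /\
  forall w, enorm w <= r -> enorm (proj_ball r v - v) <= enorm (w - v).
Proof.
have [vr|rv] := leP (enorm v) r.
  apply: (@argminP _ _ _ _ v) => //= w _; by rewrite subrr enorm0.
have v0 : 0 < enorm v by apply: lt_trans rv.
have sc : r / enorm v * enorm v = r by rewrite divfK// gt_eqF.
apply: (@argminP _ _ _ _ ((r / enorm v) *: v)) => /= [|w wr].
  by rewrite enormZ ger0_norm ?sc// divr_ge0// ltW.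
have -> : (r / enorm v) *: v - v = (r / enorm v - 1) *: v by rewrite scalerBl scale1r.
rewrite enormZ ler0_norm; last first.
  by rewrite subr_le0 ler_pdivrMr// mul1r ltW.
rewrite opprB mulrBl sc mul1r lerBlDr (le_trans _ (lerD (lexx _) wr))//.
have {1}-> : v = - (w - v) + w by rewrite opprB subrK.
by rewrite -(enormN (w - v)) ler_enormD.
Qed.

Lemma enorm_proj_ball v : enorm (proj_ball r v) <= r.
Proof. exact: (proj_ballP v).1. Qed.

(** The variational inequality of the projection: moving from the nearest
    point towards [w] inside the ball cannot decrease the distance to first order. *)
Lemma proj_ball_obtuse v w : enorm w <= r ->
  dot (v - proj_ball r v) (w - proj_ball r v) <= 0.
Proof.
move=> wr; have [] := proj_ballP v; set p := proj_ball r v => pr pmin.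
suff : 2 * dot (v - p) (w - p) <= 0 by lra.
apply: (@le_of_forall_small _ _ _ (enorm (w - p) ^+ 2)) => t /andP[t0 t1].
have := pmin (p + t *: (w - p)).
have -> : p + t *: (w - p) - v = t *: (w - p) - (v - p) by apply/colP => i; rewrite !mxE; ring.
have tr : enorm (p + t *: (w - p)) <= r.
  have -> : p + t *: (w - p) = (1 - t) *: p + t *: w.
    by apply/colP => i; rewrite !mxE; ring.
  rewrite (le_trans (ler_enormD _ _))// !enormZ !ger0_norm ?subr_ge0// ?(ltW t0)//.
  by have := ltW t0; nra.
rewrite tr => /(_ isT) /(ler_sqr_mono (enorm_ge0 _)).
rewrite -enormB [leRHS]enorm_sqB enormZ exprMn (gtr0_norm t0) dotZl (dotC (w - p)).
by move=> H; rewrite -(ler_pM2l t0) add0r; lra.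
Qed.

Lemma proj_ball_id w : enorm w <= r -> proj_ball r w = w.
Proof.
move=> wr; have := proj_ball_obtuse w wr; rewrite -enorm_sq => h.
apply/esym/eqP; rewrite -subr_eq0; apply/eqP/enorm_eq0/eqP.
by rewrite -sqrf_eq0 eq_le h sqr_ge0.
Qed.

(** Sum of the variational inequalities at the two projections. *)
Lemma proj_ball_nonexpansive v w :
  enorm (proj_ball r v - proj_ball r w) <= enorm (v - w).
Proof.
set p := proj_ball r v; set q := proj_ball r w.
have [->|pq0] := eqVneq (enorm (p - q)) 0; first exact: enorm_ge0.
have pq : 0 < enorm (p - q) by rewrite lt0r pq0/=.
rewrite -(ler_pM2r pq) (le_trans _ (dot_le _ _))// -expr2 enorm_sq.
have := proj_ball_obtuse v (enorm_proj_ball w).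
have := proj_ball_obtuse w (enorm_proj_ball v).
rewrite -/p -/q -(opprB p q) dotNr.
have -> : v - w = (v - p) - (w - q) + (p - q).
  by apply/colP => i; rewrite !mxE; ring.
move: (v - p) (w - q) (p - q) => a b c H1 H2.
by rewrite dotDl dotBl; lra.
Qed.

End Projection.

(** * The hyperobjective and its gradient *)

Section Blocks.
Context {R : realType} {dx dy : nat}.
Implicit Types (h : 'cV[R]_(dx + dy) -> R) (x : 'cV[R]_dx) (y v : 'cV[R]_dy).

Lemma grad_split h x y : grad h (col_mx x y) = col_mx (grad1 h x y) (grad2 h x y).
Proof. by rewrite vsubmxK. Qed.

Lemma usubmxB (u v : 'cV[R]_(dx + dy)) : usubmx (u - v) = usubmx u - usubmx v.
Proof. exact: linearB. Qed.

Lemma dsubmxB (u v : 'cV[R]_(dx + dy)) : dsubmx (u - v) = dsubmx u - dsubmx v.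
Proof. exact: linearB. Qed.

Lemma grad1_lip (L : R) h w w' : lipschitz_grad L h ->
  enorm (grad1 h (usubmx w) (dsubmx w) - grad1 h (usubmx w') (dsubmx w'))
    <= L * enorm (w - w').
Proof.
move=> Lh; rewrite /grad1 !vsubmxK -usubmxB.
exact: le_trans (ler_enorm_usubmx _) (Lh _ _).
Qed.

Lemma grad2_lip (L : R) h w w' : lipschitz_grad L h ->
  enorm (grad2 h (usubmx w) (dsubmx w) - grad2 h (usubmx w') (dsubmx w'))
    <= L * enorm (w - w').
Proof.
move=> Lh; rewrite /grad2 !vsubmxK -dsubmxB.
exact: le_trans (ler_enorm_dsubmx _) (Lh _ _).
Qed.

Lemma mul_col_mx (A : 'M[R]_(dx + dy)) x y : A *m col_mx x y =
  col_mx (ulsubmx A *m x + ursubmx A *m y) (dlsubmx A *m x + drsubmx A *m y).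
Proof. by rewrite -{1}[A]submxK mul_block_col. Qed.

Lemma mul_col_0mx (A : 'M[R]_(dx + dy)) y : A *m col_mx 0 y =
  col_mx (ursubmx A *m y) (drsubmx A *m y).
Proof. by rewrite mul_col_mx !mulmx0 !add0r. Qed.

Lemma hess12_lip (L : R) h w w' v : lipschitz_hess L h ->
  enorm ((hess12 h (usubmx w) (dsubmx w) - hess12 h (usubmx w') (dsubmx w')) *m v)
    <= L * enorm (w - w') * enorm v.
Proof.
move=> Lh; rewrite /hess12 !vsubmxK.
have -> : ursubmx (hess h w) - ursubmx (hess h w') = ursubmx (hess h w - hess h w').
  by apply/matrixP => i j; rewrite !mxE.
have -> : ursubmx (hess h w - hess h w') *m v
        = usubmx ((hess h w - hess h w') *m col_mx 0 v) by rewrite mul_col_0mx col_mxKu.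
apply: (le_trans (ler_enorm_usubmx _)); apply: (le_trans (ler_opnorm _ _)).
by rewrite enorm_col_0mx ler_wpM2r.
Qed.

Lemma hess22_lip (L : R) h w w' v : lipschitz_hess L h ->
  enorm ((hess22 h (usubmx w) (dsubmx w) - hess22 h (usubmx w') (dsubmx w')) *m v)
    <= L * enorm (w - w') * enorm v.
Proof.
move=> Lh; rewrite /hess22 !vsubmxK.
have -> : drsubmx (hess h w) - drsubmx (hess h w') = drsubmx (hess h w - hess h w').
  by apply/matrixP => i j; rewrite !mxE.
have -> : drsubmx (hess h w - hess h w') *m v
        = dsubmx ((hess h w - hess h w') *m col_mx 0 v) by rewrite mul_col_0mx col_mxKd.
apply: (le_trans (ler_enorm_dsubmx _)); apply: (le_trans (ler_opnorm _ _)).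
by rewrite enorm_col_0mx ler_wpM2r.
Qed.

Lemma hess12_bound (L1 L2 : R) h x y v : 0 <= L2 -> twice_differentiable h ->
  lipschitz_grad L1 h -> lipschitz_hess L2 h ->
  enorm (hess12 h x y *m v) <= L1 * enorm v.
Proof.
move=> L20 dh Lh1 Lh2; have := hess_bound (col_mx x y) (col_mx 0 v) L20 dh Lh1 Lh2.
rewrite enorm_col_0mx; apply: le_trans.
by rewrite mul_col_0mx -{1}(col_mxKu (hess12 h x y *m v) (hess22 h x y *m v)) ler_enorm_usubmx.
Qed.

Lemma hess22_bound (L1 L2 : R) h x y v : 0 <= L2 -> twice_differentiable h ->
  lipschitz_grad L1 h -> lipschitz_hess L2 h ->
  enorm (hess22 h x y *m v) <= L1 * enorm v.
Proof.
move=> L20 dh Lh1 Lh2; have := hess_bound (col_mx x y) (col_mx 0 v) L20 dh Lh1 Lh2.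
rewrite enorm_col_0mx; apply: le_trans.
by rewrite mul_col_0mx -{1}(col_mxKd (hess12 h x y *m v) (hess22 h x y *m v)) ler_enorm_dsubmx.
Qed.

Lemma sub_col_mx x x' y y' : col_mx x y - col_mx x' y' = col_mx (x - x') (y - y').
Proof. by rewrite opp_col_mx add_col_mx. Qed.

Lemma enorm_sub_col_mx x x' y y' :
  enorm (col_mx x y - col_mx x' y') <= enorm (x - x') + enorm (y - y').
Proof. by rewrite sub_col_mx ler_enorm_col_mx. Qed.

Lemma enorm_sub_col_mxr x y y' :
  enorm (col_mx x y - col_mx x y') = enorm (y - y').
Proof. by rewrite sub_col_mx subrr enorm_col_0mx. Qed.

End Blocks.

Section Bilevel.
Context {R : realType} {dx dy : nat}.
Variables (f g : 'cV[R]_(dx + dy) -> R) (Lf Cf L1 L2 mu : R).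
Hypotheses (Lf_gt0 : 0 < Lf) (Cf_gt0 : 0 < Cf) (L1_gt0 : 0 < L1)
  (L2_gt0 : 0 < L2) (mu_gt0 : 0 < mu).
Hypotheses (f_diff : everywhere_differentiable f) (g_diff : twice_differentiable g).
Hypotheses (f_lip : lipschitz_grad Lf f) (g_lip1 : lipschitz_grad L1 g)
  (g_lip2 : lipschitz_hess L2 g).
Hypothesis g_sc : forall x, strongly_convex mu (fun y : 'cV[R]_dy => g (col_mx x y)).
Hypothesis f_bound : forall x, enorm (grad2 f x (lower_sol g x)) <= Cf.
Implicit Types (x : 'cV[R]_dx) (y v z : 'cV[R]_dy).

Let r := Cf / mu.
Let kappa := L1 / mu.

(** Lipschitz constant in [y] of the linear-system residual
    [hess22 g * z - grad2 f] when [z] stays in the ball of radius [Cf / mu]. *)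
Definition radius_lip := Lf + L2 * r.
Local Notation Q := radius_lip.
Let lam := Q * (1 + kappa) / mu.

Let r_gt0 : 0 < r. Proof. exact: divr_gt0. Qed.
Let kappa_gt0 : 0 < kappa. Proof. exact: divr_gt0. Qed.
Lemma radius_lip_gt0 : 0 < Q. Proof. by rewrite addr_gt0// mulr_gt0. Qed.
Let L1_ge0 : 0 <= L1. Proof. exact: ltW. Qed.
Let L2_ge0 : 0 <= L2. Proof. exact: ltW. Qed.

Lemma g_taylor2 x y v :
  `|g (col_mx x (y + v)) - g (col_mx x y) - dot (grad2 g x y) v| <= L1 * enorm v ^+ 2.
Proof.
have := @taylor1 R _ L1 g (col_mx x y) (col_mx 0 v) L1_ge0 g_diff.1 g_lip1.
by rewrite add_col_mx addr0 grad_split dot_col_mx dot0r add0r enorm_col_0mx.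
Qed.

Lemma lower_solP x y : g (col_mx x (lower_sol g x)) <= g (col_mx x y).
Proof.
have [a ha] := strongly_convex_has_min L1_ge0 mu_gt0 (g_taylor2 x) (g_sc x).
by have [_ ->] := @argminP _ _ setT (fun y => g (col_mx x y)) a I (fun b _ => ha b).
Qed.

Lemma grad2_lower_sol x : grad2 g x (lower_sol g x) = 0.
Proof. exact: (min_grad0 L1_ge0 (g_taylor2 x) (lower_solP x)). Qed.

Lemma grad2_monotone x y y' :
  mu * enorm (y - y') ^+ 2 <= dot (grad2 g x y - grad2 g x y') (y - y').
Proof. exact: (strongly_convex_monotone L1_ge0 (g_taylor2 x) (g_sc x)). Qed.

Lemma grad1_lip2 (L : R) h x x' y y' : lipschitz_grad L h ->
  enorm (grad1 h x y - grad1 h x' y') <= L * enorm (col_mx x y - col_mx x' y').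
Proof.
by move=> Lh; have := grad1_lip (col_mx x y) (col_mx x' y') Lh; rewrite !col_mxKu !col_mxKd.
Qed.

Lemma grad2_lip2 (L : R) h x x' y y' : lipschitz_grad L h ->
  enorm (grad2 h x y - grad2 h x' y') <= L * enorm (col_mx x y - col_mx x' y').
Proof.
by move=> Lh; have := grad2_lip (col_mx x y) (col_mx x' y') Lh; rewrite !col_mxKu !col_mxKd.
Qed.

Lemma hess12_lip2 (L : R) h x x' y y' v : lipschitz_hess L h ->
  enorm ((hess12 h x y - hess12 h x' y') *m v)
    <= L * enorm (col_mx x y - col_mx x' y') * enorm v.
Proof.
by move=> Lh; have := hess12_lip (col_mx x y) (col_mx x' y') v Lh; rewrite !col_mxKu !col_mxKd.
Qed.

Lemma hess22_lip2 (L : R) h x x' y y' v : lipschitz_hess L h ->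
  enorm ((hess22 h x y - hess22 h x' y') *m v)
    <= L * enorm (col_mx x y - col_mx x' y') * enorm v.
Proof.
by move=> Lh; have := hess22_lip (col_mx x y) (col_mx x' y') v Lh; rewrite !col_mxKu !col_mxKd.
Qed.

(** Differentiating the strong monotonicity of the gradient along [v]. *)
Lemma hess22_coercive x y v : mu * enorm v ^+ 2 <= dot v (hess22 g x y *m v).
Proof.
apply: (@le_of_forall_small _ _ _ (L2 * enorm v ^+ 3)) => t /andP[t0 t1].
have := grad2_monotone x (y + t *: v) y.
rewrite [y + _ - y]addrC addKr enormZ (gtr0_norm t0) exprMn => M.
have := taylor2 (col_mx x y) (col_mx 0 (t *: v)) L2_ge0 g_diff g_lip2.
rewrite add_col_mx addr0 mul_col_0mx !grad_split !sub_col_mx => T.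
have {}T := le_trans (ler_enorm_dsubmx _) T.
rewrite col_mxKd enorm_col_0mx -/(hess22 g x y) in T.
set e := enorm _ in T; pose e' := grad2 g x (y + t *: v) - grad2 g x y - hess22 g x y *m (t *: v).
have C := dot_le e' (t *: v).
rewrite -(ler_pM2l t0) -(ler_pM2l t0).
have D : dot (grad2 g x (y + t *: v) - grad2 g x y) (t *: v) =
   dot e' (t *: v) + t * (t * dot v (hess22 g x y *m v)).
  rewrite -dotZr -dotZl scalemxAr (dotC (t *: v) (hess22 _ _ _ *m _)) -dotDl.
  by congr dot; rewrite /e' subrK.
rewrite D in M.
have : enorm e' * enorm (t *: v) <= L2 * enorm (t *: v) ^+ 2 * enorm (t *: v).
  by rewrite ler_wpM2r.
rewrite -mulrA -exprSr enormZ (gtr0_norm t0) exprMn.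
rewrite enormZ (gtr0_norm t0) in C.
by lra.
Qed.

Lemma hess22_unit x y : hess22 g x y \in unitmx.
Proof.
rewrite -unitmx_tr -row_free_unit -kermx_eq0; apply/negPn/negP => /rowV0Pn[u /sub_kermxP uk].
move=> /eqP; apply; apply: trmx_inj; rewrite trmx0; apply: enorm_eq0; apply/eqP.
have H : hess22 g x y *m u^T = 0 by apply: trmx_inj; rewrite trmx_mul trmxK uk trmx0.
have := hess22_coercive x y u^T; rewrite H dot0r pmulr_rle0// => h.
by rewrite -sqrf_eq0 eq_le h sqr_ge0.
Qed.

Lemma enorm_le_of_coercive x y v (a : R) :
  enorm (hess22 g x y *m v) <= a -> enorm v <= a / mu.
Proof.
move=> Ha; rewrite ler_pdivlMr//.
have [v0|v0] := eqVneq (enorm v) 0.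
  by rewrite v0 mul0r (le_trans _ Ha).
have vv : 0 < enorm v by rewrite lt0r v0/=.
rewrite -(ler_pM2r vv); apply: le_trans (ler_wpM2r (ltW vv) Ha).
rewrite [X in X * _]mulrC -mulrA -expr2 (le_trans (hess22_coercive x y v))//.
by rewrite mulrC dot_le.
Qed.

(** Strong monotonicity in [y] against the change of [grad2 g] caused by
    moving [x]. *)
Lemma lower_sol_lip x x' :
  enorm (lower_sol g x - lower_sol g x') <= kappa * enorm (x - x').
Proof.
set y := lower_sol g x; set y' := lower_sol g x'.
have [->|v0] := eqVneq (enorm (y - y')) 0; first by rewrite mulr_ge0// ltW.
have vv : 0 < enorm (y - y') by rewrite lt0r v0/=.
rewrite /kappa mulrAC ler_pdivlMr// mulrC -(ler_pM2r vv) -mulrA -expr2.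
apply: (le_trans (grad2_monotone x y y')).
rewrite {1}/y grad2_lower_sol -(grad2_lower_sol x') -/y' (le_trans (dot_le _ _))//.
rewrite ler_wpM2r// (le_trans (grad2_lip2 _ _ _ _ g_lip1))//.
by rewrite sub_col_mx subrr enorm_col_mx0 enormB.
Qed.

(** Solution of the linear system which implicit differentiation of
    [grad2 g (x, y*(x)) = 0] leads to; the variable [z] of the algorithm tracks it. *)
Definition zstar x := invmx (hess22 g x (lower_sol g x)) *m grad2 f x (lower_sol g x).

Lemma zstarE x : hess22 g x (lower_sol g x) *m zstar x = grad2 f x (lower_sol g x).
Proof. by rewrite mulKVmx// hess22_unit. Qed.

Lemma zstar_bound x : enorm (zstar x) <= r.
Proof. by apply: (@enorm_le_of_coercive x (lower_sol g x)); rewrite zstarE. Qed.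

Lemma col_lower_sol_lip x x' :
  enorm (col_mx x (lower_sol g x) - col_mx x' (lower_sol g x')) <= (1 + kappa) * enorm (x - x').
Proof.
rewrite (le_trans (enorm_sub_col_mx _ _ _ _))// mulrDl mul1r lerD2l.
exact: lower_sol_lip.
Qed.

(** The difference of the two linear systems is again a linear system with
    the matrix at [x], whose right-hand side is controlled by the bound on [zstar]. *)
Lemma zstar_lip x x' : enorm (zstar x - zstar x') <= lam * enorm (x - x').
Proof.
rewrite /lam mulrAC; apply: (@enorm_le_of_coercive x (lower_sol g x)).
have -> : hess22 g x (lower_sol g x) *m (zstar x - zstar x') =
   (grad2 f x (lower_sol g x) - grad2 f x' (lower_sol g x')) -
   (hess22 g x (lower_sol g x) - hess22 g x' (lower_sol g x')) *m zstar x'.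
  have := zstarE x; have := zstarE x'.
  move: (hess22 g x _) (hess22 g x' _) (zstar x) (zstar x') => A B z z' <- <-.
  by rewrite mulmxBr mulmxBl [in RHS]opprB addrA subrK.
apply: (le_trans (ler_enormB _ _)).
rewrite -mulrA; have := col_lower_sol_lip x x'; set D := enorm (col_mx _ _ - _) => HD.
rewrite /Q mulrDl; apply: lerD.
  apply: (le_trans (grad2_lip2 _ _ _ _ f_lip)); rewrite -/D ler_wpM2l//; exact: ltW.
apply: (le_trans (hess22_lip2 _ _ _ _ _ g_lip2)); rewrite -/D mulrAC.
apply: ler_pM => //; [exact: mulr_ge0|exact: enorm_ge0|].
by apply: ler_wpM2l => //; exact: zstar_bound.
Qed.

Definition hypergrad x :=
  grad1 f x (lower_sol g x) - hess12 g x (lower_sol g x) *m zstar x.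

(** The constant of the quadratic remainder of [hyperobjective]; the factor
    [1 + kappa^2] bounds the squared length of [(h, y*(x + h) - y*(x))]. *)
Definition hyper_lip := (Lf + r * L2) * (1 + kappa ^+ 2).
Local Notation LH := hyper_lip.

Lemma hyper_lip_gt0 : 0 < LH.
Proof. by apply: mulr_gt0; apply: addr_gt0 => //; [exact: mulr_gt0|exact: exprn_gt0]. Qed.

(** Linearizing [0 = grad2 g (x, y*(x))] gives the first-order change of [y*];
    pairing it with [z*] turns the term [<grad2 f, y*(x + h) - y*(x)>] into
    [- <hess12 g z*, h>]. *)
Lemma hyper_taylor x (h : 'cV[R]_dx) :
  `|hyperobjective f g (x + h) - hyperobjective f g x - dot (hypergrad x) h|
    <= LH * enorm h ^+ 2.
Proof.
rewrite /hyperobjective; set y := lower_sol g x; set d := lower_sol g (x + h) - y.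
have yd : lower_sol g (x + h) = y + d by rewrite /d [RHS]addrC subrK.
have Tf := taylor1 (col_mx x y) (col_mx h d) (ltW Lf_gt0) f_diff f_lip.
have Tg := taylor2 (col_mx x y) (col_mx h d) L2_ge0 g_diff g_lip2.
rewrite !add_col_mx -yd enorm_col_mx_sq ?grad_split dot_col_mx in Tf.
rewrite !add_col_mx -yd enorm_col_mx_sq !grad_split sub_col_mx in Tg.
have S : enorm h ^+ 2 + enorm d ^+ 2 <= (1 + kappa ^+ 2) * enorm h ^+ 2.
  rewrite mulrDl mul1r lerD2l -exprMn; apply: ler_sqr_mono => //.
  by have := lower_sol_lip (x + h) x; rewrite [x + h]addrC addrK addrC.
set H := hess g (col_mx x y) in Tg.
pose e := dlsubmx H *m h + hess22 g x y *m d.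
have Te : enorm e <= L2 * (enorm h ^+ 2 + enorm d ^+ 2).
  apply: le_trans Tg; apply: le_trans (ler_enorm_dsubmx _).
  rewrite mul_col_mx sub_col_mx col_mxKd !grad2_lower_sol subrr sub0r.
  by rewrite enormN.
(* Symmetry of the Hessian moves it from [z*] to the displacement. *)
have E1 : dot (grad2 f x y) d = dot (zstar x) (hess22 g x y *m d).
  have := hess_sym (col_mx x y) (col_mx 0 d) (col_mx 0 (zstar x)) L2_ge0 g_diff g_lip2.
  by rewrite !mul_col_0mx !dot_col_mx !dot0l !add0r -!/(hess22 g x y) zstarE -/y dotC.
have E2 : dot (hess12 g x y *m zstar x) h = dot (zstar x) (dlsubmx H *m h).
  have := hess_sym (col_mx x y) (col_mx 0 (zstar x)) (col_mx h 0) L2_ge0 g_diff g_lip2.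
  rewrite mul_col_0mx mul_col_mx !dot_col_mx !dot0l !mulmx0 addr0 add0r addr0 -!/(hess12 g x y).
  by rewrite (dotC h) => <-.
have E3 : dot (zstar x) e = dot (hess12 g x y *m zstar x) h + dot (grad2 f x y) d.
  by rewrite E1 E2 -dotDr.
have Z : `|dot (zstar x) e| <= r * (L2 * (enorm h ^+ 2 + enorm d ^+ 2)).
  by rewrite (le_trans (cauchy_schwarz _ _))// ler_pM// zstar_bound.
rewrite /hypergrad -/y dotBl.
set a := f _ - f _ in Tf *.
have -> : a - (dot (grad1 f x y) h - dot (hess12 g x y *m zstar x) h) =
   (a - (dot (grad1 f x y) h + dot (grad2 f x y) d)) + dot (zstar x) e.
  by rewrite E3; ring.
rewrite (le_trans (ler_normD _ _))// (le_trans (lerD Tf Z))//.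
rewrite mulrA -mulrDl /LH -[leRHS]mulrA ler_wpM2l//.
by apply: addr_ge0; [exact: ltW|apply: mulr_ge0 => //; exact: ltW].
Qed.

Lemma grad_hyperobjective x : grad (hyperobjective f g) x = hypergrad x.
Proof.
apply/colP => i; rewrite mxE /derive -(dot_delta (hypergrad x)).
set v := delta_mx i 0; apply: cvg_lim => //.
apply/cvgrPdist_le => e e0; apply/nbhs_ballP.
exists (e / LH) => /=; first by rewrite divr_gt0// hyper_lip_gt0.
move=> t; rewrite /ball/= sub0r normrN ltr_pdivlMr ?hyper_lip_gt0// => te tn0.
have tt : 0 < `|t| by rewrite normr_gt0.
rewrite distrC -(ler_pM2l tt) -normrM mulrBr /= [t * (_ *: _)]mulrA mulfV// mul1r.
rewrite -dotZr [_ + x]addrC (le_trans (hyper_taylor _ _))//.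
rewrite enormZ enorm_delta mulr1 mulrC expr2 -mulrA ler_wpM2l//; exact: ltW.
Qed.

Lemma hyper_descent x (h : 'cV[R]_dx) :
  hyperobjective f g (x + h) <=
    hyperobjective f g x + dot (hypergrad x) h + LH * enorm h ^+ 2.
Proof. by have /ler_normlP[_] := hyper_taylor x h; lra. Qed.

End Bilevel.

(** * One iteration along a sample path *)

Section RealInequalities.
Context {R : realType}.
Implicit Types a b c s t n : R.

Lemma young a b t : 0 < t -> 2 * (a * b) <= t * a ^+ 2 + t^-1 * b ^+ 2.
Proof.
move=> t0; have := sqr_ge0 (t * a - b).
have -> : (t * a - b) ^+ 2 = t * (t * a ^+ 2 + t^-1 * b ^+ 2 - 2 * (a * b)).
  by field; rewrite gt_eqF.
by rewrite pmulr_rge0// subr_ge0.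
Qed.

(** Squaring a contraction with a perturbation [b]: Young's inequality with
    parameter [s / 2] keeps half of the contraction and costs a factor [3 / s]. *)
Lemma contraction_sq n' n a b s : 0 < s <= 1 -> 0 <= n' ->
  n' <= a + b -> a ^+ 2 <= (1 - s) * n ^+ 2 ->
  n' ^+ 2 <= (1 - s / 2) * n ^+ 2 + 3 / s * b ^+ 2.
Proof.
move=> /andP[s0 s1] n'0 /(ler_sqr_mono n'0) H an; apply: (le_trans H).
have s2 : 0 < s / 2 by lra.
have Y := young a b s2; rewrite invf_div in Y.
have si : b ^+ 2 <= s^-1 * b ^+ 2 by rewrite ler_peMl ?sqr_ge0// invf_ge1.
have : (1 + s / 2) * a ^+ 2 <= (1 + s / 2) * ((1 - s) * n ^+ 2).
  by rewrite ler_wpM2l//; lra.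
have : 0 <= s ^+ 2 * n ^+ 2 by rewrite mulr_ge0 ?sqr_ge0.
rewrite (mulrC 3 s^-1) (mulrC 2 s^-1) in Y *.
rewrite -!mulrA in Y *.
by nra.
Qed.

Lemma sqr_add3_le a b c : (a + b + c) ^+ 2 <= 3 * (a ^+ 2 + b ^+ 2 + c ^+ 2).
Proof.
by have := sqr_ge0 (a - b); have := sqr_ge0 (a - c); have := sqr_ge0 (b - c); lra.
Qed.

Lemma sqr_add2_le a b : (a + b) ^+ 2 <= 2 * (a ^+ 2 + b ^+ 2).
Proof. by have := sqr_ge0 (a - b); lra. Qed.

(** The size of the coupling constant [c = 1 + k S] makes the cross term
    between the fast and the slow variable negligible. *)
Lemma coupling_small (k S : R) : 0 <= S -> 0 < k ->
  S / (1 + k * S) ^+ 2 <= k^-1.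
Proof.
move=> S0 k0; have kS : 0 <= k * S by rewrite mulr_ge0// ltW.
rewrite ler_pdivrMr; last by rewrite exprn_gt0//; lra.
rewrite -(ler_pM2l k0) mulrA mulfV ?gt_eqF// mul1r; nra.
Qed.

(** Sum of the one-step inequalities for [H] and for the two weighted tracking
    errors. The coefficients of [ye] and [ze] in the hypotheses are those for which
    the losses beat every gain and leave one unit of each error, and the two
    terms [al / 16 * x2] use up half of the descent [al / 4 * x2]. *)
Lemma potential_balance (al H H0 Y Y0 Z Z0 g2 x2 ye ze d1 d2 d3 p q Qs Ls : R) :
  0 < al -> 0 <= p -> 0 <= q -> 0 <= d1 -> 0 <= d2 -> 0 <= d3 ->
  H + al / 2 * g2 + al / 4 * x2 <= H0 + al / 2 * (3 * (Qs * ye + Ls * ze + d1)) ->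
  Y <= Y0 - al * (3 / 2 * Qs + 9 * q * Qs + 1) * ye + al * (6 * p) * d2 + al / 16 * x2 ->
  Z <= Z0 - al * (3 / 2 * Ls + 1) * ze + al * (9 * q) * (Qs * ye)
    + al * (9 * q) * d3 + al / 16 * x2 ->
  H + Y + Z + al / 2 * g2 + al * (8^-1 * x2 + ye + ze)
  <= H0 + Y0 + Z0 + al * (3 / 2 + 6 * p + 9 * q) * (d1 + d2 + d3).
Proof.
move=> /ltW a0 p0 q0 d10 d20 d30 Hh Hy Hz.
have G1 := mulr_ge0 a0 (mulr_ge0 p0 d10); have G2 := mulr_ge0 a0 (mulr_ge0 q0 d10).
have G3 := mulr_ge0 a0 (mulr_ge0 q0 d20); have G4 := mulr_ge0 a0 (mulr_ge0 p0 d30).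
have G5 := mulr_ge0 a0 d20; have G6 := mulr_ge0 a0 d30.
by lra.
Qed.

(** With the weight [s / c] and the step [c al], the gain of the contraction
    does not depend on [c], while the perturbation is divided by [c^2]: this is why
    a large ratio [c] of step sizes decouples the fast variables. *)
Lemma weighted_contraction (s c al m n rho : R) :
  0 < c -> 0 < al -> 0 < m ->
  s / c * ((1 - c * al * m / 2) * n + 3 / (c * al * m) * rho) =
  s / c * n - al * (s * m / 2) * n + 3 * (s / m / c ^+ 2) * (rho / al).
Proof. by move=> c0 al0 m0; field; rewrite !gt_eqF. Qed.

Lemma drift_balance (a b c l q X Y Z D1 D2 D3 vy vz : R) :
  0 <= a -> 0 <= b -> 0 <= c -> 0 <= l -> 0 <= q ->
  0 <= X -> 0 <= Y -> 0 <= Z -> 0 <= D1 -> 0 <= D2 -> 0 <= D3 ->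
  vy <= 2 * (l * Y + D2) -> vz <= 3 * (l * Z + q * Y + D3) ->
  a * X + b * a * vy + 2 * (c * a * vz) <=
  a * (1 + 2 * b * (l + 1) + 6 * c * (l + q + 1)) * (X + Y + Z + (D1 + D2 + D3)).
Proof.
move=> ha hb hc hl hq X0 Y0 Z0 D10 D20 D30 Vy Vz.
pose S := X + Y + Z + (D1 + D2 + D3).
have S1 : l * Y <= l * S by rewrite ler_wpM2l// /S; lra.
have S2 : l * Z <= l * S by rewrite ler_wpM2l// /S; lra.
have S3 : q * Y <= q * S by rewrite ler_wpM2l// /S; lra.
have B1 : vy <= 2 * ((l + 1) * S) by rewrite /S in S1 *; lra.
have B2 : vz <= 3 * ((l + q + 1) * S) by rewrite /S in S2 S3 *; lra.
have B3 : X <= S by rewrite /S; lra.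
rewrite -/S; move: (S) B1 B2 B3 => T B1 B2 B3.
have {}B1 := ler_wpM2l (mulr_ge0 hb ha) B1.
have {}B2 := ler_wpM2l (mulr_ge0 hc ha) B2.
have {}B3 := ler_wpM2l ha B3.
clear -B1 B2 B3; lra.
Qed.

End RealInequalities.

Section Step.
Context {R : realType} {dx dy : nat}.
Variables (f g : 'cV[R]_(dx + dy) -> R) (Lf Cf L1 L2 mu : R).
Hypotheses (Lf_gt0 : 0 < Lf) (Cf_gt0 : 0 < Cf) (L1_gt0 : 0 < L1)
  (L2_gt0 : 0 < L2) (mu_gt0 : 0 < mu).
Hypotheses (f_diff : everywhere_differentiable f) (g_diff : twice_differentiable g).
Hypotheses (f_lip : lipschitz_grad Lf f) (g_lip1 : lipschitz_grad L1 g)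
  (g_lip2 : lipschitz_hess L2 g).
Hypothesis g_sc : forall x, strongly_convex mu (fun y : 'cV[R]_dy => g (col_mx x y)).
Hypothesis f_bound : forall x, enorm (grad2 f x (lower_sol g x)) <= Cf.
Implicit Types (u v : triple R dx dy).

Let r := Cf / mu.
Let kappa := L1 / mu.
Let Q := radius_lip Lf Cf L2 mu.
Let lam := Q * (1 + kappa) / mu.
Let LH := hyper_lip Lf Cf L1 L2 mu.

Let r_gt0 : 0 < r. Proof. exact: divr_gt0. Qed.
Let L2_ge0 : 0 <= L2. Proof. exact: ltW. Qed.

Let zs_bound x : enorm (zstar f g x) <= r.
Proof. exact: zstar_bound L1_gt0 L2_gt0 mu_gt0 g_diff g_lip1 g_lip2 g_sc f_bound x. Qed.
Let zs_lip x x' : enorm (zstar f g x - zstar f g x') <= lam * enorm (x - x').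
Proof.
exact: zstar_lip Lf_gt0 L1_gt0 L2_gt0 mu_gt0 g_diff f_lip g_lip1 g_lip2 g_sc f_bound x x'.
Qed.
Let zsE x : hess22 g x (lower_sol g x) *m zstar f g x = grad2 f x (lower_sol g x).
Proof. exact: zstarE L1_gt0 L2_gt0 mu_gt0 g_diff g_lip1 g_lip2 g_sc x. Qed.
Let ys_lip x x' : enorm (lower_sol g x - lower_sol g x') <= kappa * enorm (x - x').
Proof. exact: lower_sol_lip L1_gt0 mu_gt0 g_diff g_lip1 g_sc x x'. Qed.
Let ys_grad x : grad2 g x (lower_sol g x) = 0.
Proof. exact: grad2_lower_sol L1_gt0 mu_gt0 g_diff g_lip1 g_sc x. Qed.
Let h22_coercive x y (v : 'cV[R]_dy) : mu * enorm v ^+ 2 <= dot v (hess22 g x y *m v).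
Proof. exact: hess22_coercive L1_gt0 L2_gt0 g_diff g_lip1 g_lip2 g_sc x y v. Qed.
Let h22_bound x y (v : 'cV[R]_dy) : enorm (hess22 g x y *m v) <= L1 * enorm v.
Proof. exact: hess22_bound L2_ge0 g_diff g_lip1 g_lip2. Qed.
Let h12_bound x y (v : 'cV[R]_dy) : enorm (hess12 g x y *m v) <= L1 * enorm v.
Proof. exact: hess12_bound L2_ge0 g_diff g_lip1 g_lip2. Qed.

Definition yerr u := enorm (ty u - lower_sol g (tx u)).
Definition zerr u := enorm (tz u - zstar f g (tx u)).

Lemma yerr_ge0 u : 0 <= yerr u. Proof. exact: enorm_ge0. Qed.
Lemma zerr_ge0 u : 0 <= zerr u. Proof. exact: enorm_ge0. Qed.

Lemma exact_dirE u : exact_dir f g u =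
  Triple (grad1 f (tx u) (ty u) - hess12 g (tx u) (ty u) *m tz u)
         (grad2 g (tx u) (ty u))
         (hess22 g (tx u) (ty u) *m tz u - grad2 f (tx u) (ty u)).
Proof. by case: u. Qed.

(** Replacing [y* x] and [z* x] by the current [y] and [z] in the formula of
    the hypergradient. *)
Lemma dir_x_bias u :
  enorm (tx (exact_dir f g u) - hypergrad f g (tx u)) <= Q * yerr u + L1 * zerr u.
Proof.
rewrite exact_dirE/= /hypergrad; case: u => x y z /=; rewrite /yerr /zerr/=.
set ys := lower_sol g x; set zs := zstar f g x.
have -> : grad1 f x y - hess12 g x y *m z - (grad1 f x ys - hess12 g x ys *m zs) =
  (grad1 f x y - grad1 f x ys) - (hess12 g x y - hess12 g x ys) *m zs
  - hess12 g x y *m (z - zs).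
  move: (grad1 f x y) (grad1 f x ys) (hess12 g x y) (hess12 g x ys) => a b A B.
  rewrite mulmxBr mulmxBl; apply/colP => i.
  by rewrite ![in RHS]mxE ![in LHS]mxE; move: (\sum_j _) (\sum_j _) (\sum_j _); rewrite ?mxE; intros; ring.
rewrite (le_trans (ler_enormB _ _))//; apply: lerD; last exact: h12_bound.
rewrite (le_trans (ler_enormB _ _))// /Q /radius_lip mulrDl; apply: lerD.
  by rewrite (le_trans (grad1_lip2 _ _ _ _ f_lip))// enorm_sub_col_mxr.
apply: (le_trans (hess12_lip2 _ _ _ _ _ g_lip2)); rewrite enorm_sub_col_mxr mulrAC.
by rewrite ler_wpM2r// ler_wpM2l//; exact: zs_bound.
Qed.

Lemma dir_y_bound u : enorm (ty (exact_dir f g u)) <= L1 * yerr u.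
Proof.
rewrite exact_dirE/= -[X in enorm X]subr0.
have <- : grad2 g (tx u) (lower_sol g (tx u)) = 0 by exact: ys_grad.
by rewrite (le_trans (grad2_lip2 _ _ _ _ g_lip1))// enorm_sub_col_mxr.
Qed.

(** The [z]-direction is [hess22 g] times [z - z*] plus this term, which vanishes
    when [y = y*]. *)
Definition dir_z_bias u :=
  tz (exact_dir f g u) - hess22 g (tx u) (ty u) *m (tz u - zstar f g (tx u)).

Lemma dir_z_bias_bound u : enorm (dir_z_bias u) <= Q * yerr u.
Proof.
rewrite /dir_z_bias exact_dirE/=; case: u => x y z /=; rewrite /yerr /=.
set ys := lower_sol g x; set zs := zstar f g x.
have E : hess22 g x ys *m zs = grad2 f x ys by exact: zsE.
have -> : hess22 g x y *m z - grad2 f x y - hess22 g x y *m (z - zs) =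
   (hess22 g x y - hess22 g x ys) *m zs - (grad2 f x y - grad2 f x ys).
  rewrite -E; move: (grad2 f x y) (hess22 g x y) (hess22 g x ys) => a A B.
  rewrite mulmxBr mulmxBl; move: (A *m z) (A *m zs) (B *m zs) => p q s.
  by apply/colP => i; rewrite !mxE; ring.
rewrite (le_trans (ler_enormB _ _))// /Q /radius_lip mulrDl addrC; apply: lerD.
  by rewrite (le_trans (grad2_lip2 _ _ _ _ f_lip))// enorm_sub_col_mxr.
apply: (le_trans (hess22_lip2 _ _ _ _ _ g_lip2)); rewrite enorm_sub_col_mxr mulrAC.
by rewrite ler_wpM2r// ler_wpM2l//; exact: zs_bound.
Qed.

Lemma dir_z_bound u : enorm (tz (exact_dir f g u)) <= L1 * zerr u + Q * yerr u.
Proof.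
have -> : tz (exact_dir f g u) =
   hess22 g (tx u) (ty u) *m (tz u - zstar f g (tx u)) + dir_z_bias u.
  by rewrite addrC subrK.
by rewrite (le_trans (ler_enormD _ _))// lerD ?dir_z_bias_bound ?h22_bound.
Qed.

(** In the expansion of the square the inner product gives [- 2 b mu], and
    [b * L1^2 <= mu] makes the quadratic term cost at most half of that. *)
Lemma gradient_step_contract n (w Dw : 'cV[R]_n) (b : R) : 0 < b ->
  b * L1 ^+ 2 <= mu -> mu * enorm w ^+ 2 <= dot Dw w -> enorm Dw <= L1 * enorm w ->
  enorm (w - b *: Dw) ^+ 2 <= (1 - b * mu) * enorm w ^+ 2.
Proof.
move=> b0 bL mono lip; rewrite enorm_sqB dotZr enormZ exprMn (gtr0_norm b0) dotC.
have D2 : enorm Dw ^+ 2 <= L1 ^+ 2 * enorm w ^+ 2 by rewrite -exprMn; exact: ler_sqr_mono.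
have : b * mu * enorm w ^+ 2 <= b * dot Dw w by rewrite -mulrA ler_pM2l.
have : b * (b * enorm Dw ^+ 2) <= b * (mu * enorm w ^+ 2).
  rewrite ler_pM2l//; apply: (@le_trans _ _ (b * (L1 ^+ 2 * enorm w ^+ 2))).
    by rewrite ler_pM2l.
  by rewrite mulrA ler_wpM2r// sqr_ge0.
by lra.
Qed.

Lemma yerr_step (alpha beta gamma : R) u v : 0 < alpha -> 0 < beta ->
  beta * L1 ^+ 2 <= mu -> beta * mu <= 1 ->
  yerr (spaba_update r alpha beta gamma u v) ^+ 2 <=
    (1 - beta * mu / 2) * yerr u ^+ 2 +
    3 / (beta * mu) * (beta * enorm (ty v - ty (exact_dir f g u))
      + kappa * (alpha * enorm (tx v))) ^+ 2.
Proof.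
move=> a0 b0 bL bm.
pose a := enorm (ty u - lower_sol g (tx u) - beta *: ty (exact_dir f g u)).
apply: (@contraction_sq _ _ _ a) => //.
- by rewrite mulr_gt0.
- exact: yerr_ge0.
- rewrite /yerr /spaba_update/= /a.
  set ys := lower_sol g (tx u); set ys' := lower_sol g _; set Dy := ty (exact_dir f g u).
  have -> : ty u - beta *: ty v - ys' = (ty u - ys - beta *: Dy)
     + (- beta *: (ty v - Dy) + (ys - ys')).
    by apply/colP => i; rewrite !mxE; ring.
  rewrite (le_trans (ler_enormD _ _))// lerD2l (le_trans (ler_enormD _ _))//.
  rewrite enormZ normrN (gtr0_norm b0) lerD2l.
  have -> : alpha * enorm (tx v) = enorm (tx u - (tx u - alpha *: tx v)).
    by rewrite opprB addrC subrK enormZ (gtr0_norm a0).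
  exact: ys_lip.
- apply: gradient_step_contract => //; last exact: dir_y_bound.
  rewrite exact_dirE/=; have := grad2_monotone L1_gt0 g_diff g_lip1 g_sc (tx u) (ty u) (lower_sol g (tx u)).
  by rewrite ys_grad subr0.
Qed.

(** The projection does not increase the distance to [z* x], a point of the
    ball; before it, the step is a contraction towards [z* x] up to the bias, the
    noise and the displacement of [z* x]. *)
Lemma zerr_step (alpha beta gamma : R) u v : 0 < alpha -> 0 < gamma ->
  gamma * L1 ^+ 2 <= mu -> gamma * mu <= 1 ->
  zerr (spaba_update r alpha beta gamma u v) ^+ 2 <=
    (1 - gamma * mu / 2) * zerr u ^+ 2 +
    3 / (gamma * mu) * (gamma * (Q * yerr u)
      + gamma * enorm (tz v - tz (exact_dir f g u))
      + lam * (alpha * enorm (tx v))) ^+ 2.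
Proof.
move=> a0 b0 bL bm; set w := tz u - zstar f g (tx u).
pose a := enorm (w - gamma *: (hess22 g (tx u) (ty u) *m w)).
apply: (@contraction_sq _ _ _ a) => //.
- by rewrite mulr_gt0.
- exact: zerr_ge0.
- rewrite /zerr /spaba_update/= /a.
  set zs := zstar f g (tx u); set zs' := zstar f g _; set Dz := tz (exact_dir f g u).
  have zsr : enorm zs <= r by exact: zs_bound.
  have -> : proj_ball r (tz u - gamma *: tz v) - zs' =
    (proj_ball r (tz u - gamma *: tz v) - proj_ball r zs) + (zs - zs').
    by rewrite (proj_ball_id r_gt0 zsr) addrA subrK.
  rewrite (le_trans (ler_enormD _ _))// !addrA; apply: lerD; last first.
    have -> : alpha * enorm (tx v) = enorm (tx u - (tx u - alpha *: tx v)).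
      by rewrite opprB addrC subrK enormZ (gtr0_norm a0).
    exact: zs_lip.
  rewrite (le_trans (proj_ball_nonexpansive r_gt0 _ _))//.
  have -> : tz u - gamma *: tz v - zs =
     (w - gamma *: (hess22 g (tx u) (ty u) *m w)) + (- gamma *: dir_z_bias u)
     + - gamma *: (tz v - Dz).
    rewrite /dir_z_bias -/zs -/Dz -/w /w -/zs; move: (hess22 _ _ _ *m _) => q.
    by apply/colP => i; rewrite !mxE; ring.
  rewrite (le_trans (ler_enormD _ _))//; apply: lerD; last first.
    by rewrite enormZ normrN (gtr0_norm b0).
  rewrite (le_trans (ler_enormD _ _))// lerD2l enormZ normrN (gtr0_norm b0) ler_pM2l//.
  exact: dir_z_bias_bound.
- by apply: gradient_step_contract => //; rewrite dotC h22_coercive.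
Qed.

(** Descent inequality with the polarization
    [- 2 <G, v> = |v - G|^2 - |v|^2 - |G|^2]; half of the negative [|v|^2] pays for
    the quadratic remainder. *)
Lemma hyper_step (alpha beta gamma : R) u v : 0 < alpha -> alpha * LH <= 4^-1 ->
  hyperobjective f g (tx (spaba_update r alpha beta gamma u v))
    + alpha / 2 * enorm (hypergrad f g (tx u)) ^+ 2 + alpha / 4 * enorm (tx v) ^+ 2
  <= hyperobjective f g (tx u) + alpha / 2 *
     (Q * yerr u + L1 * zerr u + enorm (tx v - tx (exact_dir f g u))) ^+ 2.
Proof.
move=> a0 aL; rewrite /spaba_update/=; set gh := hypergrad f g (tx u).
have := hyper_descent Lf_gt0 Cf_gt0 L1_gt0 L2_gt0 mu_gt0 f_diff g_diff f_lip g_lip1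
  g_lip2 g_sc f_bound (tx u) (- alpha *: tx v).
rewrite dotZr enormZ normrN (gtr0_norm a0) -scaleNr -/gh exprMn => D.
have B : enorm (tx v - gh) ^+ 2 <=
   (Q * yerr u + L1 * zerr u + enorm (tx v - tx (exact_dir f g u))) ^+ 2.
  apply: ler_sqr_mono => //.
  have -> : tx v - gh = (tx (exact_dir f g u) - gh) + (tx v - tx (exact_dir f g u)).
    by apply/colP => i; rewrite !mxE; ring.
  by rewrite (le_trans (ler_enormD _ _))// lerD2r dir_x_bias.
rewrite enorm_sqB dotC in B.
have : LH * (alpha ^+ 2 * enorm (tx v) ^+ 2) <= alpha / 4 * enorm (tx v) ^+ 2.
  rewrite mulrA; apply: ler_wpM2r; first exact: sqr_ge0.
  by have := ler_wpM2l (ltW a0) aL; lra.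
have : alpha / 2 * (enorm (tx v) ^+ 2 - 2 * dot gh (tx v) + enorm gh ^+ 2) <=
  alpha / 2 * (Q * yerr u + L1 * zerr u + enorm (tx v - tx (exact_dir f g u))) ^+ 2.
  by rewrite ler_wpM2l//; lra.
by rewrite -/LH in D; lra.
Qed.

(** The weights are the smallest for which [potential_balance] applies, [z] being
    settled before [y] because the [y]-error enters the recursion of the [z]-error.
    The couplings are then taken so large that the displacement of each target
    costs at most [al / 16 * |v^x|^2] ([coupling_small]). *)
Definition z_weight := (3 * L1 ^+ 2 + 2) / mu.
Definition z_coupling := 1 + 144 * (z_weight * lam ^+ 2 / mu).
Definition y_weight := (3 * Q ^+ 2 + 18 * (z_weight / mu) * Q ^+ 2 + 2) / mu.
Definition y_coupling := 1 + 96 * (y_weight * kappa ^+ 2 / mu).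
Definition noise_gain := 3 / 2 + 6 * (y_weight / mu) + 9 * (z_weight / mu).
Definition potential u := hyperobjective f g (tx u)
  + y_weight / y_coupling * yerr u ^+ 2 + z_weight / z_coupling * zerr u ^+ 2.

Lemma z_weight_gt0 : 0 < z_weight.
Proof. by rewrite divr_gt0//; have := sqr_ge0 L1; lra. Qed.

Lemma y_weight_gt0 : 0 < y_weight.
Proof.
rewrite divr_gt0//; have := sqr_ge0 Q.
have : 0 <= z_weight / mu * Q ^+ 2.
  by apply: mulr_ge0; [exact/ltW/divr_gt0/mu_gt0/z_weight_gt0|exact: sqr_ge0].
by lra.
Qed.

Lemma z_coupling_ge1 : 1 <= z_coupling.
Proof.
rewrite lerDl mulr_ge0// divr_ge0 ?(ltW mu_gt0)// mulr_ge0 ?sqr_ge0//.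
exact/ltW/z_weight_gt0.
Qed.

Lemma y_coupling_ge1 : 1 <= y_coupling.
Proof.
rewrite lerDl mulr_ge0// divr_ge0 ?(ltW mu_gt0)// mulr_ge0 ?sqr_ge0//.
exact/ltW/y_weight_gt0.
Qed.

Lemma z_coupling_gt0 : 0 < z_coupling. Proof. exact: lt_le_trans z_coupling_ge1. Qed.
Lemma y_coupling_gt0 : 0 < y_coupling. Proof. exact: lt_le_trans y_coupling_ge1. Qed.

Lemma noise_gain_gt0 : 0 < noise_gain.
Proof.
have := divr_gt0 y_weight_gt0 mu_gt0; have := divr_gt0 z_weight_gt0 mu_gt0.
by rewrite /noise_gain; lra.
Qed.

Lemma potential_y_step (alpha gamma : R) u v : 0 < alpha ->
  y_coupling * alpha * L1 ^+ 2 <= mu -> y_coupling * alpha * mu <= 1 ->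
  y_weight / y_coupling * yerr (spaba_update r alpha (y_coupling * alpha) gamma u v) ^+ 2
  <= y_weight / y_coupling * yerr u ^+ 2 - alpha * (y_weight * mu / 2) * yerr u ^+ 2
    + alpha * (6 * (y_weight / mu)) * enorm (ty v - ty (exact_dir f g u)) ^+ 2
    + alpha / 16 * enorm (tx v) ^+ 2.
Proof.
move=> a0 bL bm.
have c0 := y_coupling_gt0; have s0 := y_weight_gt0; have m0 := mu_gt0.
have b0 : 0 < y_coupling * alpha by rewrite mulr_gt0.
have S := yerr_step gamma u v a0 b0 bL bm.
apply: (le_trans (ler_wpM2l (ltW (divr_gt0 s0 c0)) S)).
rewrite weighted_contraction//; move: (enorm (ty v - _)) (enorm (tx v)) => d x.
rewrite -!addrA !lerD2l.
pose t : R := y_weight * kappa ^+ 2 / mu / y_coupling ^+ 2.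
have K : t <= 96^-1.
  apply: coupling_small => //; rewrite divr_ge0 ?(ltW m0)// mulr_ge0 ?sqr_ge0//.
  exact: ltW.
pose w := 3 * (y_weight / mu / y_coupling ^+ 2).
have w0 : 0 <= w by rewrite mulr_ge0// divr_ge0 ?sqr_ge0// ltW// divr_gt0.
rewrite -/w (@le_trans _ _ (w * (2 * ((y_coupling * alpha * d) ^+ 2 + (kappa * (alpha * x)) ^+ 2) / alpha)))//.
  by rewrite ler_wpM2l// ler_pM2r ?invr_gt0// sqr_add2_le.
have -> : w * (2 * ((y_coupling * alpha * d) ^+ 2 + (kappa * (alpha * x)) ^+ 2) / alpha) =
  alpha * (6 * (y_weight / mu)) * d ^+ 2 +
  6 * t * (alpha * x ^+ 2).
  by rewrite /w /t; field; rewrite !gt_eqF.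
rewrite lerD2l.
have ax : 0 <= alpha * x ^+ 2 by rewrite mulr_ge0 ?sqr_ge0// ltW.
have -> : alpha / 16 * x ^+ 2 = 6 * 96^-1 * (alpha * x ^+ 2) by field.
by rewrite ler_wpM2r// ler_wpM2l.
Qed.

Lemma potential_z_step (alpha beta : R) u v : 0 < alpha ->
  z_coupling * alpha * L1 ^+ 2 <= mu -> z_coupling * alpha * mu <= 1 ->
  z_weight / z_coupling * zerr (spaba_update r alpha beta (z_coupling * alpha) u v) ^+ 2
  <= z_weight / z_coupling * zerr u ^+ 2 - alpha * (z_weight * mu / 2) * zerr u ^+ 2
    + alpha * (9 * (z_weight / mu)) * (Q ^+ 2 * yerr u ^+ 2)
    + alpha * (9 * (z_weight / mu)) * enorm (tz v - tz (exact_dir f g u)) ^+ 2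
    + alpha / 16 * enorm (tx v) ^+ 2.
Proof.
move=> a0 bL bm.
have c0 := z_coupling_gt0; have s0 := z_weight_gt0; have m0 := mu_gt0.
have b0 : 0 < z_coupling * alpha by rewrite mulr_gt0.
have S := zerr_step beta u v a0 b0 bL bm.
apply: (le_trans (ler_wpM2l (ltW (divr_gt0 s0 c0)) S)).
rewrite weighted_contraction//; move: (enorm (tz v - _)) (enorm (tx v)) (yerr u) => d x y.
rewrite -!addrA !lerD2l.
pose t : R := z_weight * lam ^+ 2 / mu / z_coupling ^+ 2.
have K : t <= 144^-1.
  apply: coupling_small => //; rewrite divr_ge0 ?(ltW m0)// mulr_ge0 ?sqr_ge0//.
  exact: ltW.
pose w := 3 * (z_weight / mu / z_coupling ^+ 2).
have w0 : 0 <= w by rewrite mulr_ge0// divr_ge0 ?sqr_ge0// ltW// divr_gt0.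
rewrite -/w addrA (@le_trans _ _ (w * (3 * ((z_coupling * alpha * (Q * y)) ^+ 2 +
   (z_coupling * alpha * d) ^+ 2 + (lam * (alpha * x)) ^+ 2) / alpha)))//.
  by rewrite ler_wpM2l// ler_pM2r ?invr_gt0// sqr_add3_le.
have -> : w * (3 * ((z_coupling * alpha * (Q * y)) ^+ 2 +
   (z_coupling * alpha * d) ^+ 2 + (lam * (alpha * x)) ^+ 2) / alpha) =
  alpha * (9 * (z_weight / mu)) * (Q ^+ 2 * y ^+ 2) +
  (alpha * (9 * (z_weight / mu)) * d ^+ 2 +
  9 * t * (alpha * x ^+ 2)).
  by rewrite /w /t; field; rewrite !gt_eqF.
rewrite !lerD2l.
have ax : 0 <= alpha * x ^+ 2 by rewrite mulr_ge0 ?sqr_ge0// ltW.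
have -> : alpha / 16 * x ^+ 2 = 9 * 144^-1 * (alpha * x ^+ 2) by field.
by rewrite ler_wpM2r// ler_wpM2l.
Qed.

Lemma potential_step (alpha : R) u v : 0 < alpha -> alpha * LH <= 4^-1 ->
  y_coupling * alpha * L1 ^+ 2 <= mu -> y_coupling * alpha * mu <= 1 ->
  z_coupling * alpha * L1 ^+ 2 <= mu -> z_coupling * alpha * mu <= 1 ->
  potential (spaba_update r alpha (y_coupling * alpha) (z_coupling * alpha) u v)
  + alpha / 2 * enorm (hypergrad f g (tx u)) ^+ 2
  + alpha * (8^-1 * enorm (tx v) ^+ 2 + yerr u ^+ 2 + zerr u ^+ 2)
  <= potential u + alpha * noise_gain * sqdist v (exact_dir f g u).
Proof.
move=> a0 aL yL ym zL zm; rewrite /potential.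
have Ey : y_weight * mu / 2 = 3 / 2 * Q ^+ 2 + 9 * (z_weight / mu) * Q ^+ 2 + 1.
  by rewrite /y_weight; move: (z_weight / mu) => t; field; rewrite gt_eqF.
have Ez : z_weight * mu / 2 = 3 / 2 * L1 ^+ 2 + 1.
  by rewrite /z_weight; field; rewrite gt_eqF.
have Hz := potential_z_step (y_coupling * alpha) u v a0 zL zm; rewrite Ez in Hz.
have Hy := potential_y_step (z_coupling * alpha) u v a0 yL ym; rewrite Ey in Hy.
have Hh := hyper_step (y_coupling * alpha) (z_coupling * alpha) u v a0 aL.
apply: (potential_balance (p := y_weight / mu) (q := z_weight / mu) (Qs := Q ^+ 2)
  (Ls := L1 ^+ 2) a0 _ _ _ _ _ _ Hy Hz); rewrite ?sqr_ge0//.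
- exact/ltW/divr_gt0/mu_gt0/y_weight_gt0.
- exact/ltW/divr_gt0/mu_gt0/z_weight_gt0.
apply: (le_trans Hh); rewrite lerD2l -!exprMn; apply: ler_wpM2l; last exact: sqr_add3_le.
exact/ltW/divr_gt0.
Qed.

Definition drift_gain := 1 + 2 * y_coupling ^+ 2 * (L1 ^+ 2 + 1)
  + 6 * z_coupling ^+ 2 * (L1 ^+ 2 + Q ^+ 2 + 1).

Lemma drift_gain_gt0 : 0 < drift_gain.
Proof.
apply: (lt_le_trans ltr01); rewrite /drift_gain -addrA lerDl.
by apply: addr_ge0; apply: mulr_ge0;
  [apply: mulr_ge0 => //; exact: sqr_ge0|do ?apply: addr_ge0 => //; exact: sqr_ge0
  |apply: mulr_ge0 => //; exact: sqr_ge0|do ?apply: addr_ge0 => //; exact: sqr_ge0].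
Qed.

(** The movement of one update in terms of the quantities that
    [potential_step] makes decrease. The last term is the jump of [z] into the ball;
    it vanishes when [z] is already the result of a projection. *)
Lemma drift_step (alpha : R) u v : 0 < alpha ->
  sqdist (spaba_update r alpha (y_coupling * alpha) (z_coupling * alpha) u v) u
  <= alpha ^+ 2 * drift_gain *
     (enorm (tx v) ^+ 2 + yerr u ^+ 2 + zerr u ^+ 2 + sqdist v (exact_dir f g u))
   + 2 * enorm (tz u - proj_ball r (tz u)) ^+ 2.
Proof.
move=> a0; rewrite {1}/sqdist /spaba_update/=.
have c0 := y_coupling_gt0; have c'0 := z_coupling_gt0.
have E n (w d : 'cV[R]_n) (c : R) : enorm (w - c *: d - w) ^+ 2 = c ^+ 2 * enorm d ^+ 2.
  have -> : w - c *: d - w = - c *: d by apply/colP => i; rewrite !mxE; ring.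
  by rewrite enormZ exprMn normrN real_normK ?num_real.
rewrite !E; set D := exact_dir f g u.
have Vy : enorm (ty v) ^+ 2 <= 2 * (L1 ^+ 2 * yerr u ^+ 2 + enorm (ty v - ty D) ^+ 2).
  rewrite -exprMn; apply: le_trans (sqr_add2_le _ _); apply: ler_sqr_mono => //.
  have {1}-> : ty v = ty D + (ty v - ty D) by rewrite addrC subrK.
  by rewrite (le_trans (ler_enormD _ _))// lerD2r dir_y_bound.
have Vz : enorm (tz v) ^+ 2 <=
   3 * (L1 ^+ 2 * zerr u ^+ 2 + Q ^+ 2 * yerr u ^+ 2 + enorm (tz v - tz D) ^+ 2).
  rewrite -!exprMn; apply: le_trans (sqr_add3_le _ _ _); apply: ler_sqr_mono => //.
  have {1}-> : tz v = tz D + (tz v - tz D) by rewrite addrC subrK.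
  by rewrite (le_trans (ler_enormD _ _))// lerD2r dir_z_bound.
have Z : enorm (proj_ball r (tz u - z_coupling * alpha *: tz v) - tz u) ^+ 2 <=
  2 * ((z_coupling * alpha) ^+ 2 * enorm (tz v) ^+ 2)
   + 2 * enorm (tz u - proj_ball r (tz u)) ^+ 2.
  have -> : proj_ball r (tz u - z_coupling * alpha *: tz v) - tz u =
     (proj_ball r (tz u - z_coupling * alpha *: tz v) - proj_ball r (tz u))
     + (proj_ball r (tz u) - tz u) by rewrite addrA subrK.
  apply: (le_trans (ler_enorm_sqD _ _)); rewrite (enormB (proj_ball r (tz u))).
  rewrite lerD2r ler_pM2l// -(E _ (tz u)); apply: ler_sqr_mono => //.
  exact: proj_ball_nonexpansive.
apply: (le_trans (lerD (lexx _) Z)); rewrite addrA lerD2r /sqdist !exprMn.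
by apply: drift_balance => //; exact: sqr_ge0.
Qed.

End Step.

(** * Joint measurability *)

Section Coordinates.
Context {R : realType}.

Definition mcoords n d (T : measurableType d) (w : T -> 'cV[R]_n) :=
  forall i, measurable_fun setT (fun t => w t i 0).

(** Measurability of [h (w t) (s t)] for every pair of measurable maps [w] and
    [s]: this avoids a sigma-algebra on the space of vectors. *)
Definition jointly_measurable n d' (S : measurableType d') (h : 'cV[R]_n -> S -> R) :=
  forall d (T : measurableType d) (w : T -> 'cV[R]_n) (s : T -> S),
    mcoords w -> measurable_fun setT s -> measurable_fun setT (fun t => h (w t) (s t)).

(** Pointwise convergence with a rate, the form in which gradients and
    Hessians are limits of difference quotients. *)
Lemma measurable_fun_rate d (T : measurableType d) (h : nat -> T -> R) (f : T -> R)
    (C : T -> R) : (forall n, measurable_fun setT (h n)) ->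
  (forall n t, `|h n t - f t| <= C t / n.+1%:R) -> measurable_fun setT f.
Proof.
move=> mh hf; apply: (measurable_fun_cvg mh) => t _.
apply/cvgrPdist_le => e e0.
have C0 : 0 <= C t.
  by have := hf 0%N t; rewrite invr1 mulr1; exact: le_trans.
near=> n; rewrite distrC (le_trans (hf n t))// ler_pdivrMr ?ltr0n//.
rewrite mulrC -ler_pdivrMr//.
near: n; have [m _ Hm] := nbhs_infty_ger (C t / e); exists m => // k /= mk.
by rewrite (le_trans (Hm k mk))// ler_nat.
Unshelve. all: by end_near. Qed.

Lemma measurable_fun_scale d (T : measurableType d) (k : R) (f : T -> R) :
  measurable_fun setT f -> measurable_fun setT (fun t => k * f t).
Proof. by move=> mf; apply: measurable_funM. Qed.

Lemma measurable_fun_big d (T : measurableType d) (I : finType) (f : I -> T -> R) :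
  (forall i, measurable_fun setT (f i)) -> measurable_fun setT (fun t => \sum_i f i t).
Proof.
by move=> mf; apply: measurable_sum.
Qed.

Section Grid.
Variables (n : nat) (k : nat).

Definition grid_index (w : 'cV[R]_n) : 'cV[int]_n := \col_i Num.floor (k.+1%:R * w i 0).
Definition grid_point (c : 'cV[int]_n) : 'cV[R]_n := \col_i ((c i 0)%:~R / k.+1%:R).

Lemma grid_point_near w i : `|(grid_point (grid_index w) - w) i 0| <= k.+1%:R^-1.
Proof.
rewrite !mxE; set a := k.+1%:R * w i 0.
have k0 : 0 < k.+1%:R :> R by rewrite ltr0n.
have -> : (Num.floor a)%:~R / k.+1%:R - w i 0 = ((Num.floor a)%:~R - a) / k.+1%:R.
  by rewrite mulrBl /a [_ * w i 0]mulrC mulfK ?gt_eqF.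
rewrite normrM [X in _ * X]ger0_norm ?invr_ge0// ler_piMl ?invr_ge0//.
have /andP[h1 h2] := floor_itv a.
rewrite distrC ger0_norm ?subr_ge0//.
by rewrite intrD in h2; lra.
Qed.

End Grid.

Lemma measurable_grid_index n k d (T : measurableType d) (w : T -> 'cV[R]_n) c :
  mcoords w -> measurable [set t | grid_index k (w t) = c].
Proof.
move=> mw.
have -> : [set t | grid_index k (w t) = c] =
   \bigcap_i [set t | Num.floor (k.+1%:R * w t i 0) = c i 0].
  apply/seteqP; split => [t /= <- i _|t H]; first by rewrite /= mxE.
  by apply/colP => i; rewrite mxE; exact: H.
apply: fin_bigcap_measurable => [|i _]; first exact: finite_finset.
have -> : [set t | Num.floor (k.+1%:R * w t i 0) = c i 0] =
  (fun t => k.+1%:R * w t i 0) @^-1` `[(c i 0)%:~R, (c i 0 + 1)%:~R[%classic.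
  apply/seteqP; split => t /=; rewrite in_itv/=.
    by move=> <-; exact: floor_itv.
  exact: floor_def.
rewrite -[X in measurable X]setTI; apply: measurable_fun_scale => //; exact: mw.
Qed.

(** A function continuous in the vector and measurable in the parameter is the
    limit of its values at grid points, where only countably many vectors occur. *)
Lemma caratheodory_measurable n d' (S : measurableType d') (h : 'cV[R]_n -> S -> R) :
  (forall w, measurable_fun setT (h w)) -> (forall s, econtinuous (h^~ s)) ->
  jointly_measurable h.
Proof.
move=> mh ch d T w s mw ms.
(* For fixed [k] the vector argument takes countably many values. *)
pose hk k t := h (grid_point k (grid_index k (w t))) (s t).
apply: (@measurable_fun_cvg _ _ _ _ hk) => [k|t _].
- move=> _ B mB; rewrite setTI.
  have -> : hk k @^-1` B = \bigcup_(c : 'cV[int]_n)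
      ([set t | grid_index k (w t) = c] `&` (fun t => h (grid_point k c) (s t)) @^-1` B).
    apply/seteqP; split => [t /= Bt|t [c _ [/= <-]]//].
    by exists (grid_index k (w t)).
  apply: countable_bigcupT_measurable => [|c].
    by exact/countableP.
  apply: measurableI; first exact: measurable_grid_index.
  rewrite -[X in measurable X]setTI.
  by apply: (measurableT_comp (mh (grid_point k c)) ms).
- apply/cvgrPdist_lt => e e0; have [r r0 Hr] := ch (s t) (w t) e e0.
  near=> k; rewrite distrC /hk.
  have -> : grid_point k (grid_index k (w t)) =
     w t + (grid_point k (grid_index k (w t)) - w t) by rewrite addrC subrK.
  apply: Hr => i; rewrite (le_lt_trans (grid_point_near _ _ _))//.
  by near: k; exact: near_infty_natSinv_lt (PosNum r0).
Unshelve. all: by end_near. Qed.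

Lemma econtinuous_measurable n (h : 'cV[R]_n -> R) d (T : measurableType d)
    (w : T -> 'cV[R]_n) : econtinuous h -> mcoords w ->
  measurable_fun setT (fun t => h (w t)).
Proof.
move=> ch mw.
by apply: (@caratheodory_measurable n _ unit (fun w _ => h w)
  (fun w => measurable_cst _) (fun _ => ch) _ T w (fun _ => tt)).
Qed.

Lemma mcoords_translate n d (T : measurableType d) (w : T -> 'cV[R]_n) v :
  mcoords w -> mcoords (fun t => w t + v).
Proof.
move=> mw i; rewrite (_ : (fun t => _) = (fun t => w t i 0 + v i 0)); last first.
  by apply/funext => t; rewrite mxE.
by apply: measurable_funD => //; exact: mw.
Qed.

End Coordinates.

Section GradientMeasurability.
Context {R : realType} {n : nat} {d' : measure_display} {S : measurableType d'}.
Variables (G : 'cV[R]_n -> S -> R).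

Definition diff_quotient (h : 'cV[R]_n -> R) (v w : 'cV[R]_n) (k : nat) : R :=
  k.+1%:R * (h (w + k.+1%:R^-1 *: v) - h w).

Lemma diff_quotient_rate (h : 'cV[R]_n -> R) v w (a C : R) k :
  (forall t : R, `|h (w + t *: v) - h w - t * a| <= C * t ^+ 2) ->
  `|diff_quotient h v w k - a| <= C / k.+1%:R.
Proof.
move=> /(_ k.+1%:R^-1); have k0 : 0 < k.+1%:R :> R by rewrite ltr0n.
rewrite /diff_quotient; move: (h _ - h w) => X.
have -> : k.+1%:R * X - a = k.+1%:R * (X - k.+1%:R^-1 * a).
  by field; rewrite gt_eqF.
rewrite normrM (gtr0_norm k0) => /(ler_wpM2l (ltW k0)) /le_trans; apply.
by rewrite le_eqVlt; apply/orP; left; apply/eqP; field; rewrite gt_eqF.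
Qed.

Lemma grad_quotient_rate (h : 'cV[R]_n -> R) (L : R) w i k : 0 <= L ->
  everywhere_differentiable h -> lipschitz_grad L h ->
  `|diff_quotient h (delta_mx i 0) w k - grad h w i 0| <= L / k.+1%:R.
Proof.
move=> L0 dh Lh; apply: diff_quotient_rate => t.
have := taylor1 w (t *: delta_mx i 0) L0 dh Lh.
by rewrite dotZr dot_delta enormZ enorm_delta mulr1 real_normK ?num_real.
Qed.

Lemma hess_quotient_rate (h : 'cV[R]_n -> R) (L : R) w i j k : 0 <= L ->
  twice_differentiable h -> lipschitz_hess L h ->
  `|diff_quotient (fun u => grad h u i 0) (delta_mx j 0) w k - hess h w i j| <= L / k.+1%:R.
Proof.
move=> L0 dh Lh; apply: diff_quotient_rate => t.
have := taylor2 w (t *: delta_mx j 0) L0 dh Lh.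
rewrite enormZ enorm_delta mulr1 real_normK ?num_real//; apply: le_trans.
apply: le_trans (ler_enorm_coord _ i).
rewrite -scalemxAr -(mulmx_delta (hess h w)).
by move: (grad h (w + _)) (grad h w) (hess h w *m _) => p q r; rewrite !mxE.
Qed.

Lemma jointly_measurable_grad (L : R) i : 0 <= L -> jointly_measurable G ->
  (forall s, everywhere_differentiable (G^~ s)) ->
  (forall s, lipschitz_grad L (G^~ s)) ->
  jointly_measurable (fun w s => grad (G^~ s) w i 0).
Proof.
move=> L0 mG dG LG d T w s mw ms.
apply: (@measurable_fun_rate _ _ _ (fun k t => diff_quotient (G^~ (s t)) (delta_mx i 0) (w t) k)
  _ (fun=> L)) => [k|k t]; last exact: grad_quotient_rate.
apply: measurable_fun_scale; apply: measurable_funB; last exact: mG.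
by apply: mG => //; exact: mcoords_translate.
Qed.

Lemma jointly_measurable_hess (L1 L2 : R) i j : 0 <= L1 -> 0 <= L2 -> jointly_measurable G ->
  (forall s, twice_differentiable (G^~ s)) ->
  (forall s, lipschitz_grad L1 (G^~ s)) -> (forall s, lipschitz_hess L2 (G^~ s)) ->
  jointly_measurable (fun w s => hess (G^~ s) w i j).
Proof.
move=> L10 L20 mG dG LG1 LG2 d T w s mw ms.
have mg := jointly_measurable_grad i L10 mG (fun s => (dG s).1) LG1.
apply: (@measurable_fun_rate _ _ _
  (fun k t => diff_quotient (fun u => grad (G^~ (s t)) u i 0) (delta_mx j 0) (w t) k)
  _ (fun=> L2)) => [k|k t]; last exact: hess_quotient_rate.
apply: measurable_fun_scale; apply: measurable_funB; last exact: mg.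
by apply: mg => //; exact: mcoords_translate.
Qed.

End GradientMeasurability.

(** * Integrating out one independent draw *)

Section Monotone.
Local Open Scope ereal_scope.
Context {R : realType} {d : measure_display} {T : measurableType d}.
Variable (mu : {measure set T -> \bar R}).
Import HBNNSimple.

(** Both integrals are suprema over the simple functions below the integrand,
    and the first supremum is over fewer functions. *)
Lemma le_ge0_integral (f1 f2 : T -> \bar R) : (forall x, 0 <= f1 x) ->
  (forall x, f1 x <= f2 x) -> \int[mu]_x f1 x <= \int[mu]_x f2 x.
Proof.
move=> f10 f12; have f20 x : 0 <= f2 x by apply: le_trans (f12 x).
rewrite !ge0_integralTE//; apply: le_ereal_sup => _ [h /= hf <-].
by exists h => // x; exact: le_trans (f12 x).
Qed.

End Monotone.

(** The set [Om] with the sigma-algebra generated by [Gen]: measurability of a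
    map out of this type expresses that it depends on the information in [Gen]. *)
Definition sub_space {d : measure_display} {Om : measurableType d}
    (Gen : set (set Om)) : measurableType Gen.-sigma := g_sigma_algebraType Gen.

Section Freezing.
Local Open Scope ereal_scope.
Context {R : realType} {d d' : measure_display}.
Context {Om : measurableType d} {S : measurableType d'}.
Variables (P : probability Om R) (Q : probability S R) (Y : Om -> S).
Variable Gen : set (set Om).
Hypothesis Gen_measurable : Gen `<=` measurable.
Hypothesis mY : measurable_fun setT Y.
Hypothesis indepY : forall A B, <<s Gen >> A -> measurable B ->
  P (A `&` Y @^-1` B) = P A * Q B.

Local Notation OmG := (sub_space Gen).

Lemma sub_sigma_measurable A : <<s Gen >> A -> measurable A.
Proof. by apply: smallest_sub => //; exact: sigma_algebra_measurable. Qed.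

Let idG : Om -> OmG := fun om => om.
Let m_idG : measurable_fun setT idG.
Proof. by move=> _ B mB; rewrite setTI; exact: sub_sigma_measurable. Qed.

Lemma measurable_fun_sub d2 (T : measurableType d2) (h : Om -> T) :
  measurable_fun setT (h : OmG -> T) -> measurable_fun setT h.
Proof. by move=> mh; apply: (measurableT_comp mh m_idG). Qed.

Let idG_mfun : {mfun Om >-> OmG} := HB.pack idG (isMeasurableFun.Build _ _ _ _ idG m_idG).
Let PG : probability OmG R := distribution P idG_mfun.
Let J : Om -> OmG * S := fun om => (om, Y om).
Let mJ : measurable_fun setT J.
Proof. by apply: measurable_fun_pair. Qed.
Let J_mfun : {mfun Om >-> (OmG * S)%type} := HB.pack J (isMeasurableFun.Build _ _ _ _ J mJ).

Let law_J X : measurable X -> (PG \x Q) X = distribution P J_mfun X.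
Proof.
apply: product_measure_unique => A B mA mB.
by rewrite /distribution /pushforward /= -[RHS]indepY.
Qed.

(** When [Y] is independent of a sub-sigma-algebra, a function of [Y] and of
    data measurable for that sub-sigma-algebra is integrated by averaging over
    [Y] with the data frozen. The sub-sigma-algebra is carried by an alias of
    the sample space, so that its product with [S] is available. *)
Lemma integral_freeze (Phi : OmG * S -> \bar R) : (forall z, 0 <= Phi z) ->
  measurable_fun setT Phi ->
  \int[P]_om Phi (om, Y om) = \int[P]_om \int[Q]_s Phi (om, s).
Proof.
move=> Phi0 mPhi.
transitivity (\int[distribution P J_mfun]_z Phi z).
  by rewrite ge0_integral_pushforward.
transitivity (\int[PG \x Q]_z Phi z).
  by apply: eq_measure_integral => A mA _; exact/esym/law_J.
rewrite (fubini_tonelli1 Phi)// ge0_integral_pushforward//.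
- exact: measurable_fun_fubini_tonelli_F.
- by move=> x _; apply: integral_ge0.
Qed.

End Freezing.

Section Peel.
Context {R : realType} {d d' : measure_display}.
Context {Om : measurableType d} {S : measurableType d'}.
Variables (P : probability Om R) (Q : probability S R) (Y : Om -> S).
Variable Gen : set (set Om).
Hypothesis Gen_measurable : Gen `<=` measurable.
Hypothesis mY : measurable_fun setT Y.
Hypothesis indepY : forall A B, <<s Gen >> A -> measurable B ->
  P (A `&` Y @^-1` B) = (P A * Q B)%E.
Local Notation OmG := (sub_space Gen).

Definition has_mean (X : S -> R) (m : R) :=
  Q.-integrable setT (EFin \o X) /\ (\int[Q]_s (X s)%:E = m%:E)%E.

Lemma second_moment_shift (X : S -> R) (a B : R) :
  has_mean X 0 -> (\int[Q]_s (X s ^+ 2)%:E <= B%:E)%E ->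
  (\int[Q]_s ((a + X s) ^+ 2)%:E <= (a ^+ 2 + B)%:E)%E.
Proof.
move=> [iX mX] XB.
have mXf : measurable_fun setT X by apply/measurable_EFinP; exact: measurable_int iX.
have X2 : Q.-integrable setT (fun s => (X s ^+ 2)%:E).
  apply/integrableP; split; first by apply/measurable_EFinP; exact: measurable_funX.
  under eq_integral do rewrite gee0_abs ?lee_fin ?sqr_ge0//.
  exact: le_lt_trans XB (ltry _).
have E s : ((a + X s) ^+ 2)%:E = ((a ^+ 2)%:E + ((2 * a)%:E * (X s)%:E + (X s ^+ 2)%:E))%E.
  by rewrite -EFinM -!EFinD; congr EFin; ring.
under eq_integral do rewrite E.
have i1 : Q.-integrable setT (fun s => ((2 * a)%:E * (X s)%:E)%E).
  exact: integrableZl.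
rewrite integralD//=; last 2 first.
- exact: finite_measure_integrable_cst.
- exact: integrableD.
rewrite integralD// integralZl// mX mule0 add0e integral_cst//.
rewrite [X in (_ * X + _)%E](_ : _ = 1%E) ?mule1; last exact: probability_setT.
by rewrite EFinD leeD2l.
Qed.

(** The cross term vanishes once [Y] is integrated out with the data frozen. *)
Lemma second_moment_peel (A : Om -> R) (X : Om -> S -> R) (B : Om -> R) :
  measurable_fun setT (A : OmG -> R) ->
  measurable_fun setT (fun z : OmG * S => X z.1 z.2) ->
  (forall om, has_mean (X om) 0) ->
  (forall om, \int[Q]_s (X om s ^+ 2)%:E <= (B om)%:E)%E ->
  (\int[P]_om ((A om + X om (Y om)) ^+ 2)%:E <= \int[P]_om (A om ^+ 2 + B om)%:E)%E.
Proof.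
move=> mA mX X0 XB.
rewrite (@integral_freeze _ _ _ _ _ P Q Y Gen _ _ _
  (fun z => ((A z.1 + X z.1 z.2) ^+ 2)%:E))//=; first last.
- apply/measurable_EFinP/measurable_funX/measurable_funD => //.
  by apply: (measurableT_comp mA); exact: measurable_fst.
- by move=> z; rewrite lee_fin sqr_ge0.
apply: le_ge0_integral => om; first by apply: integral_ge0 => s _; rewrite lee_fin sqr_ge0.
exact: second_moment_shift.
Qed.

End Peel.

Section MutualIndependence.
Local Open Scope ereal_scope.
Context {R : realType} {d : measure_display} {Om : measurableType d}.
Variables (P : probability Om R) (I : Type) (E : I -> set (set Om)).
Variables (N : nat) (e : 'I_N -> I).
Hypothesis e_bij : bijective e.
Hypothesis E_measurable : forall i, E i `<=` measurable.
Hypothesis E_T : forall i, E i setT.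
Hypothesis E_I : forall i A B, E i A -> E i B -> E i (A `&` B).
Hypothesis E_indep : mutually_independent P E.

(** Events of the other members of the family; they generate the
    sigma-algebra that is frozen while the member [i0] is integrated out. *)
Definition others (i0 : I) : set (set Om) := [set A | exists2 i, i <> i0 & E i A].

Let box (i0 : I) : set (set Om) := [set A | exists B : I -> set Om,
  [/\ forall i, E i (B i), B i0 = setT & A = \bigcap_j B (e j)]].

Let box_setI i0 : setI_closed (box i0).
Proof.
move=> _ _ [B [EB Bi ->]] [C [EC Ci ->]].
exists (fun i => B i `&` C i); split => [i||]; first exact: E_I.
  by rewrite Bi Ci setIT.
by rewrite bigcapI.
Qed.

Lemma others_measurable i0 : others i0 `<=` measurable.
Proof. by move=> A [i _ /E_measurable]. Qed.

Let box_measurable i0 : box i0 `<=` measurable.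
Proof.
move=> _ [B [EB _ ->]]; apply: fin_bigcap_measurable => [|i _].
  exact: finite_finset.
exact: E_measurable (EB _).
Qed.

Let others_box i0 : others i0 `<=` box i0.
Proof.
move=> A [i ii0 EA]; exists (fun j => if pselect (j = i) then A else setT); split.
- by move=> j; case: pselect => [ji|nji] /=; [rewrite ji|exact: E_T].
- by case: pselect => // ii; case: ii0.
- apply/seteqP; split => [x Ax j _|x /= xA]; first by case: pselect.
  case: e_bij => e' _ e'K; have := xA (e' i) Logic.I; rewrite e'K.
  by case: pselect.
Qed.

Let box_indep i0 A C : box i0 A -> E i0 C -> P (A `&` C) = P A * P C.
Proof.
move=> [B [EB Bi ->]] EC; case: (e_bij) => e' eK e'K.
pose B' i := if pselect (i = i0) then C else B i.
have EB' i : E i (B' i) by rewrite /B'; case: pselect => [ii|nii] /=; [rewrite ii|exact: EB].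
have ninj : injective e by apply: can_inj eK.
have -> : \bigcap_j B (e j) `&` C = \bigcap_j B' (e j).
  apply/seteqP; split => [x [/= xB xC] j _|x /= xB'].
    by rewrite /B'; case: pselect => [//|nji] /=; exact: xB.
  split=> [j _|].
    by have := xB' j Logic.I; rewrite /B'; case: pselect => //= ->; rewrite Bi.
  by have := xB' (e' i0) Logic.I; rewrite /B' e'K; case: pselect.
rewrite (@E_indep N e (fun j => B' (e j)))// (@E_indep N e (fun j => B (e j)))//.
rewrite (bigD1 (e' i0))//= [in RHS](bigD1 (e' i0))//= /B' e'K Bi probability_setT mul1e.
case: pselect => //= ii; rewrite muleC; congr (_ * _).
apply: eq_bigr => j ji; case: pselect => //= eji.
by move: ji; rewrite -eji eK eqxx.
Qed.

(** The box events form a pi-system generating the sigma-algebra of the other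
    draws, and the product rule is given on boxes. *)
Lemma others_indep i0 A C : <<s others i0 >> A -> E i0 C ->
  P (A `&` C) = P A * P C.
Proof.
move=> sA EC; have mC : measurable C := E_measurable EC.
have pC0 : (0 <= fine (P C))%R by apply: fine_ge0.
(* Two finite measures that agree on the pi-system of boxes. *)
have sbox : <<s box i0 >> A.
  apply: smallest_sub sA; first exact: smallest_sigma_algebra.
  by apply: subset_trans (@sub_sigma_algebra _ setT (box i0)); exact: others_box.
have PC : (fine (P C))%:E = P C by rewrite fineK ?fin_num_measure.
have H : mrestr P mC A = mscale (NngNum pC0) P A.
  apply: (@g_sigma_algebra_measure_unique d R Om (box i0) (@box_measurable i0)
    (fun=> setT)) => //.
  - by move=> _; exists (fun=> setT); split => //; apply/seteqP; split.
  - by rewrite bigcup_const//; exists 0%N.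
  - by move=> B bB; rewrite /mrestr /mscale /= [RHS]muleC PC; exact: box_indep bB EC.
  - move=> _; rewrite /mrestr/=; apply: (le_lt_trans (probability_le1 P _)) (ltry _).
    exact: measurableI.
by rewrite muleC -PC; exact: H.
Qed.

End MutualIndependence.

Section DrawIndex.
Variables (K b tau : nat).
Local Notation code := (unit + 'I_K + ('I_K * 'I_tau) + ('I_K * 'I_tau)
  + ('I_K * 'I_b) + ('I_K * 'I_b))%type.

Let decode (c : code) : draw_index K b tau :=
  match c with
  | inl (inl (inl (inl (inl _)))) => InitDir _ _ _
  | inl (inl (inl (inl (inr k)))) => Coin _ _ k
  | inl (inl (inl (inr (k, i)))) => LargeXi _ k i
  | inl (inl (inr (k, i))) => LargeZeta _ k i
  | inl (inr (k, i)) => SmallXi _ k i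
  | inr (k, i) => SmallZeta _ k i
  end.

Let encode (i : draw_index K b tau) : code :=
  match i with
  | InitDir => inl (inl (inl (inl (inl tt))))
  | Coin k => inl (inl (inl (inl (inr k))))
  | LargeXi k i => inl (inl (inl (inr (k, i))))
  | LargeZeta k i => inl (inl (inr (k, i)))
  | SmallXi k i => inl (inr (k, i))
  | SmallZeta k i => inr (k, i)
  end.

(** The product rule is given for finite subfamilies; since the whole family of
    draws is finite, it applies to all of them at once. *)
Lemma draw_index_finite :
  exists (N : nat) (e : 'I_N -> draw_index K b tau), bijective e.
Proof.
exists #|{: code}|, (fun j => decode (enum_val j)).
exists (fun i => enum_rank (encode i)) => [j|i].
  have dK : cancel decode encode by case=> [[[[[[]|k]|[k i]]|[k i]]|[k i]]|[k i]].
  by rewrite dK enum_valK.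
by rewrite enum_rankK; case: i.
Qed.

End DrawIndex.

Section DrawSigma.
Context {R : realType} {dx dy : nat} {dXi dZeta d : measure_display}.
Context {Xi : measurableType dXi} {Zeta : measurableType dZeta} {Om : measurableType d}.
Variables (QXi : probability Xi R) (QZeta : probability Zeta R) (P : probability Om R).
Variables (K b tau : nat) (p : R) (D : spaba_draws R dx dy Xi Zeta b tau Om).
Hypothesis sampling : spaba_sampling QXi QZeta P K p D.

Local Notation E := (@sigma_of_draw R dx dy dXi dZeta d Xi Zeta Om K b tau D).

Lemma sigma_of_T d' (S : measurableType d') (X : Om -> S) : sigma_of X setT.
Proof. by exists setT => //; rewrite preimage_setT setIT. Qed.

Lemma sigma_of_I d' (S : measurableType d') (X : Om -> S) A B :
  sigma_of X A -> sigma_of X B -> sigma_of X (A `&` B).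
Proof.
move=> [A' mA <-] [B' mB <-]; exists (A' `&` B'); first exact: measurableI.
by rewrite !setTI preimage_setI.
Qed.

Lemma sigma_of_measurable d' (S : measurableType d') (X : Om -> S) :
  measurable_fun setT X -> sigma_of X `<=` measurable.
Proof. by move=> mX _ [B mB <-]; exact: mX. Qed.

Lemma sigma_of_draw_T i : E i setT.
Proof.
case: i => [|k|k i|k i|k i|k i] /=; try exact: sigma_of_T.
exact: (@measurableT _ (g_sigma_algebraType _)).
Qed.

Lemma sigma_of_draw_I i A B : E i A -> E i B -> E i (A `&` B).
Proof.
case: i => [|k|k i|k i|k i|k i] /=; try exact: sigma_of_I.
exact: (@measurableI _ (g_sigma_algebraType _)).
Qed.

Lemma sigma_of_draw_measurable i : E i `<=` measurable.
Proof.
case: sampling => mI mC mL mS _; case: i => [|k|k i|k i|k i|k i] /=.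
- apply: smallest_sub; first exact: sigma_algebra_measurable.
  by move=> A [c _]; apply: sigma_of_measurable (mI c) _.
- by apply: sigma_of_measurable; case: (mC k (ltn_ord k)).
- by apply: sigma_of_measurable; case: (mL k (ltn_ord k)) => /(_ i)[].
- by apply: sigma_of_measurable; case: (mL k (ltn_ord k)) => _ /(_ i)[].
- by apply: sigma_of_measurable; case: (mS k (ltn_ord k)) => /(_ i)[].
- by apply: sigma_of_measurable; case: (mS k (ltn_ord k)) => _ /(_ i)[].
Qed.

Lemma other_draws_indep i0 A C : <<s others E i0 >> A -> E i0 C ->
  P (A `&` C) = (P A * P C)%E.
Proof.
have [N [e ebij]] := draw_index_finite K b tau.
apply: (others_indep ebij); [exact: sigma_of_draw_measurable|exact: sigma_of_draw_T|
  exact: sigma_of_draw_I|by case: sampling].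
Qed.

Lemma other_draws_measurable i0 : others E i0 `<=` measurable.
Proof. exact/others_measurable/sigma_of_draw_measurable. Qed.

End DrawSigma.

(** * The coordinates of the sampled directions *)

Section Means.
Context {R : realType} {d' : measure_display} {S : measurableType d'}.
Variable Q : probability S R.
Implicit Types X Y : S -> R.

Lemma has_mean_measurable X m : has_mean Q X m -> measurable_fun setT X.
Proof. by move=> [iX _]; apply/measurable_EFinP; exact: measurable_int iX. Qed.

Lemma integral_cst_prob (a : R) : (\int[Q]_s a%:E = a%:E)%E.
Proof.
by rewrite integral_cst// [X in (_ * X)%E](_ : _ = 1%E) ?mule1; last exact: probability_setT.
Qed.

Lemma has_mean_cst (a : R) : has_mean Q (fun=> a) a.
Proof.
split; last exact: integral_cst_prob.
exact: finite_measure_integrable_cst.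
Qed.

Lemma has_meanD X Y a b : has_mean Q X a -> has_mean Q Y b ->
  has_mean Q (fun s => X s + Y s) (a + b).
Proof.
move=> [iX mX] [iY mY]; split.
  rewrite (_ : EFin \o _ = ((EFin \o X) \+ (EFin \o Y))%E); first exact: integrableD.
  by apply/funext => s /=; rewrite EFinD.
under eq_integral do rewrite EFinD.
by rewrite integralD//= mX mY.
Qed.

Lemma has_meanZ X a k : has_mean Q X a -> has_mean Q (fun s => k * X s) (k * a).
Proof.
move=> [iX mX]; split.
  rewrite (_ : EFin \o _ = (fun s => k%:E * (EFin \o X) s)%E); first exact: integrableZl.
  by apply/funext => s /=; rewrite EFinM.
under eq_integral do rewrite EFinM.
by rewrite integralZl//= mX.
Qed.

Lemma has_meanN X a : has_mean Q X a -> has_mean Q (fun s => - X s) (- a).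
Proof.
move=> /(has_meanZ (-1)); rewrite mulN1r.
by rewrite (_ : (fun s => -1 * X s) = (fun s => - X s))//; apply/funext => s; rewrite mulN1r.
Qed.

Lemma has_meanB X Y a b : has_mean Q X a -> has_mean Q Y b ->
  has_mean Q (fun s => X s - Y s) (a - b).
Proof. by move=> hX /has_meanN; exact: has_meanD. Qed.

Lemma has_mean_centered X a : has_mean Q X a -> has_mean Q (fun s => X s - a) 0.
Proof. by move=> hX; rewrite -(subrr a); exact: has_meanB hX (has_mean_cst a). Qed.

Lemma has_mean_sum (I : finType) (X : I -> S -> R) a :
  (forall i, has_mean Q (X i) (a i)) -> has_mean Q (fun s => \sum_i X i s) (\sum_i a i).
Proof.
move=> h; have H : forall r : seq I,
  has_mean Q (fun s => \sum_(i <- r) X i s) (\sum_(i <- r) a i).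
  elim=> [|i r IH].
    rewrite big_nil (_ : (fun _ => _) = fun=> 0); first exact: has_mean_cst.
    by apply/funext => s; rewrite big_nil.
  rewrite big_cons (_ : (fun _ => _) = fun s => X i s + \sum_(j <- r) X j s).
    exact: has_meanD.
  by apply/funext => s; rewrite big_cons.
exact: H.
Qed.

Lemma le_has_mean X Y a b : has_mean Q X a -> has_mean Q Y b ->
  (forall s, X s <= Y s) -> a <= b.
Proof.
move=> [iX mX] [iY mY] XY; rewrite -lee_fin -mX -mY.
by apply: le_integral => // s _ /=; rewrite lee_fin.
Qed.

Lemma eq_of_rate (a b C : R) : (forall k : nat, `|a - b| <= C / k.+1%:R) -> a = b.
Proof.
move=> H; apply/eqP; rewrite -subr_eq0 -normr_eq0 eq_le normr_ge0 andbT.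
rewrite leNgt; apply/negP => ab.
have [k _ Hk] := nbhs_infty_ger (C / `|a - b|).
have := H k; rewrite leNgt => /negP; apply.
rewrite ltr_pdivrMr ?ltr0n// mulrC -ltr_pdivrMr//.
by apply: (le_lt_trans (Hk k (leqnn _))); rewrite ltr_nat.
Qed.

(** Means pass to a limit which is uniform in the sample; the limit is integrable
    because it is within [C] of an integrable function. *)
Lemma has_mean_limit (A : S -> R) (B : nat -> S -> R) (a : R) (b : nat -> R) (C C' : R) :
  (forall k, has_mean Q (B k) (b k)) ->
  (forall k s, `|B k s - A s| <= C / k.+1%:R) ->
  (forall k, `|b k - a| <= C' / k.+1%:R) -> has_mean Q A a.
Proof.
move=> hB BA ba.
have mA : measurable_fun setT A.
  apply: (@measurable_fun_rate R _ S B A (fun=> C)) => // k.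
  exact: has_mean_measurable (hB k).
have iA : Q.-integrable setT (EFin \o A).
  have iB0 := (hB 0%N).1.
  apply: (@le_integrable _ _ _ _ _ measurableT _
    (fun s => (`|B 0%N s| + C)%:E)).
  - exact/measurable_EFinP.
  - move=> s _ /=; rewrite lee_fin; have := BA 0%N s; rewrite invr1 mulr1 => h.
    have -> : A s = B 0%N s - (B 0%N s - A s) by rewrite opprB addrC subrK.
    apply: le_trans (ler_norm _); apply: (le_trans (ler_normB _ _)).
    by rewrite lerD2l.
  - rewrite (_ : (fun s => _) = (fun s => `|(B 0%N s)%:E| + C%:E)%E)//.
    apply: integrableD => //; first exact: integrable_abse.
    exact: finite_measure_integrable_cst.
pose m := fine (\int[Q]_s (A s)%:E).
have hA : has_mean Q A m.
  by split=> //; rewrite /m fineK//; exact: integrable_fin_num.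
suff -> : a = m by [].
apply: (@eq_of_rate _ _ (C + C')) => k.
have D1 : b k - m <= C / k.+1%:R.
  apply: (le_has_mean (has_meanB (hB k) hA) (has_mean_cst _)) => s.
  by have /ler_normlP[] := BA k s.
have D2 : m - b k <= C / k.+1%:R.
  apply: (le_has_mean (has_meanB hA (hB k)) (has_mean_cst _)) => s.
  by have /ler_normlP[+ _] := BA k s; rewrite opprB.
have /ler_normlP[D3 D4] := ba k.
rewrite mulrDl; move: (C / _) (C' / _) D1 D2 D3 D4 => e1 e2 D1 D2 D3 D4.
by rewrite ler_norml; apply/andP; split; lra.
Qed.

Lemma centered_second_moment X m (B : R) : has_mean Q X m ->
  (\int[Q]_s (X s ^+ 2)%:E <= B%:E)%E -> (\int[Q]_s ((X s - m) ^+ 2)%:E <= B%:E)%E.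
Proof.
move=> hX XB; have mXf := has_mean_measurable hX.
have X2 : Q.-integrable setT (fun s => (X s ^+ 2)%:E).
  apply/integrableP; split; first by apply/measurable_EFinP; exact: measurable_funX.
  under eq_integral do rewrite gee0_abs ?lee_fin ?sqr_ge0//.
  exact: le_lt_trans XB (ltry _).
pose v := fine (\int[Q]_s (X s ^+ 2)%:E).
have vE : (\int[Q]_s (X s ^+ 2)%:E = v%:E)%E by rewrite /v fineK//; exact: integrable_fin_num.
have hX2 : has_mean Q (fun s => X s ^+ 2) v by split.
have [_ E] := has_meanD hX2 (has_meanD (has_meanZ (- (2 * m)) hX) (has_mean_cst (m ^+ 2))).
have -> : (\int[Q]_s ((X s - m) ^+ 2)%:E =
   \int[Q]_s (X s ^+ 2 + (- (2 * m) * X s + m ^+ 2))%:E)%E.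
  by apply: eq_integral => s _; congr EFin; ring.
rewrite E; move: XB; rewrite vE !lee_fin; have := sqr_ge0 m; lra.
Qed.

End Means.

Section Parts.
Context {R : realType} {dx dy : nat}.
Local Notation cidx := ('I_dx + 'I_dy + 'I_dy)%type.
Implicit Types (u v : triple R dx dy) (h : 'cV[R]_(dx + dy) -> R) (c : cidx).

Definition pt u : 'cV[R]_(dx + dy) := col_mx (tx u) (ty u).

Definition tcoord u c : R :=
  match c with
  | inl (inl i) => tx u i 0
  | inl (inr i) => ty u i 0
  | inr i => tz u i 0
  end.

(** The contributions of the two sample families to a coordinate of the
    direction; at the exact [f] and [g] they are its two expected parts. *)
Definition xi_part h u c : R :=
  match c with
  | inl (inl i) => grad h (pt u) (lshift dy i) 0
  | inl (inr _) => 0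
  | inr i => - grad h (pt u) (rshift dx i) 0
  end.

Definition zeta_part h u c : R :=
  match c with
  | inl (inl i) => - (hess12 h (tx u) (ty u) *m tz u) i 0
  | inl (inr i) => grad h (pt u) (rshift dx i) 0
  | inr i => (hess22 h (tx u) (ty u) *m tz u) i 0
  end.

Definition coin_at (w : bool * bool * bool) c : bool :=
  match c with
  | inl (inl _) => w.1.1
  | inl (inr _) => w.1.2
  | inr _ => w.2
  end.

Lemma hess12E h u i j :
  hess12 h (tx u) (ty u) i j = hess h (pt u) (lshift dy i) (rshift dx j).
Proof. by rewrite /hess12 -/(pt u); move: (hess h (pt u)) => A; rewrite !mxE. Qed.

Lemma hess22E h u i j :
  hess22 h (tx u) (ty u) i j = hess h (pt u) (rshift dx i) (rshift dx j).
Proof. by rewrite /hess22 -/(pt u); move: (hess h (pt u)) => A; rewrite !mxE. Qed.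

Lemma sqdistE u v : sqdist u v = \sum_c (tcoord u c - tcoord v c) ^+ 2.
Proof.
have E n (w w' : 'cV[R]_n) : enorm (w - w') ^+ 2 = \sum_i (w i 0 - w' i 0) ^+ 2.
  by rewrite enorm_sq; apply: eq_bigr => i _; rewrite !mxE expr2.
by rewrite /sqdist !E !big_sumType.
Qed.

Lemma sqdist_ge0 u v : 0 <= sqdist u v.
Proof. by rewrite sqdistE; apply: sumr_ge0 => c _; exact: sqr_ge0. Qed.

Lemma tcoord_exact_dir (f g : 'cV[R]_(dx + dy) -> R) u c :
  tcoord (exact_dir f g u) c = xi_part f u c + zeta_part g u c.
Proof.
case: u c => x y z [[i|i]|i] /=; rewrite ?add0r ?coordB.
- by congr (_ - _); rewrite /grad1 mxE.
- by rewrite /grad2 mxE.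
- by rewrite addrC; congr (- _ + _); rewrite /grad2 mxE.
Qed.

Lemma batch_mean_coord n m (a : 'I_n -> 'cV[R]_m) i :
  (batch_mean a) i 0 = n%:R^-1 * \sum_j a j i 0.
Proof. by rewrite /batch_mean mxE summxE. Qed.

Lemma tcoord_sampled_dir (Xi Zeta : Type) (F : 'cV[R]_(dx + dy) -> Xi -> R)
    (G : 'cV[R]_(dx + dy) -> Zeta -> R) n (I : 'I_n -> Xi) (J : 'I_n -> Zeta) u c :
  tcoord (sampled_dir F G I J u) c =
    n%:R^-1 * \sum_i xi_part (F^~ (I i)) u c + n%:R^-1 * \sum_j zeta_part (G^~ (J j)) u c.
Proof.
case: u c => x y z [[i|i]|i] /=.
- rewrite coordB !batch_mean_coord sumrN mulrN; congr (_ + _).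
  by congr (_ * _); apply: eq_bigr => j _; rewrite mxE.
- rewrite big1 ?mulr0 ?add0r ?batch_mean_coord//; congr (_ * _).
  by apply: eq_bigr => j _; rewrite /grad2 mxE.
- rewrite coordB !batch_mean_coord sumrN mulrN addrC; congr (- _ + _).
  by congr (_ * _); apply: eq_bigr => j _; rewrite /grad2 mxE.
Qed.

Lemma sqdist_pt u v : enorm (pt u - pt v) ^+ 2 <= sqdist u v.
Proof. by rewrite /pt sub_col_mx enorm_col_mx_sq lerDl sqr_ge0. Qed.

Lemma sqr_norm_le (a b : R) : `|a| <= b -> a ^+ 2 <= b ^+ 2.
Proof. by move=> ab; rewrite -real_normK ?num_real//; exact: ler_sqr_mono. Qed.

Lemma xi_part_lip (L : R) h u v c : 0 <= L -> lipschitz_grad L h ->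
  (xi_part h u c - xi_part h v c) ^+ 2 <= L ^+ 2 * sqdist u v.
Proof.
move=> L0 Lh.
have H i : (grad h (pt u) i 0 - grad h (pt v) i 0) ^+ 2 <= L ^+ 2 * sqdist u v.
  apply: (@le_trans _ _ ((L * enorm (pt u - pt v)) ^+ 2)).
    apply: sqr_norm_le; apply: le_trans (Lh _ _).
    by apply: le_trans (ler_enorm_coord _ i); rewrite coordB.
  by rewrite exprMn ler_wpM2l ?sqr_ge0// sqdist_pt.
case: c => [[i|i]|i] /=; first exact: H.
- by rewrite subrr expr0n mulr_ge0 ?sqr_ge0 ?sqdist_ge0.
- by rewrite -opprD sqrrN; exact: H.
Qed.

(** The product [hess g * z] is Lipschitz on [|z| <= rho] only: the change of
    the matrix is multiplied by [|z|], whence the constant depends on [rho]. *)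
Lemma zeta_part_lip (L1 L2 rho : R) h u v c : 0 <= L1 -> 0 <= L2 ->
  twice_differentiable h -> lipschitz_grad L1 h -> lipschitz_hess L2 h ->
  enorm (tz u) <= rho ->
  (zeta_part h u c - zeta_part h v c) ^+ 2
    <= 2 * (L1 ^+ 2 + L2 ^+ 2 * rho ^+ 2) * sqdist u v.
Proof.
move=> L10 L20 dh Lh1 Lh2 zr.
have S0 := sqdist_ge0 u v.
have rho0 : 0 <= rho by apply: le_trans zr.
have M : L1 ^+ 2 * sqdist u v <= 2 * (L1 ^+ 2 + L2 ^+ 2 * rho ^+ 2) * sqdist u v.
  rewrite ler_wpM2r//; have := sqr_ge0 L1.
  have := mulr_ge0 (sqr_ge0 L2) (sqr_ge0 rho); lra.
have H m (A B : 'M[R]_(m, dy)) i :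
    enorm ((A - B) *m tz u) <= L2 * enorm (pt u - pt v) * enorm (tz u) ->
    enorm (B *m (tz u - tz v)) <= L1 * enorm (tz u - tz v) ->
    ((A *m tz u) i 0 - (B *m tz v) i 0) ^+ 2 <=
      2 * (L1 ^+ 2 + L2 ^+ 2 * rho ^+ 2) * sqdist u v.
  move=> HA HB.
  have -> : (A *m tz u) i 0 - (B *m tz v) i 0 =
      ((A - B) *m tz u + B *m (tz u - tz v)) i 0.
    rewrite mulmxBl mulmxBr; move: (A *m _) (B *m _) (B *m _) => P Q W.
    by rewrite !mxE; ring.
  apply: (le_trans (sqr_norm_le (ler_enorm_coord _ i))).
  apply: (le_trans (ler_enorm_sqD _ _)).
  have {HA} := ler_sqr_mono (enorm_ge0 _) HA; have {HB} := ler_sqr_mono (enorm_ge0 _) HB.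
  rewrite !exprMn => HB HA.
  have HA' : enorm ((A - B) *m tz u) ^+ 2 <= L2 ^+ 2 * rho ^+ 2 * sqdist u v.
    apply: (le_trans HA); rewrite mulrAC; apply: ler_pM; rewrite ?mulr_ge0 ?sqr_ge0//.
      by rewrite ler_wpM2l ?sqr_ge0//; exact: ler_sqr_mono.
    exact: sqdist_pt.
  have HB' : enorm (B *m (tz u - tz v)) ^+ 2 <= L1 ^+ 2 * sqdist u v.
    apply: (le_trans HB); rewrite ler_wpM2l ?sqr_ge0// /sqdist lerDr.
    by rewrite addr_ge0 ?sqr_ge0.
  by rewrite -mulrA mulrDl; lra.
case: c => [[i|i]|i] /=.
- rewrite -opprD sqrrN; apply: H.
    exact: (hess12_lip2 _ _ _ _ _ Lh2).
  exact: hess12_bound L20 dh Lh1 Lh2.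
- apply: le_trans M.
  apply: (@le_trans _ _ ((L1 * enorm (pt u - pt v)) ^+ 2)).
    apply: sqr_norm_le; apply: le_trans (Lh1 _ _).
    by apply: le_trans (ler_enorm_coord _ (rshift dx i)); rewrite coordB.
  by rewrite exprMn ler_wpM2l ?sqr_ge0// sqdist_pt.
- apply: H; first exact: (hess22_lip2 _ _ _ _ _ Lh2).
  exact: hess22_bound L20 dh Lh1 Lh2.
Qed.

Section PartMeans.
Context {d' : measure_display} {S : measurableType d'}.
Variables (Q : probability S R) (H : 'cV[R]_(dx + dy) -> S -> R) (h : 'cV[R]_(dx + dy) -> R).
Hypothesis H_mean : expectation_of Q H h.

Lemma expectation_has_mean w : has_mean Q (H w) (h w).
Proof. by have [iH mH] := H_mean w; split. Qed.

Lemma expectation_jointly_measurable :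
  (forall s, everywhere_differentiable (H^~ s)) -> jointly_measurable H.
Proof.
move=> dH; apply: caratheodory_measurable.
  by move=> w; exact: has_mean_measurable (expectation_has_mean w).
move=> s; apply: continuous_econtinuous => w; exact/differentiable_continuous/dH.
Qed.

(** The difference quotients converge uniformly in the sample, at the rate
    given by the Lipschitz constant, so the mean passes to the limit. *)
Lemma grad_has_mean (L : R) w i : 0 <= L ->
  everywhere_differentiable h -> lipschitz_grad L h ->
  (forall s, everywhere_differentiable (H^~ s)) -> (forall s, lipschitz_grad L (H^~ s)) ->
  has_mean Q (fun s => grad (H^~ s) w i 0) (grad h w i 0).
Proof.
move=> L0 dh Lh dH LH.
apply: (@has_mean_limit _ _ _ _ _ (fun k s => diff_quotient (H^~ s) (delta_mx i 0) w k)
  _ (fun k => diff_quotient h (delta_mx i 0) w k) L L).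
- by move=> k; apply: has_meanZ; apply: has_meanB; exact: expectation_has_mean.
- by move=> k s; exact: grad_quotient_rate.
- by move=> k; exact: grad_quotient_rate.
Qed.

Lemma hess_has_mean (L1 L2 : R) w i j : 0 <= L1 -> 0 <= L2 ->
  twice_differentiable h -> lipschitz_grad L1 h -> lipschitz_hess L2 h ->
  (forall s, twice_differentiable (H^~ s)) -> (forall s, lipschitz_grad L1 (H^~ s)) ->
  (forall s, lipschitz_hess L2 (H^~ s)) ->
  has_mean Q (fun s => hess (H^~ s) w i j) (hess h w i j).
Proof.
move=> L10 L20 dh Lh1 Lh2 dH LH1 LH2.
apply: (@has_mean_limit _ _ _ _ (fun s => hess (H^~ s) w i j)
  (fun k s => diff_quotient (fun q => grad (H^~ s) q i 0) (delta_mx j 0) w k)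
  _ (fun k => diff_quotient (fun q => grad h q i 0) (delta_mx j 0) w k) L2 L2).
- move=> k; apply: has_meanZ; apply: has_meanB; apply: (@grad_has_mean L1) => //; try exact: dh.1;
  by move=> s; exact: (dH s).1.
- move=> k s; exact: (hess_quotient_rate w i j k L20 (dH s) (LH2 s)).
- move=> k; exact: (hess_quotient_rate w i j k L20 dh Lh2).
Qed.

Lemma xi_part_has_mean (L : R) u c : 0 <= L ->
  everywhere_differentiable h -> lipschitz_grad L h ->
  (forall s, everywhere_differentiable (H^~ s)) -> (forall s, lipschitz_grad L (H^~ s)) ->
  has_mean Q (fun s => xi_part (H^~ s) u c) (xi_part h u c).
Proof.
move=> L0 dh Lh dH LH; case: c => [[i|i]|i] /=.
- exact: (@grad_has_mean L).
- exact: has_mean_cst.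
- by apply: has_meanN; exact: (@grad_has_mean L).
Qed.

Lemma zeta_part_has_mean (L1 L2 : R) u c : 0 <= L1 -> 0 <= L2 ->
  twice_differentiable h -> lipschitz_grad L1 h -> lipschitz_hess L2 h ->
  (forall s, twice_differentiable (H^~ s)) -> (forall s, lipschitz_grad L1 (H^~ s)) ->
  (forall s, lipschitz_hess L2 (H^~ s)) ->
  has_mean Q (fun s => zeta_part (H^~ s) u c) (zeta_part h u c).
Proof.
move=> L10 L20 dh Lh1 Lh2 dH LH1 LH2.
have M m (A : S -> 'M[R]_(m, dy)) (A0 : 'M[R]_(m, dy)) z i :
    (forall j, has_mean Q (fun s => A s i j) (A0 i j)) ->
    has_mean Q (fun s => (A s *m z) i 0) ((A0 *m z) i 0).
  move=> HA; rewrite mxE (_ : (fun s => _) = (fun s => \sum_j z j 0 * A s i j)).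
    under [X in has_mean _ _ X]eq_bigr do rewrite mulrC.
    by apply: has_mean_sum => j; apply: has_meanZ.
  by apply/funext => s; rewrite mxE; apply: eq_bigr => j _; rewrite mulrC.
have HH i j : has_mean Q (fun s => hess (H^~ s) (pt u) i j) (hess h (pt u) i j).
  exact: (@hess_has_mean L1 L2).
case: c => [[i|i]|i] /=.
- apply: has_meanN; apply: M => j; have := HH (lshift dy i) (rshift dx j).
  rewrite -hess12E; rewrite (_ : (fun s => hess _ _ _ _) =
    (fun s => hess12 (H^~ s) (tx u) (ty u) i j))//.
  by apply/funext => s; rewrite hess12E.
- apply: (@grad_has_mean L1) => //; first exact: dh.1.
  by move=> s; exact: (dH s).1.
- apply: M => j; have := HH (rshift dx i) (rshift dx j).
  rewrite -hess22E; rewrite (_ : (fun s => hess _ _ _ _) =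
    (fun s => hess22 (H^~ s) (tx u) (ty u) i j))//.
  by apply/funext => s; rewrite hess22E.
Qed.

Lemma xi_part_variance (sigma : R) u c : grad_variance_le Q H h sigma ->
  (\int[Q]_s ((xi_part (H^~ s) u c - xi_part h u c) ^+ 2)%:E <= (sigma ^+ 2)%:E)%E.
Proof.
move=> V; apply: le_trans (V (pt u)).
apply: le_ge0_integral => s; rewrite lee_fin ?sqr_ge0//.
have H1 i : (grad (H^~ s) (pt u) i 0 - grad h (pt u) i 0) ^+ 2 <=
    enorm (grad (H^~ s) (pt u) - grad h (pt u)) ^+ 2.
  apply: sqr_norm_le; apply: le_trans (ler_enorm_coord _ i).
  by rewrite coordB.
case: c => [[i|i]|i] /=; first exact: H1.
- by rewrite subrr expr0n sqr_ge0.
- by rewrite -opprD sqrrN; exact: H1.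
Qed.

(** The middle coordinates are those of [grad2 G] and have the variance of the
    gradient; the others are coordinates of [hess G * (0, z)]. *)
Lemma zeta_part_variance (s1 s2 rho : R) u c : 0 < rho ->
  grad_variance_le Q H h s1 -> hess_variance_le Q H h s2 -> enorm (tz u) <= rho ->
  measurable_fun setT (fun s => zeta_part (H^~ s) u c) ->
  (\int[Q]_s ((zeta_part (H^~ s) u c - zeta_part h u c) ^+ 2)%:E
    <= (s1 ^+ 2 + rho ^+ 2 * s2 ^+ 2)%:E)%E.
Proof.
move=> rho0 V1 V2 zr mz.
have zblock (h1 h2 : 'cV[R]_(dx + dy) -> R) :
    (hess h1 (pt u) - hess h2 (pt u)) *m col_mx 0 (tz u) =
    col_mx (hess12 h1 (tx u) (ty u) *m tz u - hess12 h2 (tx u) (ty u) *m tz u)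
           (hess22 h1 (tx u) (ty u) *m tz u - hess22 h2 (tx u) (ty u) *m tz u).
  rewrite /hess12 /hess22 -!/(pt u).
  move: (hess h1 (pt u)) (hess h2 (pt u)) (tz u) => A B z.
  by rewrite mulmxBl (mul_col_0mx A) (mul_col_0mx B) sub_col_mx.
have zbound (h1 h2 : 'cV[R]_(dx + dy) -> R) i :
    `|((hess h1 (pt u) - hess h2 (pt u)) *m col_mx 0 (tz u)) i 0| <=
    rho * opnorm (hess h1 (pt u) - hess h2 (pt u)).
  apply: (le_trans (ler_enorm_coord _ _)); apply: (le_trans (ler_opnorm _ _)).
  by rewrite enorm_col_0mx mulrC ler_wpM2r ?opnorm_ge0.
have [[i ->]|zc] : (exists i, c = inl (inr i)) \/
    forall s, `|zeta_part (H^~ s) u c - zeta_part h u c| <=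
      rho * opnorm (hess (H^~ s) (pt u) - hess h (pt u)).
- case: (c) => [[i|i]|i]; [right|by left; exists i|right] => s /=.
    rewrite -opprD normrN; have := zbound (H^~ s) h (lshift dy i).
    by rewrite zblock col_mxEu coordB.
  have := zbound (H^~ s) h (rshift dx i).
  by rewrite zblock col_mxEd coordB.
- apply: (@le_trans _ _ (s1 ^+ 2)%:E); last first.
    by rewrite lee_fin lerDl mulr_ge0 ?sqr_ge0.
  apply: le_trans (V1 (pt u)); apply: le_ge0_integral => s; rewrite lee_fin ?sqr_ge0//=.
  apply: sqr_norm_le; apply: le_trans (ler_enorm_coord _ (rshift dx i)).
  by rewrite coordB.
- apply: (@le_trans _ _ (rho ^+ 2 * s2 ^+ 2)%:E); last first.
    by rewrite lee_fin lerDr sqr_ge0.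
  have mX : measurable_fun setT (fun s => zeta_part (H^~ s) u c - zeta_part h u c).
    by apply: measurable_funB; [exact: mz|exact: measurable_cst].
  have E s : ((zeta_part (H^~ s) u c - zeta_part h u c) ^+ 2)%:E =
     ((rho ^+ 2)%:E * ((rho^-1 * (zeta_part (H^~ s) u c - zeta_part h u c)) ^+ 2)%:E)%E.
    move: (zeta_part (H^~ s) u c - zeta_part h u c) => X.
    by rewrite -EFinM; congr EFin; field; rewrite gt_eqF.
  under eq_integral do rewrite E.
  rewrite ge0_integralZl//; last 3 first.
  + apply/measurable_EFinP/measurable_funX/measurable_fun_scale; exact: mX.
  + by move=> s _; rewrite lee_fin sqr_ge0.
  + by rewrite lee_fin sqr_ge0.
  rewrite [leRHS]EFinM; apply: lee_wpmul2l; first by rewrite lee_fin sqr_ge0.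
  apply: le_trans (V2 (pt u)); apply: le_ge0_integral => s; rewrite lee_fin ?sqr_ge0//=.
  apply: sqr_norm_le; rewrite normrM gtr0_norm ?invr_gt0// mulrC ler_pdivrMr//.
  by rewrite mulrC; exact: zc.
Qed.

End PartMeans.
End Parts.

(** * Measurability of the iterates *)

Section TripleMeasurability.
Context {R : realType} {dx dy : nat}.
Local Notation cidx := ('I_dx + 'I_dy + 'I_dy)%type.

Definition mtriple d (T : measurableType d) (u : T -> triple R dx dy) :=
  forall c, measurable_fun setT (fun t => tcoord (u t) c).

(** As for [jointly_measurable], through measurable maps into both arguments. *)
Definition part_measurable d' (S : measurableType d') (phi : triple R dx dy -> S -> R) :=
  forall d (T : measurableType d) (u : T -> triple R dx dy) (s : T -> S),
    mtriple u -> measurable_fun setT s -> measurable_fun setT (fun t => phi (u t) (s t)).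

Lemma mcoords_pt d (T : measurableType d) (u : T -> triple R dx dy) :
  mtriple u -> mcoords (fun t => pt (u t)).
Proof.
move=> mu i; case: (split_ordP i) => j ->.
- rewrite (_ : (fun t => _) = (fun t => tcoord (u t) (inl (inl j)))); first exact: mu.
  by apply/funext => t; rewrite /pt col_mxEu.
- rewrite (_ : (fun t => _) = (fun t => tcoord (u t) (inl (inr j)))); first exact: mu.
  by apply/funext => t; rewrite /pt col_mxEd.
Qed.

Section Sampled.
Context {d' : measure_display} {S : measurableType d'}.
Variables (H : 'cV[R]_(dx + dy) -> S -> R).
Hypothesis mH : jointly_measurable H.

Lemma xi_part_measurable (L : R) c : 0 <= L ->
  (forall s, everywhere_differentiable (H^~ s)) -> (forall s, lipschitz_grad L (H^~ s)) ->
  part_measurable (fun u s => xi_part (H^~ s) u c).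
Proof.
move=> L0 dH LH d T u s mu ms.
have M i : measurable_fun setT (fun t => grad (H^~ (s t)) (pt (u t)) i 0).
  by apply: (@jointly_measurable_grad _ _ _ _ H L i) => //; exact: mcoords_pt.
case: c => [[i|i]|i] /=; [exact: M|exact: measurable_cst|].
by apply: measurable_funN; exact: M.
Qed.

Lemma zeta_part_measurable (L1 L2 : R) c : 0 <= L1 -> 0 <= L2 ->
  (forall s, twice_differentiable (H^~ s)) -> (forall s, lipschitz_grad L1 (H^~ s)) ->
  (forall s, lipschitz_hess L2 (H^~ s)) ->
  part_measurable (fun u s => zeta_part (H^~ s) u c).
Proof.
move=> L10 L20 dH LH1 LH2 d T u s mu ms.
have MH i j : measurable_fun setT (fun t => hess (H^~ (s t)) (pt (u t)) i j).
  by apply: (@jointly_measurable_hess _ _ _ _ H L1 L2 i j) => //; exact: mcoords_pt.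
case: c => [[i|i]|i] /=.
- apply: measurable_funN.
  rewrite (_ : (fun t => _) = (fun t => \sum_j hess (H^~ (s t)) (pt (u t)) (lshift dy i) (rshift dx j)
      * tcoord (u t) (inr j))).
    by apply: measurable_fun_big => j; apply: measurable_funM; [exact: MH|exact: mu].
  by apply/funext => t; rewrite mxE; apply: eq_bigr => j _; rewrite hess12E.
- apply: (@jointly_measurable_grad _ _ _ _ H L1) => //; last exact: mcoords_pt.
  by move=> s'; exact: (dH s').1.
- rewrite (_ : (fun t => _) = (fun t => \sum_j hess (H^~ (s t)) (pt (u t)) (rshift dx i) (rshift dx j)
      * tcoord (u t) (inr j))).
    by apply: measurable_fun_big => j; apply: measurable_funM; [exact: MH|exact: mu].
  by apply/funext => t; rewrite mxE; apply: eq_bigr => j _; rewrite hess22E.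
Qed.

End Sampled.

Lemma constant_jointly_measurable (h : 'cV[R]_(dx + dy) -> R) :
  everywhere_differentiable h -> jointly_measurable (fun w (_ : unit) => h w).
Proof.
move=> dh; apply: caratheodory_measurable => [w|_]; first exact: measurable_cst.
by apply: continuous_econtinuous => w; exact/differentiable_continuous/dh.
Qed.

Lemma measurable_sqdist d (T : measurableType d) (u v : T -> triple R dx dy) :
  mtriple u -> mtriple v -> measurable_fun setT (fun t => sqdist (u t) (v t)).
Proof.
move=> mu mv; rewrite (_ : (fun t => _) = (fun t => \sum_c (tcoord (u t) c - tcoord (v t) c) ^+ 2)).
  by apply: measurable_fun_big => c; apply/measurable_funX/measurable_funB.
by apply/funext => t; rewrite sqdistE.
Qed.

Section ExactPart.
Variables (f g : 'cV[R]_(dx + dy) -> R) (Lf L1 L2 : R).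
Hypotheses (Lf0 : 0 <= Lf) (L10 : 0 <= L1) (L20 : 0 <= L2).
Hypotheses (df : everywhere_differentiable f) (dg : twice_differentiable g).
Hypotheses (f_lip : lipschitz_grad Lf f) (g_lip1 : lipschitz_grad L1 g)
  (g_lip2 : lipschitz_hess L2 g).
Context {d : measure_display} {T : measurableType d}.
Variable u : T -> triple R dx dy.
Hypothesis mu : mtriple u.

Lemma measurable_xi_part_exact c : measurable_fun setT (fun t => xi_part f (u t) c).
Proof.
by apply: (@xi_part_measurable _ unit (fun w _ => f w)
  (constant_jointly_measurable df) Lf c _ _ _ _ _ _ (fun _ => tt)).
Qed.

Lemma measurable_zeta_part_exact c : measurable_fun setT (fun t => zeta_part g (u t) c).
Proof.
by apply: (@zeta_part_measurable _ unit (fun w _ => g w)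
  (constant_jointly_measurable dg.1) L1 L2 c _ _ _ _ _ _ _ _ (fun _ => tt)).
Qed.

Lemma mtriple_exact_dir : mtriple (fun t => exact_dir f g (u t)).
Proof.
move=> c; rewrite (_ : (fun t => _) = (fun t => xi_part f (u t) c + zeta_part g (u t) c)).
  exact: measurable_funD (measurable_xi_part_exact c) (measurable_zeta_part_exact c).
by apply/funext => t; rewrite tcoord_exact_dir.
Qed.

End ExactPart.

Lemma measurable_coin_at c : measurable_fun setT (coin_at (dx := dx) (dy := dy) ^~ c).
Proof.
case: c => [[i|i]|i] /=; last exact: measurable_snd.
- exact: (measurableT_comp measurable_fst measurable_fst).
- exact: (measurableT_comp measurable_snd measurable_fst).
Qed.

Lemma proj_ball_coord_econtinuous (r : R) i : 0 < r ->
  econtinuous (fun w : 'cV[R]_dy => proj_ball r w i 0).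
Proof.
move=> r0; apply: (@lipschitz_econtinuous _ _ _ 1) => w w'.
rewrite mul1r -coordB; apply: le_trans (ler_enorm_coord _ i) _.
exact: proj_ball_nonexpansive.
Qed.

Section State.
Context {dXi dZeta d : measure_display}.
Context {Xi : measurableType dXi} {Zeta : measurableType dZeta} {T : measurableType d}.
Variables (b tau : nat).
Variables (F : 'cV[R]_(dx + dy) -> Xi -> R) (G : 'cV[R]_(dx + dy) -> Zeta -> R).
Hypothesis mF : forall c, part_measurable (fun u s => xi_part (F^~ s) u c).
Hypothesis mG : forall c, part_measurable (fun u s => zeta_part (G^~ s) u c).
Variables (r : R) (r_gt0 : 0 < r) (alpha beta gamma : nat -> R) (um1 u0 : triple R dx dy).
Variable D : spaba_draws R dx dy Xi Zeta b tau T.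

Lemma mtriple_sampled_dir n (I : 'I_n -> T -> Xi) (J : 'I_n -> T -> Zeta)
    (u : T -> triple R dx dy) : mtriple u ->
  (forall i, measurable_fun setT (I i)) -> (forall j, measurable_fun setT (J j)) ->
  mtriple (fun t => sampled_dir F G (I^~ t) (J^~ t) (u t)).
Proof.
move=> mu mI mJ c.
rewrite (_ : (fun t => _) = (fun t => n%:R^-1 * \sum_i xi_part (F^~ (I i t)) (u t) c
   + n%:R^-1 * \sum_j zeta_part (G^~ (J j t)) (u t) c)).
  apply: measurable_funD; apply: measurable_fun_scale; apply: measurable_fun_big => i.
    exact: mF.
  exact: mG.
by apply/funext => t; rewrite tcoord_sampled_dir.
Qed.

Lemma tcoord_spaba_dir k t s c : tcoord (spaba_dir F G D k t s) c =
  if coin_at (coin D k t) c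
  then tcoord (sampled_dir F G ((large_xi D k)^~ t) ((large_zeta D k)^~ t) (cur_pt s)) c
  else tcoord (prev_dir s) c
    + tcoord (sampled_dir F G ((small_xi D k)^~ t) ((small_zeta D k)^~ t) (cur_pt s)) c
    - tcoord (sampled_dir F G ((small_xi D k)^~ t) ((small_zeta D k)^~ t) (prev_pt s)) c.
Proof.
rewrite /spaba_dir; case: (coin D k t) => -[cx cy] cz.
case: c => [[i|i]|i] /=; [case: cx|case: cy|case: cz] => //=;
by rewrite coordB; congr (_ - _); rewrite mxE.
Qed.

(** Stated for an arbitrary sigma-algebra on the sample space, so that it can
    express dependence on the past as well as plain measurability. *)
Definition draws_measurable_before k :=
  (forall c, measurable_fun setT (init_coords (init_dir D) c)) /\
  forall j, (j < k)%N -> [/\ measurable_fun setT (coin D j),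
    forall i, measurable_fun setT (large_xi D j i),
    forall i, measurable_fun setT (large_zeta D j i),
    forall i, measurable_fun setT (small_xi D j i) &
    forall i, measurable_fun setT (small_zeta D j i)].

Local Notation st k := (fun t => spaba F G r alpha beta gamma um1 u0 D k t).

Lemma mtriple_cst (u : triple R dx dy) : mtriple (fun _ : T => u).
Proof. by move=> c; exact: measurable_cst. Qed.

Lemma mstate_spaba k : draws_measurable_before k ->
  [/\ mtriple (fun t => cur_pt (st k t)), mtriple (fun t => prev_pt (st k t)) &
      mtriple (fun t => prev_dir (st k t))].
Proof.
move=> [mI]; elim: k => [_|k IH mD] /=.
  split; [exact: mtriple_cst|exact: mtriple_cst|].
  by move=> c; have := mI c; rewrite (_ : init_coords _ c = fun t => tcoord (init_dir D t) c)//;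
    apply/funext => t; case: c => [[]|].
have [|mc mp mv] := IH; first by move=> j jk; apply: mD; exact: ltnW.
have [mcoin mlx mlz msx msz] := mD k (leqnn _).
have mdir : mtriple (fun t => spaba_dir F G D k t (st k t)).
  move=> c; rewrite (_ : (fun t => _) = (fun t => if coin_at (coin D k t) c
    then tcoord (sampled_dir F G ((large_xi D k)^~ t) ((large_zeta D k)^~ t) (cur_pt (st k t))) c
    else tcoord (prev_dir (st k t)) c
    + tcoord (sampled_dir F G ((small_xi D k)^~ t) ((small_zeta D k)^~ t) (cur_pt (st k t))) c
    - tcoord (sampled_dir F G ((small_xi D k)^~ t) ((small_zeta D k)^~ t) (prev_pt (st k t))) c)).
    apply: measurable_fun_ifT.
    - exact: (measurableT_comp (measurable_coin_at c) mcoin).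
    - exact: mtriple_sampled_dir.
    - apply: measurable_funB; last exact: mtriple_sampled_dir.
      by apply: measurable_funD; [exact: mv|exact: mtriple_sampled_dir].
  by apply/funext => t; rewrite tcoord_spaba_dir.
split=> //.
have upd n (w w' : T -> 'cV[R]_n) (a : R) : mcoords w -> mcoords w' ->
    mcoords (fun t => w t - a *: w' t).
  move=> mw mw' i; rewrite (_ : (fun t => _) = (fun t => w t i 0 - a * w' t i 0)).
    by apply: measurable_funB => //; exact: measurable_fun_scale.
  by apply/funext => t; rewrite !mxE.
case=> [[i|i]|i] /=.
- by apply: upd => j; [exact: (mc (inl (inl j)))|exact: (mdir (inl (inl j)))].
- by apply: upd => j; [exact: (mc (inl (inr j)))|exact: (mdir (inl (inr j)))].
- apply: (@econtinuous_measurable _ _ (fun w => proj_ball r w i 0)).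
    exact: proj_ball_coord_econtinuous.
  by apply: upd => j; [exact: (mc (inr j))|exact: (mdir (inr j))].
Qed.

End State.

End TripleMeasurability.

(** * The mean-square error of the estimator *)

Section Batch.
Context {R : realType} {d d' : measure_display}.
Context {Om : measurableType d} {S : measurableType d'}.
Variables (P : probability Om R) (Q : probability S R).
Variables (n : nat) (Y : 'I_n -> Om -> S) (Gen : 'I_n -> set (set Om)).
Hypothesis Gen_measurable : forall i, Gen i `<=` measurable.
Hypothesis mY : forall i, measurable_fun setT (Y i).
Hypothesis indepY : forall i A B, <<s Gen i >> A -> measurable B ->
  P (A `&` Y i @^-1` B) = (P A * Q B)%E.
Hypothesis otherY : forall i j, i != j ->
  measurable_fun setT (Y j : sub_space (Gen i) -> S).
Variables (A : Om -> R) (chi : Om -> S -> R) (B : Om -> R) (a : R).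
Hypothesis mA : forall i, measurable_fun setT (A : sub_space (Gen i) -> R).
Hypothesis mchi : forall i,
  measurable_fun setT (fun z : sub_space (Gen i) * S => chi z.1 z.2).
Hypothesis chi0 : forall om, has_mean Q (chi om) 0.
Hypothesis chiB : forall om, (\int[Q]_s (chi om s ^+ 2)%:E <= (B om)%:E)%E.
Hypothesis mB : measurable_fun setT B.

Let B0 om : 0 <= B om.
Proof.
rewrite -lee_fin; apply: le_trans (chiB om).
by apply: integral_ge0 => s _; rewrite lee_fin sqr_ge0.
Qed.

Let partial (r : seq 'I_n) om := A om + a * \sum_(i <- r) chi om (Y i om).

Let m_partial i r : i \notin r -> measurable_fun setT (partial r : sub_space (Gen i) -> R).
Proof.
elim: r => [_|j r IH]; rewrite /partial.
  rewrite (_ : (fun _ => _) = A); first exact: mA.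
  by apply/funext => om; rewrite big_nil mulr0 addr0.
rewrite inE negb_or => /andP[ij ir].
rewrite (_ : (fun om => _) = (fun om => partial r om + a * chi om (Y j om))).
  apply: measurable_funD; first exact: IH.
  apply: measurable_fun_scale.
  have mp : measurable_fun setT (fun om : sub_space (Gen i) => (om, Y j om)).
    by apply: measurable_fun_pair; [exact: measurable_id|exact: otherY].
  exact: (measurableT_comp (@mchi i) mp).
by apply/funext => om; rewrite big_cons /partial; move: (\sum_(_ <- r) _) => s; ring.
Qed.

Let partial_bound r : uniq r ->
  (\int[P]_om (partial r om ^+ 2)%:E <=
   \int[P]_om (A om ^+ 2)%:E + ((size r)%:R * a ^+ 2)%:E * \int[P]_om (B om)%:E)%E.
Proof.
elim: r => [_|i r IH].
  rewrite mul0r mul0e adde0; apply: le_ge0_integral => om; rewrite lee_fin ?sqr_ge0//.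
  by rewrite /partial big_nil mulr0 addr0.
move=> /= /andP[ir ur].
have E om : partial (i :: r) om = partial r om + a * chi om (Y i om).
  by rewrite /partial big_cons; move: (\sum_(_ <- r) _) => s; ring.
have := @second_moment_peel _ _ _ _ _ P Q (Y i) (Gen i) (@Gen_measurable i) (@mY i)
  (@indepY i) (partial r) (fun om s => a * chi om s) (fun om => a ^+ 2 * B om).
rewrite (_ : (fun om => _) = (fun om => (partial (i :: r) om ^+ 2)%:E)); last first.
  by apply/funext => om; rewrite E.
move=> /(_ (m_partial ir)) H; apply: (le_trans (H _ _ _)).
- exact: measurable_fun_scale (@mchi i).
- by move=> om; have := has_meanZ a (chi0 om); rewrite mulr0.
- move=> om; have E3 s : (((a * chi om s) ^+ 2)%:E = (a ^+ 2)%:E * (chi om s ^+ 2)%:E)%E.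
    by rewrite exprMn.
  under eq_integral do rewrite E3.
  have mc : measurable_fun setT (chi om) := has_mean_measurable (chi0 om).
  rewrite ge0_integralZl//; last 3 first.
  + exact/measurable_EFinP/measurable_funX.
  + by move=> s _; rewrite lee_fin sqr_ge0.
  + by rewrite lee_fin sqr_ge0.
  by rewrite [leRHS]EFinM; apply: lee_wpmul2l => //; rewrite lee_fin sqr_ge0.
have E2 om : ((partial r om ^+ 2 + a ^+ 2 * B om)%:E =
  (partial r om ^+ 2)%:E + (a ^+ 2)%:E * (B om)%:E)%E by [].
under eq_integral do rewrite E2.
have mp : measurable_fun setT (partial r).
  exact: (measurable_fun_sub (@Gen_measurable i) (m_partial ir)).
rewrite ge0_integralD//; first last.
- by apply: measurable_funeM; exact/measurable_EFinP.
- by move=> om _; rewrite mule_ge0// lee_fin ?sqr_ge0.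
- exact/measurable_EFinP/measurable_funX.
- by move=> om _; rewrite lee_fin sqr_ge0.
rewrite ge0_integralZl//; last 3 first.
- exact/measurable_EFinP.
- by move=> om _; rewrite lee_fin.
- by rewrite lee_fin sqr_ge0.
apply: (le_trans (leeD2r _ (IH ur))).
have s0 : (0 <= ((size r)%:R * a ^+ 2)%:E)%E.
  by rewrite lee_fin; apply: mulr_ge0 => //; exact: sqr_ge0.
have s1 : (0 <= (a ^+ 2)%:E)%E by rewrite lee_fin sqr_ge0.
rewrite -addeA leeD2l// -ge0_muleDl//.
by rewrite -EFinD -[X in _ + X]mul1r -mulrDl natr1.
Qed.

(** The samples are peeled off one by one, each being independent of what remains.
    For [a = 1 / n] the factor is [1 / n]: an average of [n] fresh samples. *)
Lemma batch_second_moment :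
  (\int[P]_om ((A om + a * \sum_i chi om (Y i om)) ^+ 2)%:E <=
   \int[P]_om (A om ^+ 2)%:E + (n%:R * a ^+ 2)%:E * \int[P]_om (B om)%:E)%E.
Proof.
have := @partial_bound (index_enum 'I_n) (index_enum_uniq _).
by rewrite -[index_enum _]enumT size_enum_ord.
Qed.

End Batch.

Section Coin.
Context {R : realType}.
Variables (Q : probability bool R) (p : R).
Hypothesis Qp : Q [set true] = p%:E.

Lemma integral_coin (x y : R) :
  (\int[Q]_s (if s then x else y)%:E = (p * x + (1 - p) * y)%:E)%E.
Proof.
have I1 : has_mean Q (\1_[set true] : bool -> R) p.
  split; last by rewrite integral_indic// setIT; exact: Qp.
  exact: integrable_indic.
have [_ H] := has_meanD (has_mean_cst Q y) (has_meanZ (x - y) I1).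
rewrite (_ : p * x + (1 - p) * y = y + (x - y) * p); last by ring.
rewrite -H; apply: eq_integral => s _; congr EFin; rewrite indicE.
by case: s; [rewrite mem_set//= mulr1 addrC subrK|rewrite memNset//= mulr0 addr0].
Qed.

End Coin.

Section Estimator.
Context {R : realType} {dx dy : nat} {dXi dZeta d : measure_display}.
Context {Xi : measurableType dXi} {Zeta : measurableType dZeta} {Om : measurableType d}.
Variables (QXi : probability Xi R) (QZeta : probability Zeta R) (P : probability Om R).
Variables (K b tau : nat) (p : R) (D : spaba_draws R dx dy Xi Zeta b tau Om).
Hypothesis sampling : spaba_sampling QXi QZeta P K p D.
Hypothesis p01 : 0 < p <= 1.

Local Notation E := (@sigma_of_draw R dx dy dXi dZeta d Xi Zeta Om K b tau D).
Local Notation past i0 := (sub_space (others E i0)).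

(** Iterations are numbered from [1], the initial direction being before all. *)
Definition draw_time (i : draw_index K b tau) : nat :=
  match i with
  | InitDir => 0
  | Coin k => k.+1
  | LargeXi k _ => k.+1
  | LargeZeta k _ => k.+1
  | SmallXi k _ => k.+1
  | SmallZeta k _ => k.+1
  end.

Lemma past_measurable i i0 d' (S : measurableType d') (X : Om -> S) :
  E i = sigma_of X -> i <> i0 -> measurable_fun setT (X : past i0 -> S).
Proof.
move=> EX ii0 _ B mB; apply: sub_sigma_algebra; exists i => //.
by rewrite EX; exists B.
Qed.

Lemma init_dir_past i0 c : InitDir _ _ _ <> i0 ->
  measurable_fun setT (init_coords (init_dir D) c : past i0 -> R).
Proof.
move=> ii0 _ B mB; apply: sub_sigma_algebra; exists (InitDir K b tau) => //.
by apply: sub_sigma_algebra; exists c => //; exists B.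
Qed.

(** What is drawn before iteration [k] is known even if one draw of iteration
    [k] is hidden. *)
Lemma draws_before_past i0 k : (k <= K)%N -> draw_time i0 = k.+1 ->
  @draws_measurable_before R dx dy dXi dZeta _ Xi Zeta (past i0) b tau D k.
Proof.
move=> kK ti0; have ne i : (draw_time i <= k)%N -> i <> i0.
  by move=> ik ii0; move: ik; rewrite ii0 ti0 ltnn.
split=> [c|j jk]; first by apply: init_dir_past; exact: ne.
have jK : (j < K)%N by apply: leq_trans kK.
split=> [|i|i|i|i].
- exact: (@past_measurable (Coin _ _ (Ordinal jK)) i0 _ _ (coin D j) erefl (ne _ _)).
- exact: (@past_measurable (LargeXi _ (Ordinal jK) i) i0 _ _ (large_xi D j i) erefl (ne _ _)).
- exact: (@past_measurable (LargeZeta _ (Ordinal jK) i) i0 _ _ (large_zeta D j i) erefl (ne _ _)).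
- exact: (@past_measurable (SmallXi _ (Ordinal jK) i) i0 _ _ (small_xi D j i) erefl (ne _ _)).
- exact: (@past_measurable (SmallZeta _ (Ordinal jK) i) i0 _ _ (small_zeta D j i) erefl (ne _ _)).
Qed.

Lemma draws_before_all k : (k <= K)%N ->
  @draws_measurable_before R dx dy dXi dZeta _ Xi Zeta Om b tau D k.
Proof.
move=> kK; case: sampling => mI mC mL mS _; split=> // j jk.
have jK : (j < K)%N by apply: leq_trans kK.
have [mc _ _ _] := mC j jK; have [mlx mlz] := mL j jK; have [msx msz] := mS j jK.
by split=> // i; [case: (mlx i)|case: (mlz i)|case: (msx i)|case: (msz i)].
Qed.

Let past_events i0 : others E i0 `<=` measurable.
Proof. exact: (other_draws_measurable sampling). Qed.

Lemma draw_indep i0 d' (S : measurableType d') (Q : probability S R) (X : Om -> S) :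
  E i0 = sigma_of X -> copy_of P Q X -> forall A B, <<s others E i0 >> A ->
  measurable B -> P (A `&` X @^-1` B) = (P A * Q B)%E.
Proof.
move=> EX [_ PX] A B sA mB; rewrite (other_draws_indep sampling sA).
  by congr (_ * _)%E; exact: PX.
by rewrite EX; exists B => //; rewrite setTI.
Qed.

(** The [xi]-batch and the [zeta]-batch are peeled off in turn. While a
    sample of one batch is integrated out, all the other draws count as frozen, the
    other batch included. *)
Lemma two_batch_second_moment k n (ix iz : 'I_n -> draw_index K b tau)
    (X : 'I_n -> Om -> Xi) (Z : 'I_n -> Om -> Zeta)
    (A : Om -> R) (chix : Om -> Xi -> R) (chiz : Om -> Zeta -> R) (Bx Bz : Om -> R) :
  (0 < n)%N -> (forall i, E (ix i) = sigma_of (X i)) -> (forall i, E (iz i) = sigma_of (Z i)) ->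
  (forall i, copy_of P QXi (X i)) -> (forall i, copy_of P QZeta (Z i)) ->
  injective ix -> injective iz -> (forall i j, ix i <> iz j) ->
  (forall i, draw_time (ix i) = k) -> (forall i, draw_time (iz i) = k) ->
  (forall i0, draw_time i0 = k -> measurable_fun setT (A : past i0 -> R)) ->
  (forall i0, draw_time i0 = k ->
    measurable_fun setT (fun z : past i0 * Xi => chix z.1 z.2)) ->
  (forall i0, draw_time i0 = k ->
    measurable_fun setT (fun z : past i0 * Zeta => chiz z.1 z.2)) ->
  (forall om, has_mean QXi (chix om) 0) -> (forall om, has_mean QZeta (chiz om) 0) ->
  (forall om, \int[QXi]_s (chix om s ^+ 2)%:E <= (Bx om)%:E)%E ->
  (forall om, \int[QZeta]_s (chiz om s ^+ 2)%:E <= (Bz om)%:E)%E ->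
  measurable_fun setT Bx -> measurable_fun setT Bz ->
  (\int[P]_om ((A om + n%:R^-1 * (\sum_i chix om (X i om))
      + n%:R^-1 * (\sum_i chiz om (Z i om))) ^+ 2)%:E <=
   \int[P]_om (A om ^+ 2)%:E + (n%:R^-1)%:E * (\int[P]_om (Bx om)%:E + \int[P]_om (Bz om)%:E))%E.
Proof.
move=> n0 Ex Ez cx cz injx injz xz tx tz mA mchix mchiz x0 z0 xB zB mBx mBz.
have nn : n%:R * (n%:R^-1) ^+ 2 = n%:R^-1 :> R.
  by rewrite expr2 mulrA mulfV ?mul1r// pnatr_eq0 -lt0n.
have Bx0 om : 0 <= Bx om.
  by rewrite -lee_fin; apply: le_trans (xB om); apply: integral_ge0 => s _; rewrite lee_fin sqr_ge0.
have Bz0 om : 0 <= Bz om.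
  by rewrite -lee_fin; apply: le_trans (zB om); apply: integral_ge0 => s _; rewrite lee_fin sqr_ge0.
have mX i j : ix j <> i -> measurable_fun setT (X j : past i -> Xi).
  by move=> ij; apply: past_measurable (Ex j) ij.
have H1 := @batch_second_moment _ _ _ _ _ P QXi n X (fun i => others E (ix i))
  (fun i => @past_events _) (fun i => (cx i).1)
  (fun i => draw_indep (Ex i) (cx i)) _ A chix Bx n%:R^-1
  (fun i => @mA _ (tx i)) (fun i => @mchix _ (tx i)) x0 xB mBx.
have H2 := @batch_second_moment _ _ _ _ _ P QZeta n Z (fun i => others E (iz i))
  (fun i => @past_events _) (fun i => (cz i).1)
  (fun i => draw_indep (Ez i) (cz i)) _
  (fun om => A om + n%:R^-1 * \sum_i chix om (X i om)) chiz Bz n%:R^-1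
  _ (fun i => @mchiz _ (tz i)) z0 zB mBz.
apply: (le_trans (H2 _ _)).
- move=> i j /eqP ij; apply: (past_measurable (Ez j)) => /injz ji.
  by apply: ij; rewrite ji.
- move=> i; apply: measurable_funD; first exact: mA.
  apply: measurable_fun_scale; apply: measurable_fun_big => j.
  have mp : measurable_fun setT (fun om : past (iz i) => (om, X j om)).
    by apply: measurable_fun_pair; [exact: measurable_id|apply: mX; exact: xz].
  exact: (measurableT_comp (@mchix _ (tz i)) mp).
rewrite nn; apply: (le_trans (leeD2r _ (H1 _))).
  move=> i j /eqP ij; apply: (past_measurable (Ex j)) => /injx ji.
  by apply: ij; rewrite ji.
rewrite nn -addeA -ge0_muleDr//; apply: integral_ge0 => om _; rewrite lee_fin//.
Qed.

Variables (F : 'cV[R]_(dx + dy) -> Xi -> R) (G : 'cV[R]_(dx + dy) -> Zeta -> R).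
Variables (f g : 'cV[R]_(dx + dy) -> R) (Lf L1 L2 sf sg1 sg2 : R).
Hypotheses (Lf0 : 0 <= Lf) (L10 : 0 <= L1) (L20 : 0 <= L2).
Hypotheses (f_mean : expectation_of QXi F f) (g_mean : expectation_of QZeta G g).
Hypotheses (f_diff : everywhere_differentiable f) (g_diff : twice_differentiable g).
Hypotheses (F_diff : forall xi, everywhere_differentiable (F^~ xi))
  (G_diff : forall zeta, twice_differentiable (G^~ zeta)).
Hypotheses (f_lip : lipschitz_grad Lf f) (g_lip1 : lipschitz_grad L1 g)
  (g_lip2 : lipschitz_hess L2 g).
Hypotheses (F_lip : forall xi, lipschitz_grad Lf (F^~ xi))
  (G_lip1 : forall zeta, lipschitz_grad L1 (G^~ zeta))
  (G_lip2 : forall zeta, lipschitz_hess L2 (G^~ zeta)).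
Hypotheses (F_var : grad_variance_le QXi F f sf)
  (G_var1 : grad_variance_le QZeta G g sg1) (G_var2 : hess_variance_le QZeta G g sg2).
Variables (r : R) (r_gt0 : 0 < r) (alpha beta gamma : nat -> R) (um1 u0 : triple R dx dy).
Hypotheses (b_gt0 : (0 < b)%N) (tau_gt0 : (0 < tau)%N).

Local Notation cidx := ('I_dx + 'I_dy + 'I_dy)%type.

Let mF c : part_measurable (fun u s => xi_part (F^~ s) u c).
Proof.
apply: (@xi_part_measurable _ _ _ _ _ F _ Lf) => //.
exact: expectation_jointly_measurable f_mean F_diff.
Qed.

Let mG c : part_measurable (fun u s => zeta_part (G^~ s) u c).
Proof.
apply: (@zeta_part_measurable _ _ _ _ _ G _ L1 L2) => //.
by apply: (expectation_jointly_measurable g_mean) => zeta; exact: (G_diff zeta).1.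
Qed.

Let meanF u c : has_mean QXi (fun s => xi_part (F^~ s) u c) (xi_part f u c).
Proof. exact: (@xi_part_has_mean _ _ _ _ _ _ F f f_mean Lf). Qed.

Let meanG u c : has_mean QZeta (fun s => zeta_part (G^~ s) u c) (zeta_part g u c).
Proof. exact: (@zeta_part_has_mean _ _ _ _ _ _ G g g_mean L1 L2). Qed.

Lemma mstate_draws k : (k <= K)%N ->
  [/\ mtriple (fun om => cur_pt (spaba F G r alpha beta gamma um1 u0 D k om)),
      mtriple (fun om => prev_pt (spaba F G r alpha beta gamma um1 u0 D k om)) &
      mtriple (fun om => prev_dir (spaba F G r alpha beta gamma um1 u0 D k om))].
Proof. by move=> kK; apply: mstate_spaba => //; exact: draws_before_all kK. Qed.

Section Iteration.
Variables (k : nat) (kK : (k < K)%N) (rho : R) (rho_gt0 : 0 < rho).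
Local Notation st := (fun om => spaba F G r alpha beta gamma um1 u0 D k om).
Hypothesis rho_bound : forall om, enorm (tz (cur_pt (st om))) <= rho.
Let ik : 'I_K := Ordinal kK.
Let u om := cur_pt (st om).
Let u' om := prev_pt (st om).

(** Per-coordinate variance and mean-square Lipschitz constant of one sampled
    direction, for points with [|z| <= rho]. *)
Definition sample_variance := sf ^+ 2 + (sg1 ^+ 2 + rho ^+ 2 * sg2 ^+ 2).
Definition sample_lip := Lf ^+ 2 + 2 * (L1 ^+ 2 + L2 ^+ 2 * rho ^+ 2).

Let past_state i0 : draw_time i0 = k.+1 ->
  [/\ mtriple (u : past i0 -> _), mtriple (u' : past i0 -> _) &
      mtriple (fun om : past i0 => prev_dir (st om))].
Proof.
move=> ti0; apply: (@mstate_spaba R dx dy dXi dZeta _ Xi Zeta (past i0)) => //.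
exact: draws_before_past (ltnW kK) ti0.
Qed.

Let all_state : [/\ mtriple u, mtriple u' & mtriple (fun om => prev_dir (st om))].
Proof. exact: mstate_draws (ltnW kK). Qed.

Let mexact_xi d1 (T : measurableType d1) (w : T -> triple R dx dy) c :
  mtriple w -> measurable_fun setT (fun t => xi_part f (w t) c).
Proof. by move=> mw; apply: (@measurable_xi_part_exact _ _ _ f Lf). Qed.

Let mexact_zeta d1 (T : measurableType d1) (w : T -> triple R dx dy) c :
  mtriple w -> measurable_fun setT (fun t => zeta_part g (w t) c).
Proof. by move=> mw; apply: (@measurable_zeta_part_exact _ _ _ g L1 L2). Qed.

Let mtriple_fst d1 (T : measurableType d1) d2 (S : measurableType d2)
  (w : T -> triple R dx dy) : mtriple w -> mtriple (fun z : T * S => w z.1).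
Proof. by move=> mw c; exact: (measurableT_comp (mw c) measurable_fst). Qed.

Let sampling_large : (forall i, copy_of P QXi (large_xi D k i)) /\
  (forall j, copy_of P QZeta (large_zeta D k j)).
Proof. by case: sampling => _ _ /(_ k kK). Qed.

Let sampling_small : (forall i, copy_of P QXi (small_xi D k i)) /\
  (forall j, copy_of P QZeta (small_zeta D k j)).
Proof. by case: sampling => _ _ _ /(_ k kK). Qed.

Let large_err c om := tcoord (sampled_dir F G ((large_xi D k)^~ om) ((large_zeta D k)^~ om) (u om)) c
  - tcoord (exact_dir f g (u om)) c.

Let old_err c om := tcoord (prev_dir (st om)) c - tcoord (exact_dir f g (u' om)) c.

Let small_err c om := tcoord (prev_dir (st om)) c
    + tcoord (sampled_dir F G ((small_xi D k)^~ om) ((small_zeta D k)^~ om) (u om)) c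
    - tcoord (sampled_dir F G ((small_xi D k)^~ om) ((small_zeta D k)^~ om) (u' om)) c
  - tcoord (exact_dir f g (u om)) c.

Let scaled_sumB n (a : 'I_n -> R) (m : R) : (0 < n)%N ->
  n%:R^-1 * (\sum_i (a i - m)) = n%:R^-1 * (\sum_i a i) - m.
Proof.
move=> n0; rewrite big_split/= sumrN sumr_const card_ord mulrDr mulrN.
by congr (_ - _); rewrite -[m *+ n]mulr_natl mulrA mulVf ?mul1r// pnatr_eq0 -lt0n.
Qed.

Lemma large_err_bound c :
  (\int[P]_om (large_err c om ^+ 2)%:E <= (tau%:R^-1 * sample_variance)%:E)%E.
Proof.
have E om : large_err c om = 0
   + tau%:R^-1 * (\sum_i (xi_part (F^~ (large_xi D k i om)) (u om) c - xi_part f (u om) c))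
   + tau%:R^-1 * (\sum_i (zeta_part (G^~ (large_zeta D k i om)) (u om) c - zeta_part g (u om) c)).
  rewrite /large_err tcoord_sampled_dir tcoord_exact_dir !scaled_sumB//; ring.
under eq_integral do rewrite E.
have [cx cz] := sampling_large.
have := @two_batch_second_moment k.+1 tau (LargeXi _ ik) (LargeZeta _ ik)
  (large_xi D k) (large_zeta D k) (fun=> 0)
  (fun om s => xi_part (F^~ s) (u om) c - xi_part f (u om) c)
  (fun om s => zeta_part (G^~ s) (u om) c - zeta_part g (u om) c)
  (fun=> sf ^+ 2) (fun=> sg1 ^+ 2 + rho ^+ 2 * sg2 ^+ 2) tau_gt0.
move=> H; apply: (le_trans (H _ _ _ _ _ _ _ _ _ _ _ _ _ _ _ _ _ _)) => //.
- by move=> i j [].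
- by move=> i j [].
- move=> i0 ti0; have [mu _ _] := past_state ti0.
  apply: measurable_funB; first by apply: mF; [exact: mtriple_fst|exact: measurable_snd].
  by apply: mexact_xi; exact: mtriple_fst.
- move=> i0 ti0; have [mu _ _] := past_state ti0.
  apply: measurable_funB; first by apply: mG; [exact: mtriple_fst|exact: measurable_snd].
  by apply: mexact_zeta; exact: mtriple_fst.
- by move=> om; exact: has_mean_centered (meanF (u om) c).
- by move=> om; exact: has_mean_centered (meanG (u om) c).
- by move=> om; exact: xi_part_variance.
- move=> om; apply: zeta_part_variance => //; first exact: rho_bound.
  exact: has_mean_measurable (meanG (u om) c).
rewrite !integral_cst_prob expr0n add0e -EFinD -EFinM lee_fin.
by rewrite /sample_variance.
Qed.

(** The new error is the old one plus the centred minibatch differences, whose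
    second moment is a Lipschitz constant times the squared displacement. *)
Lemma small_err_bound c :
  (\int[P]_om (small_err c om ^+ 2)%:E <= \int[P]_om (old_err c om ^+ 2)%:E
    + (b%:R^-1 * sample_lip)%:E * \int[P]_om (sqdist (u om) (u' om))%:E)%E.
Proof.
pose dx_ om s := xi_part (F^~ s) (u om) c - xi_part (F^~ s) (u' om) c.
pose dz_ om s := zeta_part (G^~ s) (u om) c - zeta_part (G^~ s) (u' om) c.
pose mx om := xi_part f (u om) c - xi_part f (u' om) c.
pose mz om := zeta_part g (u om) c - zeta_part g (u' om) c.
have hx om : has_mean QXi (dx_ om) (mx om) by apply: has_meanB; exact: meanF.
have hz om : has_mean QZeta (dz_ om) (mz om) by apply: has_meanB; exact: meanG.
have sumB n (a a' : 'I_n -> R) m : (0 < n)%N ->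
    n%:R^-1 * (\sum_i (a i - a' i - m)) = n%:R^-1 * (\sum_i a i) - n%:R^-1 * (\sum_i a' i) - m.
  by move=> n0; rewrite scaled_sumB// -mulrBr -sumrB.
have E om : small_err c om = old_err c om
   + b%:R^-1 * (\sum_i (dx_ om (small_xi D k i om) - mx om))
   + b%:R^-1 * (\sum_i (dz_ om (small_zeta D k i om) - mz om)).
  rewrite /small_err /old_err !tcoord_sampled_dir !tcoord_exact_dir /dx_ /dz_ !sumB// /mx /mz.
  move: (xi_part f (u om) c) (xi_part f (u' om) c) (zeta_part g (u om) c) (zeta_part g (u' om) c).
  by move: (\sum_i _) (\sum_i _) (\sum_i _) (\sum_i _); intros; ring.
under eq_integral do rewrite E.
have [cx cz] := sampling_small; have [mu mu' mv] := all_state.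
have msq := measurable_sqdist mu mu'.
have := @two_batch_second_moment k.+1 b (SmallXi _ ik) (SmallZeta _ ik)
  (small_xi D k) (small_zeta D k) (old_err c)
  (fun om s => dx_ om s - mx om) (fun om s => dz_ om s - mz om)
  (fun om => Lf ^+ 2 * sqdist (u om) (u' om))
  (fun om => 2 * (L1 ^+ 2 + L2 ^+ 2 * rho ^+ 2) * sqdist (u om) (u' om)) b_gt0.
move=> H; apply: (le_trans (H _ _ _ _ _ _ _ _ _ _ _ _ _ _ _ _ _ _)) => //.
- by move=> i j [].
- by move=> i j [].
- move=> i0 ti0; have [pu pu' pv] := past_state ti0.
  apply: measurable_funB; first exact: pv.
  exact: (mtriple_exact_dir Lf0 L10 L20 f_diff g_diff f_lip g_lip1 g_lip2 pu' c).
- move=> i0 ti0; have [pu pu' pv] := past_state ti0.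
  apply: measurable_funB; apply: measurable_funB.
  + by apply: mF; [exact: mtriple_fst|exact: measurable_snd].
  + by apply: mF; [exact: mtriple_fst|exact: measurable_snd].
  + by apply: mexact_xi; exact: mtriple_fst.
  + by apply: mexact_xi; exact: mtriple_fst.
- move=> i0 ti0; have [pu pu' pv] := past_state ti0.
  apply: measurable_funB; apply: measurable_funB.
  + by apply: mG; [exact: mtriple_fst|exact: measurable_snd].
  + by apply: mG; [exact: mtriple_fst|exact: measurable_snd].
  + by apply: mexact_zeta; exact: mtriple_fst.
  + by apply: mexact_zeta; exact: mtriple_fst.
- by move=> om; exact: has_mean_centered (hx om).
- by move=> om; exact: has_mean_centered (hz om).
- move=> om; apply: (centered_second_moment (hx om)).
  rewrite -(integral_cst_prob QXi); apply: le_ge0_integral => s; rewrite lee_fin ?sqr_ge0//.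
  exact: (@xi_part_lip R dx dy Lf (F^~ s) (u om) (u' om) c Lf0 (F_lip s)).
- move=> om; apply: (centered_second_moment (hz om)).
  rewrite -(integral_cst_prob QZeta); apply: le_ge0_integral => s; rewrite lee_fin ?sqr_ge0//.
  exact: (@zeta_part_lip R dx dy L1 L2 rho (G^~ s) (u om) (u' om) c L10 L20
    (G_diff s) (G_lip1 s) (G_lip2 s) (rho_bound om)).
- exact: measurable_fun_scale.
- exact: measurable_fun_scale.
have l20 : 0 <= 2 * (L1 ^+ 2 + L2 ^+ 2 * rho ^+ 2).
  by rewrite mulr_ge0// addr_ge0 ?sqr_ge0// mulr_ge0 ?sqr_ge0.
have sc a : 0 <= a -> (\int[P]_om (a * sqdist (u om) (u' om))%:E =
    a%:E * \int[P]_om (sqdist (u om) (u' om))%:E)%E.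
  move=> a0; under eq_integral do rewrite EFinM.
  rewrite ge0_integralZl//.
  - exact/measurable_EFinP.
  - by move=> om _; rewrite lee_fin sqdist_ge0.
rewrite !sc ?sqr_ge0// -ge0_muleDl ?lee_fin ?sqr_ge0// -EFinD muleA -EFinM.
by rewrite leeD2l.
Qed.

Let dir_err c om := tcoord (spaba_dir F G D k om (st om)) c - tcoord (exact_dir f g (u om)) c.

(** The coin is integrated out with all the other draws frozen, which turns the
    error into the mixture of the two preceding bounds. Working coordinate by
    coordinate covers every joint law of the three coins. *)
Lemma dir_err_bound c :
  (\int[P]_om (dir_err c om ^+ 2)%:E <= (p * (tau%:R^-1 * sample_variance))%:E +
    (1 - p)%:E * (\int[P]_om (old_err c om ^+ 2)%:E
    + (b%:R^-1 * sample_lip)%:E * \int[P]_om (sqdist (u om) (u' om))%:E))%E.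
Proof.
have [pu pu' pv] := @past_state (Coin _ _ ik) erefl.
have mexact := mtriple_exact_dir Lf0 L10 L20 f_diff g_diff f_lip g_lip1 g_lip2 pu c.
have mlx i : measurable_fun setT (large_xi D k i : past (Coin _ _ ik) -> Xi).
  exact: (@past_measurable (LargeXi _ ik i)).
have mlz i : measurable_fun setT (large_zeta D k i : past (Coin _ _ ik) -> Zeta).
  exact: (@past_measurable (LargeZeta _ ik i)).
have msx i : measurable_fun setT (small_xi D k i : past (Coin _ _ ik) -> Xi).
  exact: (@past_measurable (SmallXi _ ik i)).
have msz i : measurable_fun setT (small_zeta D k i : past (Coin _ _ ik) -> Zeta).
  exact: (@past_measurable (SmallZeta _ ik i)).
have mL : measurable_fun setT (large_err c : past (Coin _ _ ik) -> R).
  apply: measurable_funB => //.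
  exact: (mtriple_sampled_dir mF mG pu mlx mlz c).
have mS : measurable_fun setT (small_err c : past (Coin _ _ ik) -> R).
  apply: measurable_funB => //; apply: measurable_funB.
    apply: measurable_funD; first exact: pv.
    exact: (mtriple_sampled_dir mF mG pu msx msz c).
  exact: (mtriple_sampled_dir mF mG pu' msx msz c).
have [mcoin P1 P2 P3] : [/\ measurable_fun setT (coin D k),
    P [set om | (coin D k om).1.1] = p%:E, P [set om | (coin D k om).1.2] = p%:E &
    P [set om | (coin D k om).2] = p%:E] by case: sampling => _ /(_ k kK).
pose Y om := coin_at (dx := dx) (dy := dy) (coin D k om) c.
have mY : measurable_fun setT Y := measurableT_comp (measurable_coin_at c) mcoin.
pose Ym : {mfun Om >-> bool} := HB.pack Y (isMeasurableFun.Build _ _ _ _ Y mY).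
pose Q : probability bool R := distribution P Ym.
have Qp : Q [set true] = p%:E.
  have -> : Q [set true] = P [set om | Y om].
    by rewrite /Q /distribution /pushforward/=; congr (P _); apply/seteqP; split => om /=.
  by rewrite /Y; case: (c) => [[i|i]|i].
have Edir om : (dir_err c om ^+ 2)%:E =
   (fun z : past (Coin _ _ ik) * bool =>
     (if z.2 then large_err c z.1 ^+ 2 else small_err c z.1 ^+ 2)%:E) (om, Y om).
  rewrite /dir_err tcoord_spaba_dir /= -/(Y om); by case: (Y om).
under eq_integral do rewrite Edir.
rewrite (@integral_freeze _ _ _ _ _ P Q Y (others E (Coin _ _ ik)) (@past_events _) mY _
  (fun z : past (Coin _ _ ik) * bool =>
     (if z.2 then large_err c z.1 ^+ 2 else small_err c z.1 ^+ 2)%:E)).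
- have IC om : (\int[Q]_s (if s then large_err c om ^+ 2 else small_err c om ^+ 2)%:E =
    (p * large_err c om ^+ 2 + (1 - p) * small_err c om ^+ 2)%:E)%E.
    exact: integral_coin Qp _ _.
  rewrite /=; under eq_integral do rewrite IC.
  have mL' := measurable_fun_sub (@past_events _) mL.
  have mS' := measurable_fun_sub (@past_events _) mS.
  have p0 : 0 <= p by case/andP: p01 => /ltW.
  have q0 : 0 <= 1 - p by rewrite subr_ge0; case/andP: p01.
  under eq_integral do rewrite EFinD !(EFinM p) (EFinM (1 - p)).
  rewrite ge0_integralD//; last 4 first.
  + by move=> om _; rewrite mule_ge0// lee_fin ?sqr_ge0.
  + by apply: measurable_funeM; exact/measurable_EFinP/measurable_funX.
  + by move=> om _; rewrite mule_ge0// lee_fin ?sqr_ge0.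
  + by apply: measurable_funeM; exact/measurable_EFinP/measurable_funX.
  rewrite !ge0_integralZl//; try by [rewrite lee_fin|
    exact/measurable_EFinP/measurable_funX|move=> om _; rewrite lee_fin sqr_ge0].
  apply: leeD.
    by rewrite EFinM; apply: lee_wpmul2l; [rewrite lee_fin|exact: large_err_bound].
  by apply: lee_wpmul2l; [rewrite lee_fin|exact: small_err_bound].
- move=> A B sA mB; rewrite (other_draws_indep sampling sA)//.
  exists (coin_at (dx := dx) (dy := dy) ^~ c @^-1` B); last by rewrite setTI.
  by rewrite -[X in measurable X]setTI; exact: measurable_coin_at.
- by move=> z; rewrite lee_fin; case: ifP => _; rewrite sqr_ge0.
- apply/measurable_EFinP; apply: measurable_fun_ifT; first exact: measurable_snd.
    by apply: measurable_funX; exact: (measurableT_comp mL measurable_fst).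
  by apply: measurable_funX; exact: (measurableT_comp mS measurable_fst).
Qed.

Let sum_integral (v w : Om -> triple R dx dy) : mtriple v -> mtriple w ->
  (\int[P]_om (sqdist (v om) (w om))%:E =
   \sum_c \int[P]_om ((tcoord (v om) c - tcoord (w om) c) ^+ 2)%:E)%E.
Proof.
move=> mv mw; rewrite -ge0_integral_sum//.
- by apply: eq_integral => om _; rewrite sqdistE sumEFin.
- by move=> c; apply/measurable_EFinP/measurable_funX/measurable_funB; [exact: mv|exact: mw].
- by move=> c om _; rewrite lee_fin sqr_ge0.
Qed.

(** One refresh of the estimator: with probability [p] its error is that of a
    batch of size [tau]; otherwise the previous error is kept and the noise of
    a batch of size [b] of differences is added. *)
Lemma estimator_step :
  (\int[P]_om (sqdist (spaba_dir F G D k om (st om)) (exact_dir f g (u om)))%:E <=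
   (#|{: cidx}|%:R * (p * (tau%:R^-1 * sample_variance)))%:E +
    (1 - p)%:E * (\int[P]_om (sqdist (prev_dir (st om)) (exact_dir f g (u' om)))%:E
    + (#|{: cidx}|%:R * (b%:R^-1 * sample_lip))%:E *
      \int[P]_om (sqdist (u om) (u' om))%:E))%E.
Proof.
have [mu mu' mv] := all_state.
have [_ _ mv'] := mstate_draws kK.
rewrite (sum_integral mv'); last first.
  exact: (mtriple_exact_dir Lf0 L10 L20 f_diff g_diff f_lip g_lip1 g_lip2 mu).
rewrite (sum_integral mv); last first.
  exact: (mtriple_exact_dir Lf0 L10 L20 f_diff g_diff f_lip g_lip1 g_lip2 mu').
apply: (le_trans (lee_sum _ (fun c _ => dir_err_bound c))).
have q0 : (0 <= (1 - p)%:E)%E by rewrite lee_fin subr_ge0; case/andP: p01.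
set I := (\int[P]_om (sqdist _ _)%:E)%E.
have I0 : (0 <= I)%E by apply: integral_ge0 => om _; rewrite lee_fin sqdist_ge0.
have sl0 : 0 <= b%:R^-1 * sample_lip.
  rewrite mulr_ge0// addr_ge0 ?sqr_ge0// mulr_ge0// addr_ge0 ?sqr_ge0//.
  by rewrite mulr_ge0 ?sqr_ge0.
have X0 c : (0 <= \int[P]_om (old_err c om ^+ 2)%:E)%E.
  by apply: integral_ge0 => om _; rewrite lee_fin sqr_ge0.
have sI0 : (0 <= (b%:R^-1 * sample_lip)%:E * I)%E by rewrite mule_ge0.
rewrite big_split/= -ge0_sume_distrr; last by move=> c _; exact: adde_ge0.
rewrite big_split/= sumEFin sumr_const -[_ *+ #|_|]mulr_natl.
suff -> : ((#|{: cidx}|%:R * (b%:R^-1 * sample_lip))%:E * I =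
  \sum_(c : cidx) (b%:R^-1 * sample_lip)%:E * I)%E by [].
have <- : (\sum_(c : cidx) (b%:R^-1 * sample_lip)%:E =
  (#|{: cidx}|%:R * (b%:R^-1 * sample_lip))%:E)%E.
  by rewrite sumEFin sumr_const -[_ *+ #|_|]mulr_natl.
by rewrite ge0_sume_distrl.
Qed.

End Iteration.
End Estimator.

(** * Telescoping the Lyapunov function *)

Section Balances.
Context {R : realType}.

(** The drift weight is proportional to [ab * q^2]; both [ab * q] and [al * q]
    stay below [c], whence one power of [al] survives. *)
Lemma drift_coefficient (al ab q c A : R) : 0 < al -> 0 <= q -> 0 <= A ->
  0 <= ab * q <= c -> 0 <= al * q <= c -> A * c ^+ 2 <= 8^-1 ->
  A * (ab * q ^+ 2) * al ^+ 2 <= al / 8.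
Proof.
move=> al0 q0 A0 /andP[h1 h2] /andP[h3 h4] Ac.
have H : (ab * q) * (al * q) <= c ^+ 2 by rewrite expr2; exact: ler_pM.
have {}H := le_trans (ler_wpM2l A0 H) Ac.
have {}H := ler_wpM2l (ltW al0) H.
have -> : A * (ab * q ^+ 2) * al ^+ 2 = al * (A * (ab * q * (al * q))) by ring.
by [].
Qed.

(** The drift, weighted by [kap], is paid for by an eighth of each quantity that
    the potential loses and by one more unit of estimator error. *)
Lemma path_balance (al ab M N kap V V' gh vx ye ze er sq J : R) :
  0 < al -> al <= ab -> 0 <= M -> 0 <= kap -> kap * N * al ^+ 2 <= al / 8 ->
  0 <= vx -> 0 <= ye -> 0 <= ze -> 0 <= er ->
  V' + al / 2 * gh + al * (8^-1 * vx + ye + ze) <= V + al * M * er ->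
  sq <= al ^+ 2 * N * (vx + ye + ze + er) + 2 * J ->
  V' + al / 2 * gh + kap * sq <= V + (M + 1) * ab * er + kap * (2 * J).
Proof.
move=> al0 alab M0 kap0 kN vx0 ye0 ze0 er0 H1 H2.
have {}H2 := ler_wpM2l kap0 H2.
have S0 : 0 <= vx + ye + ze + er by rewrite !addr_ge0.
have K1 := ler_wpM2r S0 kN.
have E1 : al * M * er <= ab * M * er.
  by rewrite ler_wpM2r// ler_wpM2r.
have E2 : al * er <= ab * er by rewrite ler_wpM2r.
have Y0 := mulr_ge0 (ltW al0) ye0; have Z0 := mulr_ge0 (ltW al0) ze0.
have R0 := mulr_ge0 (ltW al0) er0.
have {}H2 : kap * sq <= al / 8 * (vx + ye + ze + er) + kap * (2 * J).
  apply: (le_trans H2); rewrite mulrDr lerD2r; apply: le_trans K1.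
  by rewrite le_eqVlt; apply/orP; left; apply/eqP; ring.
move: (kap * sq) (kap * (2 * J)) H2 => t1 t2 H2.
by lra.
Qed.

Local Open Scope ereal_scope.

Lemma ge0_le_real (x : \bar R) (r : R) : 0 <= x -> x <= r%:E ->
  exists2 y : R, (0 <= y)%R & x = y%:E.
Proof. by case: x => [y| |]//=; rewrite lee_fin => y0 _; exists y. Qed.

(** The four inequalities are added in the extended reals; each quantity turns
    out to be finite before anything is cancelled. *)
Lemma telescope_step (S V V' P P' g I : \bar R) (w c kap a q l B j : R) :
  0 <= S -> 0 <= V -> 0 <= V' -> 0 <= P -> 0 <= P' -> 0 <= g -> 0 <= I ->
  (0 < w)%R -> (0 <= kap)%R -> (0 <= a)%R -> (0 <= q)%R -> (0 <= l)%R ->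
  (w * q = w - c)%R -> (w * q * l = kap)%R ->
  S + V + w%:E * P <= B%:E ->
  V' + g + kap%:E * I <= V + c%:E * P + j%:E ->
  P' <= a%:E + q%:E * (P + l%:E * I) ->
  S + g + V' + w%:E * P' <= (B + w * a + j)%:E.
Proof.
move=> S0 V0 V'0 P0 P'0 g0 I0 w0 kap0 a0 q0 l0 wq wql H1 H2 H3.
have wP0 : 0 <= w%:E * P by rewrite mule_ge0// lee_fin ltW.
have [s s0 Es] : exists2 y : R, (0 <= y)%R & S = y%:E.
  apply: ge0_le_real S0 _; apply: le_trans H1; rewrite -addeA leeDl//.
  exact: adde_ge0.
have [v v0 Ev] : exists2 y : R, (0 <= y)%R & V = y%:E.
  apply: ge0_le_real V0 _; apply: le_trans H1; rewrite -addeA addeCA leeDl//.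
  exact: adde_ge0.
have [p p0 Ep] : exists2 y : R, (0 <= y)%R & P = y%:E.
  move: H1 P0; case: (P) => [y| |]//=; first by rewrite lee_fin => _ y0; exists y.
  by rewrite Es Ev gt0_muley ?lte_fin// addey// leye_eq.
have kI0 : 0 <= kap%:E * I by rewrite mule_ge0.
rewrite Ev Ep -EFinM -!EFinD in H2.
have [v' v'0 Ev'] : exists2 y : R, (0 <= y)%R & V' = y%:E.
  apply: ge0_le_real V'0 _; apply: le_trans H2; rewrite -addeA leeDl//.
  exact: adde_ge0.
have [h h0 Eh] : exists2 y : R, (0 <= y)%R & g = y%:E.
  apply: ge0_le_real g0 _; apply: le_trans H2; rewrite -addeA addeCA leeDl//.
  exact: adde_ge0.
have [t t0 Et] : exists2 y : R, (0 <= y)%R & kap%:E * I = y%:E.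
  apply: ge0_le_real kI0 _; apply: le_trans H2; rewrite leeDr//.
  exact: adde_ge0.
have wP' : w%:E * P' <= (w * a)%:E + (((w - c) * p)%:E + kap%:E * I).
  apply: (le_trans (lee_wpmul2l _ H3)); first by rewrite lee_fin ltW.
  have lI0 : 0 <= l%:E * I by rewrite mule_ge0.
  have qlI0 : 0 <= q%:E * (P + l%:E * I) by rewrite mule_ge0// adde_ge0.
  rewrite ge0_muleDr//= ge0_muleDr//= ge0_muleDr//; last 2 first.
  - by rewrite mule_ge0.
  - by rewrite mule_ge0.
  by rewrite !muleA -!EFinM wql wq Ep -EFinM.
rewrite Et -!EFinD in wP'.
rewrite Es Eh Ev' -!EFinD.
have [w' w'0 Ew'] : exists2 y : R, (0 <= y)%R & w%:E * P' = y%:E.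
  by apply: ge0_le_real wP'; rewrite mule_ge0// lee_fin ltW.
rewrite Ew' -EFinD lee_fin; rewrite Ew' lee_fin in wP'.
rewrite Ev' Eh Et -!EFinD lee_fin in H2.
by rewrite Es Ev Ep -EFinM -!EFinD lee_fin in H1; lra.
Qed.

(** At the last step the estimator error is not refreshed: the weight [w]
    dominates the coefficient [c] of the error that enters the potential. *)
Lemma telescope_last (S V V' P g I : \bar R) (w c kap B j : R) :
  0 <= S -> 0 <= V -> 0 <= V' -> 0 <= P -> 0 <= g -> 0 <= I ->
  (0 < w)%R -> (0 <= kap)%R -> (c <= w)%R ->
  S + V + w%:E * P <= B%:E ->
  V' + g + kap%:E * I <= V + c%:E * P + j%:E ->
  S + g <= (B + j)%:E.
Proof.
move=> S0 V0 V'0 P0 g0 I0 w0 kap0 cw H1 H2.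
have kI0 : 0 <= kap%:E * I by rewrite mule_ge0.
have H3 : g <= V + w%:E * P + j%:E.
  apply: (@le_trans _ _ (V' + g + kap%:E * I)).
    by rewrite addeAC leeDr// adde_ge0.
  by apply: (le_trans H2); rewrite leeD2r// leeD2l// lee_wpmul2r// lee_fin.
apply: (le_trans (leeD2l _ H3)); rewrite EFinD !addeA leeD2r//.
Qed.

End Balances.

Section StateFunctions.
Context {R : realType} {dx dy : nat}.
Variables (f g : 'cV[R]_(dx + dy) -> R) (Lf Cf L1 L2 mu : R).
Hypotheses (Lf_gt0 : 0 < Lf) (Cf_gt0 : 0 < Cf) (L1_gt0 : 0 < L1)
  (L2_gt0 : 0 < L2) (mu_gt0 : 0 < mu).
Hypotheses (f_diff : everywhere_differentiable f) (g_diff : twice_differentiable g).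
Hypotheses (f_lip : lipschitz_grad Lf f) (g_lip1 : lipschitz_grad L1 g)
  (g_lip2 : lipschitz_hess L2 g).
Hypothesis g_sc : forall x, strongly_convex mu (fun y : 'cV[R]_dy => g (col_mx x y)).
Hypothesis f_bound : forall x, enorm (grad2 f x (lower_sol g x)) <= Cf.
Context {d : measure_display} {T : measurableType d}.
Variable u : T -> triple R dx dy.
Hypothesis mu_ : mtriple u.

(** The point which [u] tracks, so that [yerr] and [zerr] measure the distance
    to it in the last two blocks. *)
Definition target (v : triple R dx dy) : triple R dx dy :=
  Triple (tx v) (lower_sol g (tx v)) (zstar f g (tx v)).

Lemma mcoords_lipschitz m n (L : R) (h : 'cV[R]_m -> 'cV[R]_n) (w : T -> 'cV[R]_m) :
  (forall x x', enorm (h x - h x') <= L * enorm (x - x')) -> mcoords w ->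
  mcoords (fun t => h (w t)).
Proof.
move=> Lh mw i; apply: (@econtinuous_measurable _ _ (fun x => h x i 0)) mw.
apply: (@lipschitz_econtinuous _ _ _ L) => x x'; rewrite -coordB.
exact: le_trans (ler_enorm_coord _ i) (Lh x x').
Qed.

Lemma mtriple_target : mtriple (fun t => target (u t)).
Proof.
have mx : mcoords (fun t => tx (u t)) by move=> i; exact: (mu_ (inl (inl i))).
case=> [[i|i]|i] /=; first exact: mx.
- apply: mcoords_lipschitz mx i => x x'.
  exact: (lower_sol_lip L1_gt0 mu_gt0 g_diff g_lip1 g_sc x x').
- apply: mcoords_lipschitz mx i => x x'.
  exact: (zstar_lip Lf_gt0 L1_gt0 L2_gt0 mu_gt0 g_diff f_lip g_lip1 g_lip2 g_sc f_bound x x').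
Qed.

Lemma measurable_enorm_sq n (w : T -> 'cV[R]_n) : mcoords w ->
  measurable_fun setT (fun t => enorm (w t) ^+ 2).
Proof.
move=> mw; rewrite (_ : (fun t => _) = (fun t => \sum_i w t i 0 ^+ 2)).
  by apply: measurable_fun_big => i; apply: measurable_funX; exact: mw.
by apply/funext => t; rewrite enorm_sq; apply: eq_bigr => i _; rewrite expr2.
Qed.

Lemma measurable_hypergrad_sq :
  measurable_fun setT (fun t => enorm (hypergrad f g (tx (u t))) ^+ 2).
Proof.
apply: measurable_enorm_sq => i.
have := mtriple_exact_dir (ltW Lf_gt0) (ltW L1_gt0) (ltW L2_gt0) f_diff g_diff f_lip
  g_lip1 g_lip2 mtriple_target (inl (inl i)).
by [].
Qed.

Lemma measurable_potential :
  measurable_fun setT (fun t => potential f g Lf Cf L1 L2 mu (u t)).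
Proof.
have mt := mtriple_target.
apply: measurable_funD; first apply: measurable_funD.
- apply: (@econtinuous_measurable _ _ f _ T (fun t => pt (target (u t)))).
    by apply: continuous_econtinuous => w; exact/differentiable_continuous/f_diff.
  exact: mcoords_pt.
- apply/measurable_fun_scale/measurable_enorm_sq => i.
  rewrite (_ : (fun t => _) = (fun t => tcoord (u t) (inl (inr i)) - tcoord (target (u t)) (inl (inr i)))).
    by apply: measurable_funB; [exact: mu_|exact: mt].
  by apply/funext => t; rewrite coordB.
- apply/measurable_fun_scale/measurable_enorm_sq => i.
  rewrite (_ : (fun t => _) = (fun t => tcoord (u t) (inr i) - tcoord (target (u t)) (inr i))).
    by apply: measurable_funB; [exact: mu_|exact: mt].
  by apply/funext => t; rewrite coordB.
Qed.

End StateFunctions.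

Lemma subtract_bound (R : realType) (a b c x y m : R) :
  a + b + c <= x + y -> a - m + b + c <= x - m + y.
Proof. by move=> ?; lra. Qed.

Lemma integrate_balance (R : realType) (d : measure_display) (Om : measurableType d)
    (P : probability Om R) (V' V gh sq er : Om -> R) (a kap c j : R) :
  0 <= a -> 0 <= kap -> 0 <= c -> 0 <= j ->
  (forall om, 0 <= V' om) -> (forall om, 0 <= V om) -> (forall om, 0 <= gh om) ->
  (forall om, 0 <= sq om) -> (forall om, 0 <= er om) ->
  measurable_fun setT V' -> measurable_fun setT V -> measurable_fun setT gh ->
  measurable_fun setT sq -> measurable_fun setT er ->
  (forall om, V' om + a * gh om + kap * sq om <= V om + c * er om + j) ->
  (\int[P]_om (V' om)%:E + a%:E * \int[P]_om (gh om)%:E + kap%:E * \int[P]_om (sq om)%:E <=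
   \int[P]_om (V om)%:E + c%:E * \int[P]_om (er om)%:E + j%:E)%E.
Proof.
move=> a0 k0 c0 j0 V'0 V0 g0 s0 e0 mV' mV mg ms me H.
have sc (t : R) (h : Om -> R) : 0 <= t -> (forall om, 0 <= h om) -> measurable_fun setT h ->
    (t%:E * \int[P]_om (h om)%:E = \int[P]_om (t * h om)%:E)%E.
  move=> t0 h0 mh; under [RHS]eq_integral do rewrite EFinM.
  rewrite ge0_integralZl//; first exact/measurable_EFinP.
  by move=> om _; rewrite lee_fin.
have ad (h1 h2 : Om -> R) : (forall om, 0 <= h1 om) -> (forall om, 0 <= h2 om) ->
    measurable_fun setT h1 -> measurable_fun setT h2 ->
    (\int[P]_om (h1 om)%:E + \int[P]_om (h2 om)%:E = \int[P]_om (h1 om + h2 om)%:E)%E.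
  move=> h10 h20 m1 m2; under [RHS]eq_integral do rewrite EFinD.
  by rewrite ge0_integralD//; try exact/measurable_EFinP; move=> om _; rewrite lee_fin.
have ag0 om : 0 <= a * gh om by exact: mulr_ge0.
have ks0 om : 0 <= kap * sq om by exact: mulr_ge0.
have ce0 om : 0 <= c * er om by exact: mulr_ge0.
have mag : measurable_fun setT (fun om => a * gh om) by exact: measurable_fun_scale.
have mks : measurable_fun setT (fun om => kap * sq om) by exact: measurable_fun_scale.
have mce : measurable_fun setT (fun om => c * er om) by exact: measurable_fun_scale.
have m1 : measurable_fun setT (fun om => V' om + a * gh om) by exact: measurable_funD.
have m2 : measurable_fun setT (fun om => V om + c * er om) by exact: measurable_funD.
rewrite (sc a gh)// (sc kap sq)// (sc c er)// -(integral_cst_prob P j).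
rewrite (ad V' _ V'0 ag0 mV' mag) (ad _ _ _ ks0 m1 mks); last first.
  by move=> om; exact: addr_ge0.
rewrite (ad V _ V0 ce0 mV mce) (ad _ (cst j) _ _ m2)//; last first.
  by move=> om; exact: addr_ge0.
apply: le_ge0_integral => om; rewrite lee_fin; last exact: H.
by apply: addr_ge0 => //; exact: addr_ge0.
Qed.

(** The first refresh starts from arbitrary data, whose error may even be infinite
    when [p = 1]; it is compared with the initial error, where the squared
    displacement has coefficient [1 / b] instead of [l / b]. *)
Lemma first_error_bound (R : realType) (E0 E1 : \bar R) (a p l b s J B : R) :
  0 < p <= 1 -> 0 <= l -> 0 < b -> 0 <= s -> 0 <= J -> (0 <= E0)%E ->
  (E1 <= (p * a)%:E + (1 - p)%:E * (E0 + (l / b)%:E * s%:E))%E ->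
  (((1 - p) / p)%:E * (E0 + ((s + J) / b)%:E) <= B%:E)%E ->
  (p^-1%:E * E1 <= (a + (1 + l) * B)%:E)%E.
Proof.
move=> /andP[p0 p1] l0 b0 s0 J0 E00 H1 H2.
have q0 : 0 <= 1 - p by rewrite subr_ge0.
have pV : 0 < p^-1 by rewrite invr_gt0.
have pE : p^-1 * p = 1 by rewrite mulVf// gt_eqF.
have qp0 : 0 <= (1 - p) / p by rewrite divr_ge0// ltW.
have B0 : 0 <= B.
  rewrite -lee_fin; apply: le_trans H2; apply: mule_ge0; rewrite ?lee_fin//.
  by apply: adde_ge0 => //; rewrite lee_fin divr_ge0 ?addr_ge0// ltW.
have {}H1 := lee_wpmul2l (ltW pV : (0 <= p^-1%:E)%E) H1.
apply: (le_trans H1).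
case: E0 E00 H2 {H1} => [y| |]//=; last first.
  move=> _; have [p_eq1|pn1] := eqVneq p 1.
    move=> _; rewrite p_eq1 subrr mul0e adde0 invr1 mul1e mul1r lee_fin lerDl.
    by rewrite mulr_ge0// addr_ge0.
  rewrite addye// gt0_muley ?leye_eq//.
  by rewrite lte_fin divr_gt0// subr_gt0 lt_neqAle pn1.
rewrite lee_fin => y0; rewrite -?EFinM -?EFinD -?EFinM -?EFinD -?EFinM !lee_fin => H2.
have s1 : 0 <= s / b by rewrite divr_ge0// ltW.
have j1 : 0 <= J / b by rewrite divr_ge0// ltW.
have -> : p^-1 * (p * a + (1 - p) * (y + l / b * s)) =
    a + (1 - p) / p * (y + l * (s / b)).
  by rewrite mulrDr (mulrA _ p) pE mul1r; congr (_ + _); ring.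
rewrite lerD2l; apply: le_trans (ler_wpM2l _ H2); last by rewrite addr_ge0.
rewrite [leRHS]mulrCA; apply: ler_wpM2l => //.
rewrite (mulrDl s J); move: (s / b) (J / b) s1 j1 => t1 t2 h1 h2.
have := mulr_ge0 l0 h2; have := mulr_ge0 l0 y0; have := mulr_ge0 l0 h1.
lra.
Qed.

(** Division of the telescoped bound by [K theta ab / 2]. As [1 / ab] is
    [Q / c], the initial potential [V0] gives [Q / K]; the initial error
    [Lam (Q + 1 / (p t))] gives the first two terms of the rate; the variance
    [S0 / t] of the first step is at most the second one because [p <= 1]. *)
Lemma rate_arithmetic (R : realType) (K p t c Q ab theta V0 m S0 S1 A Vr Lam k1 jmp : R) :
  0 < K -> 0 < p <= 1 -> 0 < t -> 0 < c -> 0 < Q -> 0 < theta -> 0 <= V0 -> 0 <= m ->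
  0 <= S0 -> 0 <= S1 -> 0 <= A -> 0 <= Vr -> 0 <= k1 <= K ->
  ab = c / Q -> jmp <= 2 * m * Vr * ab * (Lam * (Q + (p * t)^-1)) ->
  K^-1 * (2 / (theta * ab) *
    (V0 + m * ab * (S0 / t + A * (Lam * (Q + (p * t)^-1))) + k1 * (m * ab * (S1 / t)) + jmp))
  <= (2 / theta * (V0 / c + m * (S0 + (A + 2 * Vr) * `|Lam| + S1)) + 1) *
    (Q / K + (K * p * t)^-1 + 1 / t).
Proof.
move=> K0 /andP[p0 p1] t0 c0 Q0 th0 V00 m0 S00 S10 A0 Vr0 /andP[k0 k1K] abE jb.
have ab0 : 0 < ab by rewrite abE divr_gt0.
have n1 : K != 0 by rewrite gt_eqF.
have n2 : p != 0 by rewrite gt_eqF.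
have n3 : t != 0 by rewrite gt_eqF.
have n4 : c != 0 by rewrite gt_eqF.
have n5 : Q != 0 by rewrite gt_eqF.
have n6 : theta != 0 by rewrite gt_eqF.
have n7 : ab != 0 by rewrite gt_eqF.
set X := Q / K; set Y := (K * p * t)^-1; set Z := 1 / t.
have X0 : 0 <= X by rewrite divr_ge0// ltW.
have Y0 : 0 <= Y by rewrite invr_ge0 !mulr_ge0// ltW.
have Z0 : 0 <= Z by rewrite divr_ge0// ltW.
pose rest := V0 / c * X + m * (S0 * (K * t)^-1 + (A + 2 * Vr) * (Lam * (X + Y)) + k1 / K * (S1 * Z)).
have -> : (2 / theta * (V0 / c + m * (S0 + (A + 2 * Vr) * `|Lam| + S1)) + 1) * (X + Y + Z) =
    2 / theta * ((V0 / c + m * (S0 + (A + 2 * Vr) * `|Lam| + S1)) * (X + Y + Z)) + (X + Y + Z).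
  by ring.
have XYZ0 : 0 <= X + Y + Z by rewrite !addr_ge0.
have th2 : 0 <= 2 / theta by rewrite divr_ge0// ltW.
apply: (@le_trans _ _ (2 / theta * rest)).
  have -> : 2 / theta * rest = K^-1 * (2 / (theta * ab) * (V0 +
      m * ab * (S0 / t + A * (Lam * (Q + (p * t)^-1))) + k1 * (m * ab * (S1 / t)) +
      2 * m * Vr * ab * (Lam * (Q + (p * t)^-1)))).
    by rewrite /rest /X /Y /Z abE; field; rewrite n1 n2 n3 n4 n5 n6.
  apply: ler_wpM2l; first by rewrite invr_ge0 ltW.
  apply: ler_wpM2l; first by rewrite divr_ge0// ltW// mulr_gt0.
  by rewrite lerD2l.
apply: (@le_trans _ _ (2 / theta * ((V0 / c + m * (S0 + (A + 2 * Vr) * `|Lam| + S1)) * (X + Y + Z)))); last first.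
  by rewrite lerDl.
apply: ler_wpM2l => //.
have KtY : (K * t)^-1 <= Y.
  rewrite /Y; rewrite lef_pV2 ?posrE ?mulr_gt0//.
  by rewrite mulrAC ler_piMr// mulr_ge0// ltW.
have kK : k1 / K <= 1 by rewrite ler_pdivrMr// mul1r.
have LX : Lam * (X + Y) <= `|Lam| * (X + Y) by rewrite ler_wpM2r ?ler_norm// addr_ge0.
have Vc : 0 <= V0 / c by rewrite divr_ge0// ltW.
have e1 : V0 / c * X <= V0 / c * (X + Y + Z) by rewrite ler_wpM2l// -addrA lerDl addr_ge0.
have e2 : S0 * (K * t)^-1 <= S0 * (X + Y + Z).
  by rewrite ler_wpM2l// (le_trans KtY)// addrAC lerDr addr_ge0.
have e3 : (A + 2 * Vr) * (Lam * (X + Y)) <= (A + 2 * Vr) * `|Lam| * (X + Y + Z).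
  rewrite -mulrA ler_wpM2l ?addr_ge0 ?mulr_ge0//; apply: (le_trans LX).
  by rewrite ler_wpM2l// lerDl.
have e4 : k1 / K * (S1 * Z) <= S1 * (X + Y + Z).
  apply: (@le_trans _ _ (1 * (S1 * Z))); first by rewrite ler_wpM2r// mulr_ge0.
  by rewrite mul1r ler_wpM2l// lerDr addr_ge0.
rewrite /rest [leRHS]mulrDl -(mulrA m (S0 + _ + S1)); apply: lerD => //.
apply: ler_wpM2l => //; rewrite !(mulrDl _ _ (X + Y + Z)).
by apply: lerD; [apply: lerD => //; rewrite -mulrDl|].
Qed.

(** * The convergence rate *)

Lemma sample_lip_ge0 (R : realType) (Lf L1 L2 rho : R) : 0 <= sample_lip Lf L1 L2 rho.
Proof.
rewrite addr_ge0 ?sqr_ge0// mulr_ge0// addr_ge0 ?sqr_ge0//.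
by apply: mulr_ge0; exact: sqr_ge0.
Qed.

Lemma sample_variance_ge0 (R : realType) (sf sg1 sg2 rho : R) :
  0 <= sample_variance sf sg1 sg2 rho.
Proof.
rewrite addr_ge0 ?sqr_ge0// addr_ge0 ?sqr_ge0//.
by apply: mulr_ge0; exact: sqr_ge0.
Qed.

(* Below, these constants enter through their signs only. *)
#[local] Opaque y_coupling z_coupling noise_gain drift_gain hyper_lip y_weight z_weight
  sample_lip sample_variance hypergrad exact_dir.

Section Run.
Context {R : realType} {dx dy : nat} {dXi dZeta : measure_display}.
Context {Xi : measurableType dXi} {Zeta : measurableType dZeta}.
Variables (QXi : probability Xi R) (QZeta : probability Zeta R).
Variables (F : 'cV[R]_(dx + dy) -> Xi -> R) (G : 'cV[R]_(dx + dy) -> Zeta -> R).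
Variables (f g : 'cV[R]_(dx + dy) -> R) (Lf Cf L1 L2 mu sf sg1 sg2 m : R).
Hypotheses (Lf_gt0 : 0 < Lf) (Cf_gt0 : 0 < Cf) (L1_gt0 : 0 < L1)
  (L2_gt0 : 0 < L2) (mu_gt0 : 0 < mu).
Hypotheses (f_mean : expectation_of QXi F f) (g_mean : expectation_of QZeta G g).
Hypotheses (f_diff : everywhere_differentiable f) (g_diff : twice_differentiable g).
Hypotheses (F_diff : forall xi, everywhere_differentiable (F^~ xi))
  (G_diff : forall zeta, twice_differentiable (G^~ zeta)).
Hypotheses (f_lip : lipschitz_grad Lf f) (g_lip1 : lipschitz_grad L1 g)
  (g_lip2 : lipschitz_hess L2 g).
Hypothesis g_sc : forall x, strongly_convex mu (fun y : 'cV[R]_dy => g (col_mx x y)).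
Hypothesis f_bound : forall x, enorm (grad2 f x (lower_sol g x)) <= Cf.
Hypotheses (F_lip : forall xi, lipschitz_grad Lf (F^~ xi))
  (G_lip1 : forall zeta, lipschitz_grad L1 (G^~ zeta))
  (G_lip2 : forall zeta, lipschitz_hess L2 (G^~ zeta)).
Hypotheses (F_var : grad_variance_le QXi F f sf)
  (G_var1 : grad_variance_le QZeta G g sg1) (G_var2 : hess_variance_le QZeta G g sg2).
Hypothesis H_ge : forall x, m <= hyperobjective f g x.

Let r := Cf / mu.
Let r_gt0 : 0 < r. Proof. exact: divr_gt0. Qed.
Let LH := hyper_lip Lf Cf L1 L2 mu.
Let cy := y_coupling Lf Cf L1 L2 mu.
Let cz := z_coupling Lf Cf L1 L2 mu.
Let M := noise_gain Lf Cf L1 L2 mu.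
Let N := drift_gain Lf Cf L1 L2 mu.
Let n : R := #|{: 'I_dx + 'I_dy + 'I_dy}|%:R.
Let VL rho := n * sample_lip Lf L1 L2 rho.
Let VS rho := n * sample_variance sf sg1 sg2 rho.
Local Notation pot := (potential f g Lf Cf L1 L2 mu).

Let LH0 : 0 < LH. Proof. exact: hyper_lip_gt0. Qed.
Let cy0 : 0 < cy. Proof. exact: y_coupling_gt0. Qed.
Let cz0 : 0 < cz. Proof. exact: z_coupling_gt0. Qed.
Let M0 : 0 < M. Proof. exact: noise_gain_gt0. Qed.
Let N0 : 0 < N. Proof. exact: drift_gain_gt0. Qed.
Let n0 : 0 <= n. Proof. exact: ler0n. Qed.

Let VL0 rho : 0 <= VL rho. Proof. exact: mulr_ge0 n0 (sample_lip_ge0 _ _ _ rho). Qed.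
Let VS0 rho : 0 <= VS rho. Proof. exact: mulr_ge0 n0 (sample_variance_ge0 _ _ _ rho). Qed.

Lemma potential_ge v : m <= pot v.
Proof.
rewrite /potential -addrA; apply: (le_trans (H_ge (tx v))); rewrite lerDl.
by apply: addr_ge0; apply: mulr_ge0; rewrite ?sqr_ge0//; apply/ltW/divr_gt0;
  [exact: y_weight_gt0|exact: cy0|exact: z_weight_gt0|exact: cz0].
Qed.

(** The step cap is the inverse of [1] plus the sum of all the quantities whose
    product with the step has to be at most [1]. *)
Definition step_loads : R := 4 * LH + cy * L1 ^+ 2 / mu + cy * mu
  + cz * L1 ^+ 2 / mu + cz * mu + 8 * ((M + 1) * VL r * N).

Definition max_step : R := (1 + step_loads)^-1.

Let MVN0 : 0 <= (M + 1) * VL r * N.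
Proof.
apply: mulr_ge0; last exact: ltW.
by apply: mulr_ge0 => //; apply: addr_ge0 => //; exact: ltW.
Qed.

Let loads : [/\ 0 <= step_loads, 4 * LH <= step_loads,
    8 * ((M + 1) * VL r * N) <= step_loads &
  [/\ cy * L1 ^+ 2 / mu <= step_loads, cy * mu <= step_loads,
    cz * L1 ^+ 2 / mu <= step_loads & cz * mu <= step_loads]].
Proof.
have P1 : 0 <= 4 * LH by rewrite mulr_ge0// ltW.
have P2 : 0 <= cy * L1 ^+ 2 / mu by rewrite divr_ge0 ?(ltW mu_gt0)// mulr_ge0 ?sqr_ge0// ltW.
have P3 : 0 <= cy * mu by rewrite mulr_ge0// ltW.
have P4 : 0 <= cz * L1 ^+ 2 / mu by rewrite divr_ge0 ?(ltW mu_gt0)// mulr_ge0 ?sqr_ge0// ltW.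
have P5 : 0 <= cz * mu by rewrite mulr_ge0// ltW.
have P6 : 0 <= 8 * ((M + 1) * VL r * N) by exact: mulr_ge0.
rewrite /step_loads; move: (4 * LH) (cy * L1 ^+ 2 / mu) (cy * mu) (cz * L1 ^+ 2 / mu) (cz * mu)
  (8 * ((M + 1) * VL r * N)) P1 P2 P3 P4 P5 P6 => x1 x2 x3 x4 x5 x6 *.
by split; [lra|lra|lra|split; lra].
Qed.

Lemma max_step_gt0 : 0 < max_step.
Proof. by case: loads => l0 _ _ _; rewrite invr_gt0 ltr_pwDl. Qed.

Let max_step_mul x : x <= step_loads -> max_step * x <= 1.
Proof.
case: loads => l0 _ _ _ xl.
rewrite /max_step mulrC ler_pdivrMr ?mul1r ?(le_trans xl) ?lerDr//.
by rewrite ltr_pwDl.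
Qed.

Let max_step_le1 : max_step <= 1.
Proof. by case: loads => l0 _ _ _; rewrite invf_le1 ?ltr_pwDl// lerDl. Qed.

Lemma step_conditions a : 0 < a -> a <= max_step -> [/\ a * LH <= 4^-1,
  cy * a * L1 ^+ 2 <= mu, cy * a * mu <= 1, cz * a * L1 ^+ 2 <= mu & cz * a * mu <= 1].
Proof.
move=> a0 am; case: loads => _ h1 _ [h2 h3 h4 h5].
have Hm x : 0 <= x -> x <= step_loads -> a * x <= 1.
  move=> x0 /max_step_mul; apply: le_trans; exact: ler_wpM2r.
have m0 := mu_gt0.
have c0 := ltW cy0; have c0' := ltW cz0.
have Ga c : 0 <= c -> c * L1 ^+ 2 / mu <= step_loads -> c * a * L1 ^+ 2 <= mu.
  move=> cc /Hm; rewrite mulrA ler_pdivrMr// mul1r mulrA [a * c]mulrC; apply.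
  by rewrite divr_ge0 ?(ltW m0)// mulr_ge0 ?sqr_ge0.
have Gb c : 0 <= c -> c * mu <= step_loads -> c * a * mu <= 1.
  move=> cc /Hm; rewrite mulrA [a * c]mulrC; apply.
  by rewrite mulr_ge0// ltW.
split; [|exact: Ga|exact: Gb|exact: Ga|exact: Gb].
have := Hm _ _ h1; rewrite mulr_ge0 ?(ltW LH0)// => /(_ isT).
by move: (LH) => x H; lra.
Qed.

Let max_step_drift : (M + 1) * VL r * N * max_step ^+ 2 <= 8^-1.
Proof.
case: loads => _ _ /max_step_mul H _.
have c0 := ltW max_step_gt0.
have : max_step * (8 * ((M + 1) * VL r * N)) * max_step <= 1.
  by rewrite mulr_ile1// mulr_ge0// mulr_ge0.
by move: ((M + 1) * VL r * N) (max_step) => x y; lra.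
Qed.

#[local] Opaque max_step step_loads.

Section Sampling.
Variables (K b tau : nat) (p Lambda theta : R) (alpha beta gamma : nat -> R).
Variables (um1 u0 : triple R dx dy).
Context {d : measure_display} {Om : measurableType d}.
Variables (P : probability Om R) (D : spaba_draws R dx dy Xi Zeta b tau Om).
Hypotheses (b_gt0 : (0 < b)%N) (tau_gt0 : (0 < tau)%N) (p01 : 0 < p <= 1).
Hypothesis sampling : spaba_sampling QXi QZeta P K p D.
Let q := spaba_ratio p b.
Let ab := max_step / (1 + q).
Hypotheses (K_gt0 : (0 < K)%N) (theta_gt0 : 0 < theta).
Hypothesis alpha_ge : forall k, (k < K)%N -> theta * ab <= alpha k.
Hypothesis alpha_le : forall k, (k < K)%N -> alpha k <= ab.
Hypothesis betaE : forall k, (k < K)%N -> beta k = cy * alpha k.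
Hypothesis gammaE : forall k, (k < K)%N -> gamma k = cz * alpha k.
Let Lam := Lambda * (1 + q + (p * tau%:R)^-1).
Let J0 := enorm (tz u0 - proj_ball r (tz u0)) ^+ 2.
Hypothesis init_le :
  (((1 - p) / p)%:E * init_error P f g r b (init_dir D) um1 u0 <= Lam%:E)%E.

Local Notation st k om := (spaba F G r alpha beta gamma um1 u0 D k om).
Let u k om := cur_pt (st k om).
Let V k om := pot (u k om) - m.
Let er k om := sqdist (prev_dir (st k om)) (exact_dir f g (prev_pt (st k om))).
Let PE k : \bar R := \int[P]_om (er k om)%:E.
Let EV k : \bar R := \int[P]_om (V k om)%:E.
Let GH k : \bar R := \int[P]_om (enorm (hypergrad f g (tx (u k om))) ^+ 2)%:E.
Let DI k : \bar R := \int[P]_om (sqdist (u k.+1 om) (u k om))%:E.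
Let J k := if k is 0%N then J0 else 0.
Let kap := (M + 1) * VL r * (ab * q ^+ 2).
Let w := (M + 1) * ab / p.

Let p_gt0 : 0 < p. Proof. by case/andP: p01. Qed.
Let p_le1 : 0 <= 1 - p. Proof. by rewrite subr_ge0; case/andP: p01. Qed.
Let bR : 0 < b%:R :> R. Proof. by rewrite ltr0n. Qed.
Let tauR : 0 < tau%:R :> R. Proof. by rewrite ltr0n. Qed.
Let q_ge0 : 0 <= q. Proof. exact: sqrtr_ge0. Qed.
Let q_sq : q ^+ 2 = (1 - p) / (p * b%:R).
Proof. by rewrite sqr_sqrtr// divr_ge0// mulr_ge0// ltW. Qed.
Let q1 : 0 < 1 + q. Proof. by rewrite ltr_pwDl. Qed.
Let ab_gt0 : 0 < ab. Proof. by rewrite divr_gt0// max_step_gt0. Qed.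
Let alpha_gt0 k : (k < K)%N -> 0 < alpha k.
Proof. by move=> /alpha_ge; apply: lt_le_trans; exact: mulr_gt0. Qed.
Let M1 : 0 < M + 1. Proof. by rewrite addr_gt0. Qed.
Let w_gt0 : 0 < w. Proof. by rewrite divr_gt0// mulr_gt0. Qed.
Let kap_ge0 : 0 <= kap.
Proof. by apply: mulr_ge0; apply: mulr_ge0; rewrite ?sqr_ge0// ltW. Qed.

Let mstate k : (k <= K)%N -> mtriple (u k) /\ mtriple (fun om => prev_dir (st k om)) /\
  mtriple (fun om => prev_pt (st k om)).
Proof.
move=> kK; have [? ? ?] := mstate_draws sampling (ltW Lf_gt0) (ltW L1_gt0) (ltW L2_gt0)
  f_mean g_mean F_diff G_diff F_lip G_lip1 G_lip2 r_gt0 alpha beta gamma um1 u0 kK.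
by split.
Qed.

Let mV k : (k <= K)%N -> measurable_fun setT (V k).
Proof.
move=> kK; apply: measurable_funB; last exact: measurable_cst.
apply: (measurable_potential Lf_gt0 L1_gt0 L2_gt0 mu_gt0 f_diff g_diff f_lip g_lip1 g_lip2 g_sc f_bound).
exact: (mstate kK).1.
Qed.

Let mGH k : (k <= K)%N ->
  measurable_fun setT (fun om => enorm (hypergrad f g (tx (u k om))) ^+ 2).
Proof.
move=> kK.
apply: (measurable_hypergrad_sq Lf_gt0 L1_gt0 L2_gt0 mu_gt0 f_diff g_diff f_lip g_lip1 g_lip2 g_sc f_bound).
exact: (mstate kK).1.
Qed.

Let mer k : (k <= K)%N -> measurable_fun setT (er k).
Proof.
move=> kK; have [_ [md mp]] := mstate kK; apply: measurable_sqdist md _.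
exact: (mtriple_exact_dir (ltW Lf_gt0) (ltW L1_gt0) (ltW L2_gt0) f_diff g_diff f_lip g_lip1 g_lip2 mp).
Qed.

Let V_ge0 k om : 0 <= V k om. Proof. by rewrite subr_ge0 potential_ge. Qed.
Let er_ge0 k om : 0 <= er k om. Proof. exact: sqdist_ge0. Qed.
Let J_ge0 k : 0 <= J k. Proof. by case: k => [|k] //=; exact: sqr_ge0. Qed.

Let EV_ge0 k : (0 <= EV k)%E.
Proof. by apply: integral_ge0 => om _; rewrite lee_fin. Qed.
Let PE_ge0 k : (0 <= PE k)%E.
Proof. by apply: integral_ge0 => om _; rewrite lee_fin. Qed.
Let GH_ge0 k : (0 <= GH k)%E.
Proof. by apply: integral_ge0 => om _; rewrite lee_fin sqr_ge0. Qed.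
Let DI_ge0 k : (0 <= DI k)%E.
Proof. by apply: integral_ge0 => om _; rewrite lee_fin sqdist_ge0. Qed.

Let in_ball k om : (0 < k)%N -> enorm (tz (u k om)) <= r.
Proof. by case: k => // k _; exact: enorm_proj_ball. Qed.

(** The error [er k.+1] is that of the direction used in this step. The term
    [J k] vanishes for [k > 0], since these iterates have their [z] in the ball. *)
Lemma path_step k om : (k < K)%N ->
  V k.+1 om + alpha k / 2 * enorm (hypergrad f g (tx (u k om))) ^+ 2
    + kap * sqdist (u k.+1 om) (u k om)
  <= V k om + (M + 1) * ab * er k.+1 om + kap * (2 * J k).
Proof.
move=> kK; have a0 := alpha_gt0 kK; have aab := alpha_le kK.
have q0 := q_ge0; have qq := q1; have ms := max_step_gt0.
have abm : ab <= max_step by rewrite ler_pdivrMr// ler_peMr ?(ltW ms)// lerDl.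
have [c1 c2 c3 c4 c5] := step_conditions a0 (le_trans aab abm).
pose v := prev_dir (st k.+1 om).
have uE : u k.+1 om = spaba_update r (alpha k) (cy * alpha k) (cz * alpha k) (u k om) v.
  by rewrite -(betaE kK) -(gammaE kK).
have S1 := potential_step Lf_gt0 Cf_gt0 L1_gt0 L2_gt0 mu_gt0 f_diff g_diff f_lip g_lip1
  g_lip2 g_sc f_bound (u k om) v a0 c1 c2 c3 c4 c5.
have S2 := drift_step Cf_gt0 L1_gt0 L2_gt0 mu_gt0 g_diff f_lip g_lip1
  g_lip2 g_sc f_bound (u k om) v a0.
rewrite -/r -/cy -/cz -uE in S1 S2.
have erE : er k.+1 om = sqdist v (exact_dir f g (u k om)) by [].
rewrite -!erE in S1 S2.
have JE : enorm (tz (u k om) - proj_ball r (tz (u k om))) ^+ 2 = J k.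
  have: (k = 0%N) \/ (0 < k)%N by case: (k); [left|right].
  case=> [->//|k0]; rewrite proj_ball_id ?in_ball// subrr enorm0 expr0n.
  by case: (k) k0.
rewrite JE in S2.
have abq : ab * q <= max_step.
  by rewrite /ab mulrAC ler_pdivrMr// ler_wpM2l ?(ltW ms)// lerDr.
apply: (path_balance (N := N) a0 aab (ltW M0) kap_ge0 _ _ _ _ (er_ge0 _ _) _ S2).
- have -> : kap * N = (M + 1) * VL r * N * (ab * q ^+ 2) by rewrite /kap mulrAC.
  apply: (drift_coefficient a0 q0 MVN0 _ _ max_step_drift).
  + by apply/andP; split; [exact: mulr_ge0 (ltW ab_gt0) q0|exact: abq].
  + apply/andP; split; first exact: mulr_ge0 (ltW a0) q0.
    exact: le_trans (ler_wpM2r q0 aab) abq.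
- exact: sqr_ge0.
- exact: sqr_ge0.
- exact: sqr_ge0.
- exact: subtract_bound S1.
Qed.

Lemma expected_step k : (k < K)%N ->
  (EV k.+1 + (alpha k / 2)%:E * GH k + kap%:E * DI k <=
   EV k + ((M + 1) * ab)%:E * PE k.+1 + (kap * (2 * J k))%:E)%E.
Proof.
move=> kK; have a0 := alpha_gt0 kK.
have [mu1 _] := mstate kK; have [mu0 _] := mstate (ltnW kK).
have msq := measurable_sqdist mu1 mu0.
have Mab : 0 <= (M + 1) * ab by rewrite mulr_ge0// ltW.
have a2 : 0 <= alpha k / 2 by rewrite divr_ge0// ltW.
have j0 : 0 <= kap * (2 * J k) by exact: mulr_ge0 kap_ge0 (mulr_ge0 (ler0n _ 2) (J_ge0 k)).
apply: (@integrate_balance R _ _ P (V k.+1) (V k)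
  (fun om => enorm (hypergrad f g (tx (u k om))) ^+ 2)
  (fun om => sqdist (u k.+1 om) (u k om)) (er k.+1) _ _ _ _ a2 kap_ge0 Mab j0
  (V_ge0 k.+1) (V_ge0 k) _ _ (er_ge0 k.+1)).
- by move=> om; exact: sqr_ge0.
- by move=> om; exact: sqdist_ge0.
- exact: mV kK.
- exact: mV (ltnW kK).
- exact: mGH (ltnW kK).
- exact: msq.
- exact: mer kK.
- by move=> om; exact: path_step.
Qed.

Let error_step k rho : (k < K)%N -> 0 < rho -> (forall om, enorm (tz (u k om)) <= rho) ->
  (PE k.+1 <= (p * (VS rho / tau%:R))%:E + (1 - p)%:E * (PE k + (VL rho / b%:R)%:E *
      \int[P]_om (sqdist (u k om) (prev_pt (st k om)))%:E))%E.
Proof.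
move=> kK rho0 zb.
have := estimator_step sampling p01 (ltW Lf_gt0) (ltW L1_gt0) (ltW L2_gt0) f_mean g_mean
  f_diff g_diff F_diff G_diff f_lip g_lip1 g_lip2 F_lip G_lip1 G_lip2 F_var G_var1 G_var2
  r_gt0 b_gt0 tau_gt0 kK rho0 zb.
rewrite -/n (_ : n * (p * _) = p * (VS rho / tau%:R)); last first.
  by rewrite /VS [_^-1 * _]mulrC !mulrA; congr (_ * _ / _); exact: mulrC.
rewrite (_ : n * (b%:R^-1 * _) = VL rho / b%:R); last first.
  by rewrite /VL [b%:R^-1 * _]mulrC mulrA.
by [].
Qed.

Let rho0 := enorm (tz u0) + 1.

(** At the starting point [z_0] is arbitrary, so the estimator constants are
    those of a ball containing it. *)
Let first_error :
  (w%:E * PE 1 <= ((M + 1) * ab * (VS rho0 / tau%:R + (1 + VL rho0) * Lam))%:E)%E.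
Proof.
have rho_gt0 : 0 < rho0 by rewrite /rho0 ltr_pwDr// enorm_ge0.
have zb om : enorm (tz (u 0 om)) <= rho0 by rewrite lerDl.
have := error_step K_gt0 rho_gt0 zb.
have dE : (\int[P]_om (sqdist (u 0 om) (prev_pt (st 0 om)))%:E = (sqdist u0 um1)%:E)%E.
  exact: (integral_cst_prob P (sqdist u0 um1)).
rewrite dE.
move=> H; have {}H := first_error_bound p01 (VL0 rho0) bR (sqdist_ge0 u0 um1) (J_ge0 0)
  (PE_ge0 0) H init_le.
have Mab : (0 <= ((M + 1) * ab)%:E)%E by rewrite lee_fin mulr_ge0// ltW.
by have := lee_wpmul2l Mab H; rewrite muleA -!EFinM.
Qed.

Let jump_bound : kap * (2 * J0) <= 2 * (M + 1) * VL r * ab * Lam.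
Proof.
have qJ : q ^+ 2 * J0 <= Lam.
  have c0 : (0 <= ((1 - p) / p)%:E)%E by rewrite lee_fin divr_ge0// ltW.
  rewrite q_sq -lee_fin; apply: le_trans init_le.
  rewrite (_ : (1 - p) / (p * b%:R) * J0 = (1 - p) / p * (J0 / b%:R)); last first.
    by rewrite invfM; move: (J0) => x; ring.
  rewrite EFinM; apply: (lee_wpmul2l c0); apply: (@le_trans _ _
    ((sqdist u0 um1 + J0) / b%:R)%:E).
    by rewrite lee_fin ler_pM2r ?invr_gt0// lerDr sqdist_ge0.
  exact: (leeDr _ (PE_ge0 0)).
rewrite (_ : kap * (2 * J0) = 2 * (M + 1) * VL r * ab * (q ^+ 2 * J0)); last first.
  by rewrite /kap; ring.
apply: (ler_wpM2l _ qJ); apply: mulr_ge0 (ltW ab_gt0); apply: mulr_ge0 => //.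
by apply: mulr_ge0 => //; exact: ltW.
Qed.

Let S k : \bar R := (\sum_(0 <= j < k) (alpha j / 2)%:E * GH j)%E.
Let B k : R := pot u0 - m + (M + 1) * ab * (VS rho0 / tau%:R + (1 + VL rho0) * Lam)
  + k%:R * ((M + 1) * ab * (VS r / tau%:R)) + \sum_(0 <= j < k) kap * (2 * J j).

Let aGH_ge0 k : (k < K)%N -> (0 <= (alpha k / 2)%:E * GH k)%E.
Proof.
by move=> kK; apply: mule_ge0 => //; rewrite lee_fin divr_ge0// ltW// alpha_gt0.
Qed.

Let S_ge0 k : (k <= K)%N -> (0 <= S k)%E.
Proof.
move=> kK; rewrite /S big_nat_cond; apply: sume_ge0 => j; rewrite andbT => /andP[_ jk].
exact/aGH_ge0/(leq_trans jk).
Qed.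

Let EV0 : EV 0 = (pot u0 - m)%:E.
Proof. exact: (integral_cst_prob P (pot u0 - m)). Qed.

(** The weight [w] is such that [w (1 - p) = w - (M + 1) ab]: the loss in the
    estimator error is what the potential step consumes. The same weight turns the
    drift coefficient [VL / b] of the estimator into [kap]. *)
Let lyapunov_sum k : (k < K)%N -> (S k + EV k + w%:E * PE k.+1 <= (B k)%:E)%E.
Proof.
elim: k => [_|k IH kK].
  rewrite /S /B !big_nil add0e EV0 mul0r !addr0 EFinD.
  exact: leeD2l first_error.
have {}IH := IH (ltnW kK).
have He := error_step kK r_gt0 (fun om => in_ball om (ltn0Sn k)).
have a0 : 0 <= p * (VS r / tau%:R).
  by apply: mulr_ge0 (ltW p_gt0) _; apply: divr_ge0 (VS0 r) (ltW tauR).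
have l0 : 0 <= VL r / b%:R by apply: divr_ge0 (VL0 r) (ltW bR).
have pn0 : p != 0 by rewrite gt_eqF.
have bn0 : b%:R != 0 :> R by rewrite gt_eqF.
have wq : w * (1 - p) = w - (M + 1) * ab by rewrite /w; field.
have wl : w * (1 - p) * (VL r / b%:R) = kap.
  by rewrite /kap /w q_sq; field; rewrite pn0 bn0.
have := telescope_step (S_ge0 (ltnW (ltnW kK))) (EV_ge0 k) (EV_ge0 k.+1) (PE_ge0 k.+1)
  (PE_ge0 k.+2) (aGH_ge0 (ltnW kK)) (DI_ge0 k) w_gt0 kap_ge0 a0 p_le1 l0 wq wl IH
  (expected_step (ltnW kK)) He.
rewrite (_ : B k + w * (p * (VS r / tau%:R)) + kap * (2 * J k) = B k.+1).
  by rewrite /S big_nat_recr.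
rewrite /B big_nat_recr//= (_ : w * (p * (VS r / tau%:R)) = (M + 1) * ab * (VS r / tau%:R)).
  by rewrite -natr1; ring.
by rewrite /w (mulrA _ p) divfK.
Qed.

Let descent_sum :
  (S K <= (pot u0 - m + (M + 1) * ab * (VS rho0 / tau%:R + (1 + VL rho0) * Lam)
    + K.-1%:R * ((M + 1) * ab * (VS r / tau%:R)) + kap * (2 * J0))%:E)%E.
Proof.
have kK : (K.-1 < K)%N by rewrite prednK.
have cw : (M + 1) * ab <= w.
  rewrite /w ler_pdivlMr// ler_piMr//; first by rewrite mulr_ge0// ltW.
  by case/andP: p01.
have := telescope_last (S_ge0 (ltnW kK)) (EV_ge0 _) (EV_ge0 _) (PE_ge0 _) (aGH_ge0 kK)
  (DI_ge0 _) w_gt0 kap_ge0 cw (lyapunov_sum kK) (expected_step kK).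
rewrite (_ : (S K.-1 + _)%E = S K); last by rewrite -[in RHS](prednK K_gt0) /S big_nat_recr.
rewrite (_ : B K.-1 + kap * (2 * J K.-1) = pot u0 - m +
  (M + 1) * ab * (VS rho0 / tau%:R + (1 + VL rho0) * Lam)
    + K.-1%:R * ((M + 1) * ab * (VS r / tau%:R)) + kap * (2 * J0))//.
rewrite /B -addrA; congr (_ + _).
have -> : \sum_(0 <= j < K.-1) kap * (2 * J j) + kap * (2 * J K.-1) =
    \sum_(0 <= j < K.-1.+1) kap * (2 * J j) by rewrite big_nat_recr.
rewrite big_nat_recl//= big1 ?addr0// => j _; by rewrite !mulr0.
Qed.

(** It depends on the problem, on [u0], [theta] and [Lambda] only. The summand
    [1] makes it positive. *)
Definition rate_constant : R := 2 / theta *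
  ((pot u0 - m) / max_step + (M + 1) *
    (VS rho0 + (1 + VL rho0 + 2 * VL r) * `|Lambda| + VS r)) + 1.

Lemma rate_constant_gt0 : 0 < rate_constant.
Proof.
rewrite /rate_constant ltr_wpDl//; apply: mulr_ge0; first by rewrite divr_ge0// ltW.
apply: addr_ge0; first by rewrite divr_ge0 ?subr_ge0 ?potential_ge// ltW// max_step_gt0.
apply: mulr_ge0; first exact: ltW.
by rewrite !addr_ge0// mulr_ge0// addr_ge0// ?addr_ge0// mulr_ge0.
Qed.

(** Every step size is at least [theta * ab], which turns the weighted sum of the
    squared gradients into their average. *)
Lemma gradient_rate :
  ((K%:R^-1)%:E * \sum_(0 <= k < K) GH k <=
   (rate_constant * ((1 + q) / K%:R + (K%:R * p * tau%:R)^-1 + 1 / tau%:R))%:E)%E.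
Proof.
have KR : 0 < K%:R :> R by rewrite ltr0n.
have ta : 0 < theta * ab by exact: mulr_gt0.
have k1 : 0 <= (K.-1%:R : R) <= K%:R by rewrite ler0n ler_nat leq_pred.
have V00 : 0 <= pot u0 - m by rewrite subr_ge0 potential_ge.
have A0 : 0 <= 1 + VL rho0 by exact: addr_ge0.
have := rate_arithmetic KR p01 tauR max_step_gt0 q1 theta_gt0 V00 (ltW M1) (VS0 rho0) (VS0 r)
  A0 (VL0 r) k1 (erefl ab) jump_bound.
rewrite -lee_fin; apply: le_trans.
rewrite EFinM; apply: lee_wpmul2l; first by rewrite lee_fin invr_ge0 ltW.
rewrite EFinM.
have c0 : (0 <= (2 / (theta * ab))%:E)%E by rewrite lee_fin divr_ge0// ltW.
apply: le_trans (lee_wpmul2l c0 descent_sum).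
rewrite /S big_nat_cond [in leRHS]big_nat_cond ge0_sume_distrr; last first.
  by move=> j; rewrite andbT => /andP[_ jK]; exact: aGH_ge0.
apply: lee_sum => j; rewrite andbT => /andP[_ jK].
rewrite muleA -EFinM -[leLHS]mul1e; apply: lee_wpmul2r => //; rewrite lee_fin.
rewrite (_ : 2 / (theta * ab) * (alpha j / 2) = alpha j / (theta * ab)).
  by rewrite ler_pdivlMr// mul1r alpha_ge.
by move: (theta * ab) ta => x x0; field; rewrite gt_eqF.
Qed.

End Sampling.
End Run.

Section LipschitzMonotone.
Context {R : realType} {n : nat}.
Variables (L : R) (h : 'cV[R]_n -> R).

(** Enlarging the Lipschitz constants makes them positive. *)
Lemma lipschitz_grad_max1 : lipschitz_grad L h -> lipschitz_grad (Num.max L 1) h.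
Proof.
move=> H w w'; apply: (le_trans (H w w')).
by apply: ler_wpM2r; rewrite ?enorm_ge0// le_max lexx.
Qed.

Lemma lipschitz_hess_max1 : lipschitz_hess L h -> lipschitz_hess (Num.max L 1) h.
Proof.
move=> H w w'; apply: (le_trans (H w w')).
by apply: ler_wpM2r; rewrite ?enorm_ge0// le_max lexx.
Qed.

Lemma max1_gt0 : 0 < Num.max L 1.
Proof. by rewrite lt_max ltr01 orbT. Qed.

End LipschitzMonotone.

Theorem theorem3p9 (R : realType) (dx dy : nat)
    (dXi dZeta : measure_display)
    (Xi : measurableType dXi) (Zeta : measurableType dZeta)
    (QXi : probability Xi R) (QZeta : probability Zeta R)
    (F : 'cV[R]_(dx + dy) -> Xi -> R) (G : 'cV[R]_(dx + dy) -> Zeta -> R)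
    (f g : 'cV[R]_(dx + dy) -> R)
    (Lf Cf L1g L2g mu sigma_f sigma_g1 sigma_g2 : R)
    (* the problem in expectation form *)
    (f_expectation : expectation_of QXi F f)
    (g_expectation : expectation_of QZeta G g)
    (f_smooth : everywhere_differentiable f)
    (g_smooth : twice_differentiable g)
    (F_smooth : forall xi, everywhere_differentiable (F^~ xi))
    (G_smooth : forall zeta, twice_differentiable (G^~ zeta))
    (H_bounded_below : exists m : R, forall x, m <= hyperobjective f g x)
    (* (i) *)
    (f_lipschitz : lipschitz_grad Lf f)
    (Cf_gt0 : 0 < Cf)
    (grad2f_bounded : forall x, enorm (grad2 f x (lower_sol g x)) <= Cf)
    (* (ii) *)
    (g_lipschitz1 : lipschitz_grad L1g g)
    (g_lipschitz2 : lipschitz_hess L2g g)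
    (mu_gt0 : 0 < mu)
    (g_strongly_convex :
      forall x, strongly_convex mu (fun y : 'cV[R]_dy => g (col_mx x y)))
    (* (iii) *)
    (sigma_f_gt0 : 0 < sigma_f)
    (sigma_g1_gt0 : 0 < sigma_g1)
    (sigma_g2_gt0 : 0 < sigma_g2)
    (F_variance : grad_variance_le QXi F f sigma_f)
    (G_variance1 : grad_variance_le QZeta G g sigma_g1)
    (G_variance2 : hess_variance_le QZeta G g sigma_g2)
    (* (iv) *)
    (F_lipschitz : forall xi, lipschitz_grad Lf (F^~ xi))
    (G_lipschitz1 : forall zeta, lipschitz_grad L1g (G^~ zeta))
    (G_lipschitz2 : forall zeta, lipschitz_hess L2g (G^~ zeta)) :
  exists c c_beta c_gamma sigma : R,
    [/\ 0 < c, 0 < c_beta, 0 < c_gamma & 0 < sigma] /\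
    (* C is the constant hidden in the O, uniform in everything bound after it *)
    forall (u0 : triple R dx dy) (theta Lambda : R), 0 < theta ->
    exists C : R, 0 < C /\
    forall (K b tau : nat) (p : R) (alpha beta gamma : nat -> R)
      (um1 : triple R dx dy)
      (d : measure_display) (Om : measurableType d) (P : probability Om R)
      (D : spaba_draws R dx dy Xi Zeta b tau Om),
      (1 < K)%N -> (0 < b < tau)%N -> 0 < p <= 1 ->
      spaba_sampling QXi QZeta P K p D ->
      (((1 - p) / p)%:E * init_error P f g (Cf / mu) b (init_dir D) um1 u0
        <= (Lambda * (1 + spaba_ratio p b + (p * tau%:R)^-1))%:E)%E ->
      (forall k, (k < K)%N ->
        [/\ theta * (c / (1 + spaba_ratio p b)) <= alpha k,
            alpha k <= c / (1 + spaba_ratio p b),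
            beta k = c_beta * alpha k &
            gamma k = c_gamma * alpha k]) ->
      ((K%:R^-1)%:E * \sum_(0 <= k < K)
          \int[P]_om (enorm (grad (hyperobjective f g)
            (spaba_x F G (Cf / mu) alpha beta gamma um1 u0 D k om)) ^+ 2)%:E
        <= (C * ((1 + spaba_ratio p b) / K%:R + (K%:R * p * tau%:R)^-1
                 + sigma / tau%:R))%:E)%E.
Proof.
have [m H_ge] := H_bounded_below.
have Lf0 := max1_gt0 Lf; have L10 := max1_gt0 L1g; have L20 := max1_gt0 L2g.
have fl := lipschitz_grad_max1 f_lipschitz.
have gl1 := lipschitz_grad_max1 g_lipschitz1.
have gl2 := lipschitz_hess_max1 g_lipschitz2.
have Fl xi := lipschitz_grad_max1 (F_lipschitz xi).
have Gl1 zeta := lipschitz_grad_max1 (G_lipschitz1 zeta).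
have Gl2 zeta := lipschitz_hess_max1 (G_lipschitz2 zeta).
move: Lf0 L10 L20 fl gl1 gl2 Fl Gl1 Gl2.
move: (Num.max Lf 1) (Num.max L1g 1) (Num.max L2g 1) => A B C Lf0 L10 L20 fl gl1 gl2 Fl Gl1 Gl2.
(* The Lipschitz constants are now arbitrary positive numbers. *)
exists (max_step (dx := dx) (dy := dy) A Cf B C mu), (y_coupling A Cf B C mu),
  (z_coupling A Cf B C mu), 1; split.
  split; [exact: max_step_gt0|exact: y_coupling_gt0|exact: z_coupling_gt0|exact: ltr01].
move=> u0 theta Lambda theta0.
exists (rate_constant f g A Cf B C mu sigma_f sigma_g1 sigma_g2 m Lambda theta u0).
split; first exact: rate_constant_gt0.
move=> K b tau p alpha beta gamma um1 d Om P D K1 /andP[b0 bt] p01 sampling init_le steps.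
have alpha_ge k (kK : (k < K)%N) := let: And4 h _ _ _ := steps k kK in h.
have alpha_le k (kK : (k < K)%N) := let: And4 _ h _ _ := steps k kK in h.
have betaE k (kK : (k < K)%N) := let: And4 _ _ h _ := steps k kK in h.
have gammaE k (kK : (k < K)%N) := let: And4 _ _ _ h := steps k kK in h.
have := gradient_rate Lf0 Cf_gt0 L10 L20 mu_gt0 f_expectation g_expectation f_smooth g_smooth
  F_smooth G_smooth fl gl1 gl2 g_strongly_convex grad2f_bounded Fl Gl1 Gl2 F_variance
  G_variance1 G_variance2 H_ge b0 (ltn_trans b0 bt) p01 sampling (ltnW K1) theta0
  alpha_ge alpha_le betaE gammaE init_le.
apply: le_trans; apply: lee_wpmul2l; first by rewrite lee_fin invr_ge0 ler0n.
apply: lee_sum => k _; rewrite le_eqVlt; apply/orP; left; apply/eqP.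
apply: eq_integral => om _; rewrite /spaba_x.
by rewrite (grad_hyperobjective Lf0 Cf_gt0 L10 L20 mu_gt0 f_smooth g_smooth fl gl1 gl2
  g_strongly_convex grad2f_bounded).
Qed.
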